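(* Let $R\in\mathbb{C}(t)$ with $R(0)=0$, $R\neq 0$, such that no iterate $R^{\circ n}$ ($n\geq1$) is the identity. Let $\mathbb{F}$ be the field defined in the context, and suppose there exists $\Psi\in\mathbb{F}$ with $\Psi(R(t))=R'(t)\Psi(t)$ (i.e. $\Phi_R(\Psi)=R'\Psi$) such that $\Psi$ is differentially transcendental over $\mathbb{C}(t)$ with respect to $\frac{d}{dt}$. Let $b\in\mathbb{C}(t)$ and let $f\in\mathbb{C}((t))$ satisfy $f(R(t))=f(t)+b(t)$. Then either $f\in\mathbb{C}(t)$ or $f$ is differentially transcendental over $\mathbb{C}(t)$ with respect to $\frac{d}{dt}$.
   Context: $\Phi_R$ denotes the endomorphism $f=\sum_n f_nt^n\mapsto f(R(t))=\sum_nf_nR(t)^n$ of $\mathbb{C}((t))$; rational functions are identified with their expansions. Write $R(t)=r_dt^d(1+u(t))$ with $d\geq1$, $r_d\neq0$, $u\in t\mathbb{C}[[t]]$. If $d=1$ (i.e. $R'(0)\neq0$), $\mathbb{F}=\mathbb{C}((t))$. If $d\geq 2$, $\mathbb{F}=\mathbb{C}((t))(\log t)$: the purely transcendental extension $\mathbb{C}((t))(\ell)$ with derivation extending $\frac{d}{dt}$ by $\ell'=1/t$, and with $\Phi_R$ extended as a field endomorphism by $\Phi_R(\ell)=\lambda+d\ell+\sum_{k\geq1}(-1)^{k+1}u^k/k$, where $\lambda$ is a fixed logarithm of $r_d$ (this realizes $\log R(t)$; $\ell$ plays the role of $\log t$). On $\mathbb{F}$ the chain rule $(\Phi_R(g))'=R'\,\Phi_R(g')$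 holds and the elements fixed by $\Phi_R$ are exactly $\mathbb{C}$. Differential transcendence over $\mathbb{C}(t)$ means satisfying no nontrivial polynomial relation $P(g,g',\dots,g^{(n)})=0$ with coefficients in $\mathbb{C}(t)$. *)

(* Defs.v *)
From HB Require Import structures.
From mathcomp Require Import all_boot all_order all_algebra.
From mathcomp Require Import boolp reals sequences trigo.
From mathcomp Require Import complex ring.
From mathcomp Require Import -(notations) mpoly.

Set Implicit Arguments.
Unset Strict Implicit.
Unset Printing Implicit Defensive.
Import Order.TTheory GRing.Theory Num.Theory.
Local Open Scope ring_scope.
Local Open Scope quotient_scope.

Section FractionField.
Variable A : idomainType.

(* The map x / y |-> f x / f y.  It is computed on the representative chosen by
   the quotient; frac_lift_div shows independence of it when f is an injective
   ring morphism. *)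
Definition frac_lift (K : fieldType) (f : A -> K) (x : {fraction A}) : K :=
  f (\n_(repr x)) / f (\d_(repr x)).

(* The quotient rule, again on a representative. *)
Definition frac_deriv (D : A -> A) (x : {fraction A}) : {fraction A} :=
  let n := \n_(repr x) in let m := \d_(repr x) in
  tofrac (D n * m - n * D m) / tofrac m ^+ 2.

Lemma frac_numden (x : {fraction A}) :
  x = tofrac (\n_(repr x)) / tofrac (\d_(repr x)).
Proof.
rewrite -[LHS]reprK; set y := repr x.
have dy := denom_ratioP y.
have Fdy : tofrac (\d_y) != 0 :> {fraction A} by rewrite tofrac_eq0.
apply: (canRL (mulfK Fdy)); rewrite !piE.
apply/eqmodP; rewrite /= /equivf /FracField.mulf.
by rewrite !numden_Ratio ?mulf_neq0 ?oner_neq0 // !mulr1 mulrC.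
Qed.

Lemma frac_numden_eq (a b : A) (x : {fraction A}) : b != 0 ->
  x = tofrac a / tofrac b -> a * \d_(repr x) = \n_(repr x) * b.
Proof.
move=> b0 xab; have := frac_numden x; rewrite {1}xab.
move=> /eqP; rewrite eqr_div ?tofrac_eq0 ?denom_ratioP //.
by rewrite -!tofracM tofrac_eq => /eqP.
Qed.

Lemma frac_lift_div (K : fieldType) (f : {rmorphism A -> K}) (a b : A) :
  injective f -> b != 0 -> frac_lift f (tofrac a / tofrac b) = f a / f b.
Proof.
move=> f_inj b0; rewrite /frac_lift; set x := (_ / _ : {fraction A}).
have f0 c : c != 0 -> f c != 0 by rewrite -(inj_eq f_inj) rmorph0.
apply/eqP; rewrite eqr_div ?f0 ?denom_ratioP // -!rmorphM /=.
by rewrite -(frac_numden_eq b0 (erefl x)).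
Qed.

Lemma frac_lift_zmod_morphism (K : fieldType) (f : {rmorphism A -> K}) :
  injective f -> zmod_morphism (frac_lift f).
Proof.
move=> f_inj x y; rewrite {1}(frac_numden x) {1}(frac_numden y) /frac_lift.
set a := \n_(repr x); set b := \d_(repr x).
set c := \n_(repr y); set d := \d_(repr y).
have [b0 d0] : b != 0 /\ d != 0 by split; apply: denom_ratioP.
have f0 e : e != 0 -> f e != 0 by rewrite -(inj_eq f_inj) rmorph0.
rewrite -[LHS]/(frac_lift f _) -mulNr addf_div ?tofrac_eq0 //.
rewrite -tofracN -!tofracM -tofracD frac_lift_div ?mulf_neq0 //.
by rewrite -mulNr addf_div ?f0 // !(rmorphM, rmorphD, rmorphN).
Qed.

Lemma frac_lift_monoid_morphism (K : fieldType) (f : {rmorphism A -> K}) :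
  injective f -> monoid_morphism (frac_lift f).
Proof.
move=> f_inj; split=> [|x y].
  have -> : 1 = tofrac 1 / tofrac 1 :> {fraction A} by rewrite tofrac1 divr1.
  by rewrite frac_lift_div ?oner_neq0 // rmorph1 divr1.
rewrite {1}(frac_numden x) {1}(frac_numden y) mulf_div -!tofracM.
by rewrite frac_lift_div ?mulf_neq0 ?denom_ratioP // !rmorphM -mulf_div.
Qed.

Lemma frac_deriv_div (D : {additive A -> A}) (a b : A) :
  (forall x y, D (x * y) = D x * y + x * D y) -> b != 0 ->
  frac_deriv D (tofrac a / tofrac b) =
  tofrac (D a * b - a * D b) / tofrac b ^+ 2.
Proof.
move=> DM b0; rewrite /frac_deriv; set x := (tofrac a / tofrac b).
have := frac_numden_eq b0 (erefl x); have := denom_ratioP (repr x).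
set n := \n_(repr x); set m := \d_(repr x) => m0 amnb.
have Da : D a * m + a * D m = D n * b + n * D b by rewrite -!DM amnb.
apply/eqP; rewrite eqr_div ?expf_neq0 ?tofrac_eq0 // -!tofracXn -!tofracM.
rewrite tofrac_eq; apply/eqP.
have -> : (D n * m - n * D m) * b ^+ 2 =
  (D n * b + n * D b) * m * b - (n * b) * (D b * m + D m * b) by ring.
by rewrite -Da -amnb; ring.
Qed.

End FractionField.

Record pseries (A : Type) := PSeries { pscoef : nat -> A }.

HB.instance Definition _ (A : Type) := [isNew for @pscoef A].
HB.instance Definition _ (A : choiceType) := [Choice of pseries A by <:].

Section PowerSeries.
Variable C : fieldType.
Implicit Types (f g h s u : pseries C) (p q : {poly C}).

Lemma psP f g : pscoef f =1 pscoef g <-> f = g.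
Proof. by split=> [fg|-> //]; apply: val_inj; apply/funext. Qed.

Definition ps_of_poly p : pseries C := PSeries (fun n => p`_n).
Definition ps_opp f : pseries C := PSeries (fun n => - pscoef f n).
Definition ps_add f g : pseries C :=
  PSeries (fun n => pscoef f n + pscoef g n).
Definition ps_mul f g : pseries C :=
  PSeries (fun n => \sum_(i < n.+1) pscoef f i * pscoef g (n - i)).

Fact ps_addA : associative ps_add.
Proof. by move=> f g h; apply/psP => n /=; rewrite addrA. Qed.
Fact ps_addC : commutative ps_add.
Proof. by move=> f g; apply/psP => n /=; rewrite addrC. Qed.
Fact ps_add0 : left_id (ps_of_poly 0) ps_add.
Proof. by move=> f; apply/psP => n /=; rewrite coef0 add0r. Qed.
Fact ps_addN : left_inverse (ps_of_poly 0) ps_opp ps_add.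
Proof. by move=> f; apply/psP => n /=; rewrite coef0 addNr. Qed.

HB.instance Definition _ :=
  GRing.isZmodule.Build (pseries C) ps_addA ps_addC ps_add0 ps_addN.

Definition ps_trunc n f : {poly C} := \poly_(i < n.+1) pscoef f i.

Lemma ps_truncE n f i : (i <= n)%N -> (ps_trunc n f)`_i = pscoef f i.
Proof. by move=> le_in; rewrite coef_poly ltnS le_in. Qed.

Lemma coefM_eq_le n (p p' q q' : {poly C}) :
  (forall i, (i <= n)%N -> p`_i = p'`_i) ->
  (forall i, (i <= n)%N -> q`_i = q'`_i) -> (p * q)`_n = (p' * q')`_n.
Proof.
move=> pp qq; rewrite !coefM; apply: eq_bigr => i _.
by rewrite pp ?qq ?leq_subr // -ltnS.
Qed.

Lemma ps_mul_trunc n m f g : (m <= n)%N ->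
  pscoef (ps_mul f g) m = (ps_trunc n f * ps_trunc n g)`_m.
Proof.
move=> le_mn; rewrite coefM /=; apply: eq_bigr => i _.
by rewrite !ps_truncE // ?(leq_trans (leq_subr _ _)) // (leq_trans _ le_mn) //
  -ltnS.
Qed.

Fact ps_mulA : associative ps_mul.
Proof.
move=> f g h; apply/psP => n; rewrite !(@ps_mul_trunc n n) //.
transitivity (ps_trunc n f * (ps_trunc n g * ps_trunc n h))`_n.
  by apply: coefM_eq_le => // i le_in; rewrite ps_truncE // (ps_mul_trunc _ _ le_in).
rewrite mulrA; apply: coefM_eq_le => // i le_in.
by rewrite ps_truncE // (ps_mul_trunc _ _ le_in).
Qed.

Fact ps_mulC : commutative ps_mul.
Proof. by move=> f g; apply/psP => n; rewrite !(@ps_mul_trunc n n) // mulrC. Qed.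

Fact ps_mul1 : left_id (ps_of_poly 1) ps_mul.
Proof.
move=> f; apply/psP => n /=.
rewrite big_ord_recl /= coef1 mul1r subn0 big1 ?addr0 // => i _.
by rewrite coef1 mul0r.
Qed.

Fact ps_mulDl : left_distributive ps_mul ps_add.
Proof.
move=> f g h; apply/psP => n /=; rewrite -big_split /=.
by apply: eq_bigr => i _; rewrite mulrDl.
Qed.

Fact ps_one_neq0 : ps_of_poly 1 != 0.
Proof.
apply/eqP => /psP/(_ 0%N) /= /eqP; rewrite coef1 coef0 /=.
by rewrite (negbTE (oner_neq0 C)).
Qed.

HB.instance Definition _ := GRing.Zmodule_isComNzRing.Build (pseries C)
  ps_mulA ps_mulC ps_mul1 ps_mulDl ps_one_neq0.

Definition ps_unit : {pred pseries C} := fun f => `[< exists g, g * f = 1 >].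

Definition ps_inv f : pseries C :=
  if pselect (exists g, g * f = 1) is left e then sval (cid e) else f.

Fact ps_mulV : {in ps_unit, left_inverse 1 ps_inv *%R}.
Proof.
move=> f /asboolP uf; rewrite /ps_inv; case: pselect => // e.
by case: (cid e).
Qed.

Fact ps_unitP f g : g * f = 1 -> ps_unit f.
Proof. by move=> gf; apply/asboolP; exists g. Qed.

Fact ps_inv_out : {in [predC ps_unit], ps_inv =1 id}.
Proof.
by move=> f /= /asboolPn uf; rewrite /ps_inv; case: pselect.
Qed.

HB.instance Definition _ := GRing.ComNzRing_hasMulInverse.Build (pseries C)
  ps_mulV ps_unitP ps_inv_out.

Lemma ps_order f : f != 0 -> exists n, pscoef f n != 0 /\
  forall i, (i < n)%N -> pscoef f i = 0.
Proof.
move=> f0; have ex : exists n, pscoef f n != 0.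
  apply: contrapT => nex; case/eqP: f0; apply/psP => n /=.
  by rewrite coef0; apply/eqP; apply: contrapT => /negP fn; apply: nex; exists n.
case: (ex_minnP ex) => n fn minn; exists n; split=> // i lt_in.
by apply: contraTeq lt_in => fi; rewrite -leqNgt minn.
Qed.

Fact ps_integral f g : f * g = 0 -> (f == 0) || (g == 0).
Proof.
move=> fg; apply/norP => -[/ps_order[m [fm minm]] /ps_order[n [gn minn]]].
have /eqP := congr1 (fun h => pscoef h (m + n)%N) fg; rewrite /= coef0.
have lt_m : (m < (m + n).+1)%N by rewrite ltnS leq_addr.
rewrite (bigD1 (Ordinal lt_m)) //= addKn big1 => [|i ne_im].
  by rewrite addr0 (negbTE (mulf_neq0 fm gn)).
case: (ltngtP i m) => [/minm ->|lt_mi|eq_im]; first by rewrite mul0r.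
- rewrite minn ?mulr0 // ltn_subLR ?ltn_add2r //.
  by rewrite -ltnS ltn_ord.
- by case/eqP: ne_im; apply: val_inj.
Qed.

HB.instance Definition _ :=
  GRing.ComUnitRing_isIntegral.Build (pseries C) ps_integral.

Fact ps_of_poly_is_zmod_morphism : zmod_morphism ps_of_poly.
Proof. by move=> p q; apply/psP => n /=; rewrite coefB. Qed.
HB.instance Definition _ := GRing.isZmodMorphism.Build {poly C} (pseries C)
  ps_of_poly ps_of_poly_is_zmod_morphism.

Fact ps_of_poly_is_monoid_morphism : monoid_morphism ps_of_poly.
Proof. by split=> // p q; apply/psP => n /=; rewrite coefM. Qed.
HB.instance Definition _ := GRing.isMonoidMorphism.Build {poly C} (pseries C)
  ps_of_poly ps_of_poly_is_monoid_morphism.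

Lemma ps_of_poly_inj : injective ps_of_poly.
Proof. by move=> p q /psP pq; apply/polyP => n; apply: pq. Qed.

Lemma ps_invertible f : pscoef f 0 != 0 -> exists g, g * f = 1.
Proof.
move=> f0.
pose next (l : seq C) :=
  - (\sum_(i < size l) l`_i * pscoef f (size l - i)) / pscoef f 0.
pose L := fix L n : seq C :=
  if n is m.+1 then rcons (L m) (next (L m)) else [:: (pscoef f 0)^-1].
have sL n : size (L n) = n.+1 by elim: n => //= n IHn; rewrite size_rcons IHn.
have nL n m : (n <= m)%N -> (L m)`_n = (L n)`_n.
  elim: m => [|m IHm]; first by case: n.
  rewrite leq_eqVlt => /predU1P[-> //|lt_nm].
  by rewrite /= nth_rcons sL lt_nm IHm.
exists (PSeries (fun n => (L n)`_n)); apply/psP => -[|n].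
  by rewrite /= big_ord1 coef1 mulVf.
rewrite [LHS]big_ord_recr /= subnn coef1 nth_rcons sL ltnn eqxx.
rewrite /next sL divfK //.
apply/eqP; rewrite /= subr_eq0; apply/eqP; apply: eq_bigr => i _.
by rewrite (nL _ n) // -ltnS.
Qed.

Definition ps_deriv f : pseries C :=
  PSeries (fun n => pscoef f n.+1 *+ n.+1).

(* The series \sum_n f_n s^n, for s without constant term; then the
   coefficient of t^m in s^n vanishes for n > m. *)
Definition ps_comp s f : pseries C :=
  PSeries (fun m => \sum_(n < m.+1) pscoef f n * pscoef (s ^+ n) m).

(* The series \sum_(k >= 1) (-1)^(k+1) u^k / k; the term k = 0 of the sequence
   of coefficients is 0 because 0^-1 = 0. *)
Definition ps_log1p u : pseries C :=
  ps_comp u (PSeries (fun k => (-1) ^+ k.+1 / k%:R)).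

End PowerSeries.

Definition ratfun (C : fieldType) : fieldType := {fraction {poly C}}.
Definition laurent (C : fieldType) : fieldType := {fraction pseries C}.

(* C((t)) is also the localization of C[[t]] at t. *)
Lemma laurentP (C : fieldType) (x : laurent C) :
  exists (n : nat) (f : pseries C), x = tofrac f / tofrac (ps_of_poly 'X^n).
Proof.
have [n [bn minb]] := ps_order (denom_ratioP (repr x)).
pose c := PSeries (fun i => pscoef (\d_(repr x)) (n + i)).
have c0 : pscoef c 0 != 0 by rewrite /= addn0.
have [g gc] := ps_invertible c0.
exists n, (\n_(repr x) * g); rewrite {1}(frac_numden x).
have X0 : ps_of_poly 'X^n != 0 :> pseries C.
  by rewrite -(rmorph0 (@ps_of_poly C)) (inj_eq (@ps_of_poly_inj C)) -size_poly_eq0 size_polyXn.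
apply/eqP; rewrite eqr_div ?tofrac_eq0 ?denom_ratioP // -!tofracM tofrac_eq.
have bE : \d_(repr x) = c * ps_of_poly 'X^n; last first.
  by rewrite {1}bE mulrA -(mulrA _ g) gc mulr1.
apply/psP => m /=; under eq_bigr do rewrite coefXn.
have [lt_mn|le_nm] := ltnP m n.
  rewrite minb // big1 // => i _; case: eqP => [e|]; last by rewrite mulr0.
  by move: (leq_subr i m); rewrite e leqNgt lt_mn.
have lt_m : (m - n < m.+1)%N by rewrite ltnS leq_subr.
rewrite (bigD1 (Ordinal lt_m)) //= subKn // eqxx mulr1 subnKC // big1 ?addr0 //.
move=> i ne_i; case: eqP => [e|]; last by rewrite mulr0.
by case/eqP: ne_i; apply: val_inj; rewrite /= -e subKn // -ltnS.
Qed.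

Section RationalFunctions.
Variable C : fieldType.
Implicit Types R S : ratfun C.

Definition vanishes_at0 R : Prop := exists p q : {poly C},
  [/\ q.[0] != 0, p.[0] = 0 & R = tofrac p / tofrac q].

Definition ratfunX : ratfun C := tofrac 'X.

(* R(S(t)), for S nonconstant. *)
Definition ratfun_comp R S : ratfun C :=
  frac_lift (fun p : {poly C} => (map_poly (fun c => tofrac c%:P) p).[S]) R.

Definition ratfun_iter n R : ratfun C := iter n (ratfun_comp R) ratfunX.

Definition expansion : ratfun C -> laurent C :=
  frac_lift (fun p => tofrac (ps_of_poly p)).

Let ps_frac : {rmorphism {poly C} -> laurent C} :=
  @tofrac (pseries C) \o @ps_of_poly C.

Let ps_frac_inj : injective ps_frac.
Proof. by move=> a b /eqP; rewrite /= tofrac_eq => /eqP /ps_of_poly_inj. Qed.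

HB.instance Definition _ := GRing.isZmodMorphism.Build (ratfun C) (laurent C)
  expansion (frac_lift_zmod_morphism ps_frac_inj).
HB.instance Definition _ := GRing.isMonoidMorphism.Build (ratfun C) (laurent C)
  expansion (frac_lift_monoid_morphism ps_frac_inj).

Lemma expansion_div (p q : {poly C}) : q != 0 ->
  expansion (tofrac p / tofrac q) =
  tofrac (ps_of_poly p) / tofrac (ps_of_poly q).
Proof. exact: (frac_lift_div (f := ps_frac)). Qed.

End RationalFunctions.

(* A field extension of C((t)), with a derivation and a map in the role of the
   substitution t |-> R(t). *)
Record substField (C : fieldType) := SubstField {
  sf_sort :> fieldType;
  sf_laurent : {rmorphism laurent C -> sf_sort};
  sf_deriv : sf_sort -> sf_sort;
  sf_subst : sf_sort -> sf_sort
}.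

Section Substitution.
Variable C : fieldType.

Definition laurent_deriv : laurent C -> laurent C := frac_deriv (@ps_deriv C).

(* The map f / g |-> f(s(t)) / g(s(t)), for s nonzero without constant term. *)
Definition laurent_comp (s : pseries C) : laurent C -> laurent C :=
  frac_lift (fun f => tofrac (ps_comp s f)).

(* C((t))(l), with 'X in the role of l. *)
Definition laurent_log : fieldType := {fraction {poly laurent C}}.

(* (\sum_i a_i l^i)' = \sum_i a_i' l^i + (\sum_i i a_i l^(i-1)) / t *)
Definition laurent_log_deriv : laurent_log -> laurent_log :=
  frac_deriv (fun p : {poly laurent C} =>
    map_poly laurent_deriv p + (expansion (ratfunX C))^-1 *: p^`()).

Variables (d : nat) (r : C) (u : pseries C) (lambda : C).

(* r t^d (1 + u) *)
Definition leading_form : pseries C := ps_of_poly (r *: 'X^d) * (1 + u).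

(* lambda + d l + log (1 + u) *)
Definition log_subst : {poly laurent C} :=
  (tofrac (ps_of_poly lambda%:P + ps_log1p u))%:P + d%:R *: 'X.

Definition laurent_log_comp : laurent_log -> laurent_log :=
  frac_lift (fun p : {poly laurent C} =>
    tofrac (map_poly (laurent_comp leading_form) p \Po log_subst)).

Definition laurent_substField : substField C :=
  SubstField idfun laurent_deriv (laurent_comp leading_form).

Definition laurent_log_substField : substField C :=
  SubstField (@tofrac {poly laurent C} \o polyC)
    laurent_log_deriv laurent_log_comp.

Definition FR : substField C :=
  if d == 1%N then laurent_substField else laurent_log_substField.

End Substitution.

Section DifferentialTranscendence.
Variables (k F : fieldType) (iota : {rmorphism k -> F}) (D : F -> F).

Definition diff_transcendental (g : F) : Prop :=
  forall (n : nat) (P : mpoly n.+1 k), P != 0 ->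
    mmap iota (fun i : 'I_n.+1 => iter i D g) P != 0.

End DifferentialTranscendence.

Local Open Scope complex_scope.

Definition cexp (K : realType) (z : K[i]) : K[i] :=
  let: x +i* y := z in (expR x * cos y) +i* (expR x * sin y).

(* Main.v *)
(* The operator delta = Psi d/dt commutes with Phi_R, so the functions
   z_i = delta^i f satisfy Phi_R(z_i) = z_i + delta^i b, where delta^i b lies in
   L = C(t)<Psi>.  If f is differentially algebraic, then the z_i are
   algebraically dependent over L, and by the additive Kolchin-Ostrowski theorem
   some combination z_q - c_0 z_0 - ... - c_(q-1) z_(q-1) with constant
   coefficients c_i lies in L.  As Psi, Psi', ... are algebraically independent
   over C(t), this forces f' to be rational.  Write f' = h' + y with h rational
   and y having simple poles only; the rational function (f - h)(R) - (f - h) has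
   the derivative R' y(R) - y, which again has simple poles only, so it is
   constant.  Hence f - h is a power series with (f - h)(R) = f - h + c, and
   comparing constant terms c = 0.  So f - h is fixed by Phi_R, and it is
   constant. *)

Require Import Defs.
From HB Require Import structures.
From mathcomp Require Import all_boot all_order all_algebra.
From mathcomp Require Import polyXY.
From mathcomp Require Import boolp reals.
From mathcomp Require Import complex ring.
From mathcomp Require Import -(notations) mpoly.

Set Implicit Arguments.
Unset Strict Implicit.
Unset Printing Implicit Defensive.
Import Order.TTheory GRing.Theory Num.Theory.
Local Open Scope ring_scope.

(** * Simple extensions and towers of subfields *)

(** A dependence of the $z_i$ over $L$ is no contradiction by itself, because $L$ contains every
    derivative of $\Psi$; the way back to $C(t)$ is a dichotomy. Let $q$ be the least order of a
    dependence and [k1] the field generated over $C(t)$ by $f, ..., f^{(q-1)}$. By the exchange of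
    independent elements, the $\Psi^{(j)}$ stay independent over [k1], and the additive relation,
    solved for its top term, puts $f^{(q)}$ in [k1]$(\Psi, \Psi', ...)$. If $f^{(q)}$ involves a
    $\Psi^{(s)}$, each further derivative brings in the next $\Psi^{(s+m)}$, and $f, f', ...$
    inherit independence over $C(t)$. If $f^{(q)}$ lies in [k1], the relation is affine in
    $\Psi^{(q-1)}$ and comparing coefficients yields $f'$. The constants $c_i$ are elements fixed by
    the substitution, so these must be shown to be complex numbers: orders and leading coefficients
    do this for Laurent series, and for polynomials in $\log t$ the degree is visible in the
    eigenvalue $d^m$. The dichotomy is proved for an abstract field with a derivation and an
    endomorphism, which covers both choices of $\mathbb{F}$. *)

Section Adjunction.
Variable F : fieldType.
Implicit Types (E : divringClosed F) (p q u v : {poly F}) (x y z h : F).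

(** Subfields are predicates on the one field [F], so that fields generated in different orders are
    compared by plain inclusions. *)
Definition adj_pred (E : divringClosed F) (y : F) : {pred F} := fun z =>
  `[< exists p q, [/\ p \is a polyOver E, q \is a polyOver E,
        q.[y] != 0 & z = p.[y] / q.[y]] >].

Lemma adjP E y z : reflect (exists p q, [/\ p \is a polyOver E,
  q \is a polyOver E, q.[y] != 0 & z = p.[y] / q.[y]]) (z \in adj_pred E y).
Proof. exact: asboolP. Qed.

Fact adj_divring_closed E y : divring_closed (adj_pred E y).
Proof.
split=> [|a b|a b].
- apply/adjP; exists 1, 1; split; rewrite ?rpred1 ?hornerC ?oner_neq0 //.
  by rewrite divr1.
- move=> /adjP[p [q [Ep Eq q0 ->]]] /adjP[u [v [Eu Ev v0 ->]]].
  apply/adjP; exists (p * v - u * q), (q * v).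
  split; rewrite ?hornerM ?mulf_neq0 ?rpredB ?rpredM //.
  by rewrite !hornerE -mulNr addf_div // mulNr.
- move=> /adjP[p [q [Ep Eq q0 ->]]] /adjP[u [v [Eu Ev v0 ->]]].
  have [u0|u0] := eqVneq u.[y] 0.
    rewrite u0 mul0r invr0 mulr0; apply/adjP; exists 0, 1.
    by split; rewrite ?rpred0 ?rpred1 ?hornerE ?oner_neq0 // mul0r.
  apply/adjP; exists (p * v), (q * u).
  split; rewrite ?rpredM ?hornerM ?mulf_neq0 //.
  by rewrite invf_div mulf_div.
Qed.
HB.instance Definition _ E y :=
  GRing.isDivringClosed.Build F (adj_pred E y) (adj_divring_closed E y).

Definition adj E y : divringClosed F := adj_pred E y.

Lemma sub_adj E y : {subset E <= adj E y}.
Proof.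
move=> z Ez; apply/adjP; exists z%:P, 1.
by split; rewrite ?rpred1 ?polyOverC ?hornerE ?oner_neq0 // divr1.
Qed.

Lemma mem_adj E y : y \in adj E y.
Proof.
apply/adjP; exists 'X, 1.
by split; rewrite ?rpred1 ?polyOverX ?hornerE ?oner_neq0 // divr1.
Qed.

Lemma adj_min E E' y :
  {subset E <= E'} -> y \in E' -> {subset adj E y <= E'}.
Proof.
move=> EE' E'y z /adjP[p [q [Ep Eq q0 ->]]].
by rewrite rpred_div ?rpred_horner // (polyOverS EE').
Qed.

Fixpoint tower E (s : nat -> F) n : divringClosed F :=
  if n is m.+1 then adj (tower E s m) (s m) else E.

Lemma tower_sub E s m n : (m <= n)%N -> {subset tower E s m <= tower E s n}.
Proof.
elim: n => [|n IHn]; first by rewrite leqn0 => /eqP->.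
rewrite leq_eqVlt => /predU1P[-> //|]; rewrite ltnS => /IHn mn z /mn.
exact: sub_adj.
Qed.

Lemma sub_tower E s n : {subset E <= tower E s n}.
Proof. exact: (@tower_sub E s 0 n). Qed.

Lemma mem_tower E s m n : (m < n)%N -> s m \in tower E s n.
Proof. by move=> lt_mn; apply/(tower_sub lt_mn)/mem_adj. Qed.

Lemma tower_min E E' s n : {subset E <= E'} ->
  (forall i, (i < n)%N -> s i \in E') -> {subset tower E s n <= E'}.
Proof.
move=> EE'; elim: n => [|n IHn] // sE'; apply: adj_min; last exact: sE'.
by apply: IHn => i lt_in; apply/sE'/ltnW.
Qed.

Lemma tower_mono E E' s n : {subset E <= E'} ->
  {subset tower E s n <= tower E' s n}.
Proof.
move=> EE'; apply: tower_min; first by move=> z /EE'; apply: sub_tower.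
by move=> i; apply: mem_tower.
Qed.

Definition transc E y := forall p, p \is a polyOver E -> p != 0 -> p.[y] != 0.

Lemma transcS E E' y : {subset E <= E'} -> transc E' y -> transc E y.
Proof. by move=> EE' ty p /(polyOverS EE'); apply: ty. Qed.

Lemma transc_notin E y : transc E y -> y \notin E.
Proof.
move=> ty; apply/negP => Ey; have := ty ('X - y%:P).
by rewrite polyOverXsubC Ey polyXsubC_eq0 !hornerE subrr eqxx => /(_ isT isT).
Qed.

Lemma transc_eq E y p q : transc E y -> p \is a polyOver E ->
  q \is a polyOver E -> p.[y] = q.[y] -> p = q.
Proof.
move=> ty Ep Eq pq; apply/eqP; rewrite -subr_eq0; apply/negP => /negP pq0.
by have := ty _ (rpredB Ep Eq) pq0; rewrite !hornerE pq subrr eqxx.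
Qed.

Lemma transcPn E y : ~ transc E y ->
  exists p, [/\ p \is a polyOver E, p != 0 & p.[y] = 0].
Proof.
move=> ny; apply: contrapT => nex; apply: ny => p Ep p0.
by apply/eqP => py; apply: nex; exists p.
Qed.

Lemma transc_affine E a b y : a \in E -> b \in E -> a != 0 ->
  transc E y -> transc E (a * y + b).
Proof.
move=> Ea Eb a0 ty p Ep p0; have szq : size (a *: 'X + b%:P) = 2%N.
  by rewrite size_polyDl size_scale ?size_polyX // size_polyC; case: eqP.
have := ty (p \Po (a *: 'X + b%:P)); rewrite horner_comp !hornerE; apply.
  by rewrite polyOver_comp // rpredD ?polyOverZ ?polyOverX ?polyOverC.
by rewrite comp_poly2_eq0 ?szq.
Qed.

(** The leading coefficient of [p] is the quotient of those of [p * v] and [v], hence in [E];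
    removing the leading term of [p] lowers the size. *)
Lemma polyOver_factor E p v : v \is a polyOver E -> v != 0 ->
  p * v \is a polyOver E -> p \is a polyOver E.
Proof.
move=> Ev v0; have [n] := ubnP (size p); elim: n p => // n IHn p lt_pn Epv.
have [->|p0] := eqVneq p 0; first exact: rpred0.
pose c := lead_coef p; have Ec : c \in E.
  have := rpred_div (polyOverP Epv (size (p * v)).-1) (polyOverP Ev (size v).-1).
  by rewrite -!lead_coefE lead_coefM mulfK ?lead_coef_eq0.
pose m := (size p).-1; have Em : c *: 'X^m \is a polyOver E.
  by rewrite polyOverZ ?polyOverXn.
rewrite -(subrK (c *: 'X^m) p) rpredD //; apply: IHn; last first.
  by rewrite mulrBl rpredB // rpredM.
apply: leq_trans (_ : size p <= n)%N; last by rewrite -ltnS.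
have sp : size p = m.+1 by rewrite prednK // lt0n size_poly_eq0.
rewrite sp ltnS; apply/leq_sizeP => j le_mj.
rewrite coefB coefZ coefXn; have [->|ne_jm] := eqVneq j m.
  by rewrite mulr1 /c lead_coefE subrr.
by rewrite mulr0 subr0 nth_default // sp ltn_neqAle eq_sym ne_jm.
Qed.

(* An element of E(y) that is a polynomial in y over a larger field, over which
   y is still transcendental, is a polynomial in y over E. *)
Lemma polyOver_adj E E1 y p : {subset E <= E1} -> transc E1 y ->
  p \is a polyOver E1 -> p.[y] \in adj E y -> p \is a polyOver E.
Proof.
move=> EE1 ty E1p /adjP[u [v [Eu Ev vy py]]].
have v0 : v != 0 by apply: contraNneq vy => ->; rewrite horner0.
have : p * v = u.
  have sub := polyOverS EE1.
  apply: (transc_eq ty); [exact: rpredM (sub _ Ev) | exact: sub |].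
  by rewrite hornerM py divfK.
by move=> pvu; apply: (polyOver_factor Ev v0); rewrite pvu.
Qed.

Lemma mem_adj_sub E E1 y z : {subset E <= E1} -> transc E1 y ->
  z \in E1 -> z \in adj E y -> z \in E.
Proof.
move=> EE1 ty E1z Ez; rewrite -polyOverC.
by apply: (polyOver_adj EE1 ty); rewrite ?polyOverC // hornerC.
Qed.

(** A common denominator, built up along Horner's scheme. Having a polynomial [P] in two variables
    over [E] is what allows the variables to be swapped in [transc_exchange]. *)
Lemma clear_denominators E y p : p \is a polyOver (adj E y) ->
  exists2 v, v \is a polyOver E /\ v.[y] != 0 &
    exists2 P : {poly {poly F}}, (forall i, P`_i \is a polyOver E) &
      v.[y] *: p = map_poly (horner^~ y) P.
Proof.
elim/poly_ind: p => [_|p c IHp].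
  exists 1; first by rewrite rpred1 hornerC oner_neq0.
  by exists 0; [move=> i; rewrite coef0 rpred0 | rewrite scaler0 map_poly0].
move=> Epc; have Ec : c \in adj E y.
  by move/polyOverP/(_ 0%N): Epc; rewrite coefD coefMX coefC add0r.
have Ep : p \is a polyOver (adj E y).
  apply/polyOverP => i; move/polyOverP/(_ i.+1): Epc.
  by rewrite coefD coefMX coefC addr0.
have [v [Ev v0] [P EP defP]] := IHp Ep.
have /adjP[a [b [Ea Eb b0 ->]]] := Ec.
exists (v * b); first by rewrite rpredM // hornerM mulf_neq0.
exists (b *: P * 'X + (v * a)%:P) => [i|].
  rewrite coefD coefMX coefC coefZ; case: i => [|i] /=.
    by rewrite add0r rpredM.
  by rewrite addr0 rpredM.
apply/polyP => i; rewrite coefZ coef_map_id0 ?horner0 // !coefD !coefMX !coefC.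
rewrite coefZ; case: i => [|i] /=.
  by rewrite !add0r !hornerM -mulrA [X in _ * X]mulrC divfK.
have /polyP/(_ i) := defP; rewrite coefZ coef_map_id0 ?horner0 // => Pi.
by rewrite !addr0 !hornerM -Pi mulrA; congr (_ * _); rewrite mulrC.
Qed.

Lemma horner_map_horner (P : {poly {poly F}}) x y :
  (map_poly (horner^~ y) P).[x] = P.[x, y].
Proof.
have := horner_map (horner_eval y) P x%:P.
by rewrite /= !horner_evalE hornerC.
Qed.

(** A relation for [x] over [E(y)], cleared of denominators, is a relation [P(x, y) = 0] over [E].
    Read as a polynomial in [y], its coefficients vanish at [x] because [y] is transcendental over
    [E(x)]; then they vanish identically because [x] is transcendental over [E]. *)
Lemma transc_exchange E x y : transc E x -> transc (adj E x) y ->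
  transc (adj E y) x.
Proof.
move=> tx ty p Ep p0; have [v [Ev v0] [P EP defP]] := clear_denominators Ep.
apply: contraTneq p0 => px; rewrite negbK.
pose Q := swapXY P; have EQ j : Q`_j \is a polyOver E.
  by apply/polyOverP => i; rewrite coef_swapXY (polyOverP (EP i)).
pose q := map_poly (horner^~ x) Q; have Eq : q \is a polyOver (adj E x).
  apply/polyOverP => j; rewrite coef_map_id0 ?horner0 //.
  by rewrite rpred_horner ?mem_adj // (polyOverS (@sub_adj E x)).
have q0 : q = 0.
  apply: (transc_eq ty); rewrite ?rpred0 // horner0.
  by rewrite horner_map_horner horner2_swapXY -horner_map_horner -defP hornerZ px mulr0.
have Q0 : Q = 0.
  apply/polyP => j; rewrite coef0; apply: (transc_eq tx); rewrite ?rpred0 //.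
  by have /polyP/(_ j) := q0; rewrite coef_map_id0 ?horner0 // coef0.
have P0 : P = 0 by apply/eqP; rewrite -swapXY_eq0 -/Q Q0.
have := congr1 (fun r => v.[y]^-1 *: r) defP.
by rewrite P0 map_poly0 scaler0 scalerA mulVf // scale1r => ->.
Qed.

(** The factor [c] is only given in [F], but it is the quotient of the coefficients of [u] and [v]
    at the degree of [v]. *)
Lemma transc_proportional E y u v : transc E y -> u \is a polyOver E ->
  v \is a polyOver E -> v != 0 -> (exists c, u = c *: v) -> u.[y] / v.[y] \in E.
Proof.
move=> ty Eu Ev v0 [c uv]; rewrite {1}uv hornerZ mulfK ?ty //.
have := rpred_div (polyOverP Eu (size v).-1) (polyOverP Ev (size v).-1).
by rewrite {1}uv coefZ mulfK // -lead_coefE lead_coef_eq0.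
Qed.

Lemma proportional_gcd u v : v != 0 -> (size (u %/ gcdp u v)%R <= 1)%N ->
  (size (v %/ gcdp u v)%R <= 1)%N -> exists c, u = c *: v.
Proof.
move=> v0 /size1_polyC su /size1_polyC sv.
have := divpK (dvdp_gcdr _ _ : gcdp u v %| v); have := divpK (dvdp_gcdl _ _ : gcdp u v %| u).
rewrite su sv; set a := _`_0; set b := _`_0; set g := gcdp u v => gu gv.
have b0 : b != 0 by apply: contraNneq v0 => b0; rewrite -gv b0 mul0r.
by exists (a / b); rewrite -gv -gu !mul_polyC scalerA divfK.
Qed.

Lemma expr_subK (A : pzRingType) (x : A) m (i : 'I_m.+1) :
  x ^+ m = x ^+ (m - i) * x ^+ i.
Proof. by rewrite -exprD subnK // -ltnS. Qed.

(** If [h = u(y) / v(y)] is a root of [p], write [u / v = u1 / v1] in lowest terms. The homogenized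
    equation makes [v1] divide a power of [u1], so [v1] is constant, and then a nonconstant [u1]
    cannot be a root of [p]. Hence [u] and [v] are proportional and [h] lies in [E]. *)
Lemma transc_of_mem_adj E y h : transc E y -> h \in adj E y -> h \notin E ->
  transc E h.
Proof.
move=> ty /adjP[u [v [Eu Ev vy defh]]] Eh p Ep p0; apply: contraNneq Eh => ph.
have v0 : v != 0 by apply: contraNneq vy => ->; rewrite horner0.
rewrite defh; apply: transc_proportional => //.
set g := gcdp u v; have g0 : g != 0 by rewrite gcdp_eq0 negb_and v0 orbT.
have [gu gv] := (divpK (dvdp_gcdl _ _ : gcdp u v %| u), divpK (dvdp_gcdr _ _ : gcdp u v %| v)).
rewrite -/g in gu gv; set u1 := u %/ g in gu; set v1 := v %/ g in gv.
pose m := (size p).-1; have sp : size p = m.+1.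
  by rewrite prednK // lt0n size_poly_eq0.
(* The gcd is taken over [F], so transcendence of [y] over [E] is applied to [u] and [v]; only then
   is the factor [g ^+ m] cancelled. *)
have sum0 : \sum_(i < m.+1) p`_i *: (u1 ^+ i * v1 ^+ (m - i)) = 0.
  have eq0 : \sum_(i < m.+1) p`_i *: (u ^+ i * v ^+ (m - i)) = 0.
    apply: (transc_eq ty); [apply: rpred_sum => i _|exact: rpred0|].
      by rewrite polyOverZ ?(polyOverP Ep) // rpredM ?rpredX.
    have -> : 0.[y] = v.[y] ^+ m * p.[h] by rewrite ph mulr0 horner0.
    rewrite horner_sum [p.[h]]horner_coef sp mulr_sumr; apply: eq_bigr => i _.
    rewrite !hornerE defh expr_div_n (expr_subK v.[y] i) /=.
    by move: (_ ^+ (m - i)) (expf_neq0 i vy) => w; move: (_ ^+ i) => w' w'0; field.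
  apply: (mulfI (expf_neq0 m g0)); rewrite mulr0 -[RHS]eq0.
  rewrite mulr_sumr; apply: eq_bigr => i _.
  rewrite -scalerAr -gu -gv !exprMn (expr_subK g i).
  by congr (_ *: _); ring.
have pm : p`_m != 0 by rewrite -lead_coefE lead_coef_eq0.
have cvu : coprimep v1 u1 by rewrite coprimep_sym coprimep_div_gcd ?v0 ?orbT.
have v1_1 : (size v1 <= 1)%N.
  case: (posnP m) sum0 pm => [->|m_gt0].
    by rewrite big_ord1 expr0 mulr1 alg_polyC => /eqP; rewrite polyC_eq0 => ->.
  rewrite big_ord_recr /= subnn mulr1 addrC => /eqP; rewrite addr_eq0 => /eqP sum0 pm.
  have : v1 %| u1 ^+ m.
    rewrite -(dvdpZr _ _ pm) sum0 dvdpNr; elim/big_ind: _ => [|a b|i _].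
    - exact: dvdp0.
    - exact: dvdp_add.
    - rewrite -mul_polyC !dvdp_mull //= -(subnSK (ltn_ord i)) exprS.
      exact: dvdp_mulIl.
  by move=> /coprimep_dvdl/(_ (coprimep_expr m cvu)); rewrite coprimepp => /eqP->.
have u1_1 : (size u1 <= 1)%N.
  rewrite leqNgt; apply/negP => u1_gt1.
  have v1E := size1_polyC v1_1; set c := v1`_0 in v1E.
  have c0 : c != 0.
    by apply: contraNneq v0 => c0; rewrite -gv v1E c0 mul0r.
  (* With [v1] equal to the constant [c], the homogenized equation is [c ^+ m] times the equation
     for [u1 / c]. *)
  have /eqP : p \Po (c^-1 *: u1) = 0.
    apply: (scalerI (expf_neq0 m c0)); rewrite scaler0 -[RHS]sum0.
    rewrite comp_polyE sp scaler_sumr; apply: eq_bigr => i _.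
    rewrite v1E exprZn [_ * _ ^+ (m - i)]mulrC -polyC_exp mul_polyC !scalerA /=; congr (_ *: _).
    rewrite (expr_subK c i) exprVn /=.
    by move: (_ ^+ (m - i)) (expf_neq0 i c0) => w; move: (_ ^+ i) => w' w'0; field.
  by rewrite comp_poly_eq0 ?size_scale ?invr_eq0 // (negbTE p0).
exact: (proportional_gcd v0).
Qed.

(** * Derivations and difference equations in characteristic zero *)

Section Characteristic0.
Hypothesis F0 : forall n, n.+1%:R != 0 :> F.

Lemma deriv_eq0 p : p^`() = 0 -> (size p <= 1)%N.
Proof.
move=> dp; apply/leq_sizeP => -[|j] // _.
have /eqP := congr1 (fun q : {poly F} => q`_j) dp.
by rewrite coef_deriv coef0 -mulr_natr mulf_eq0 (negbTE (F0 j)) orbF => /eqP.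
Qed.

Lemma dvdp_deriv p : p %| p^`() -> (size p <= 1)%N.
Proof.
have [->|p0] := eqVneq p 0; first by rewrite size_poly0.
have [/deriv_eq0 //|dp0] := eqVneq p^`() 0.
by move=> /(dvdp_leq dp0); rewrite leqNgt lt_size_deriv.
Qed.

(** The terms with the derivative of the gcd cancel, so the cofactors satisfy the same equation.
    Being coprime, each of them divides its own derivative, which forces it to be constant in
    characteristic zero. *)
Lemma wronskian_proportional u v : v != 0 -> u^`() * v = u * v^`() ->
  exists c, u = c *: v.
Proof.
move=> v0; set g := gcdp u v.
have g0 : g != 0 by rewrite gcdp_eq0 negb_and v0 orbT.
have gu : u %/ g * g = u by rewrite divpK ?dvdp_gcdl.
have gv : v %/ g * g = v by rewrite divpK ?dvdp_gcdr.
have cuv : coprimep (u %/ g) (v %/ g) by rewrite coprimep_div_gcd // v0 orbT.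
rewrite -{1 2}gu -{1 2}gv !derivM.
set u1 := u %/ g in cuv gu *; set v1 := v %/ g in cuv gv *.
have -> : (u1^`() * g + u1 * g^`()) * (v1 * g) =
  (u1^`() * v1) * g ^+ 2 + u1 * v1 * g * g^`() by ring.
have -> : u1 * g * (v1^`() * g + v1 * g^`()) =
  (u1 * v1^`()) * g ^+ 2 + u1 * v1 * g * g^`() by ring.
move=> /addIr /(mulIf (expf_neq0 2 g0)) uv.
apply: (proportional_gcd v0); apply: dvdp_deriv; rewrite -/g -/u1 -/v1.
  by rewrite -(Gauss_dvdpl _ cuv) uv dvdp_mulIl.
by rewrite -(Gauss_dvdpr _ (_ : coprimep v1 u1)) -?uv ?dvdp_mulIr // coprimep_sym.
Qed.

Section Derivation.
Variable D : {additive F -> F}.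
Hypothesis DM : forall x y, D (x * y) = D x * y + x * D y.

Lemma derivation_div x y : y != 0 -> D (x / y) = (D x * y - x * D y) / y ^+ 2.
Proof.
move=> y0; have := DM (x / y) y; rewrite divfK // => ->.
by field.
Qed.

Lemma derivation_horner p y :
  D p.[y] = (map_poly D p).[y] + p^`().[y] * D y.
Proof.
elim/poly_ind: p => [|p c IHp].
  by rewrite map_poly0 deriv0 !horner0 mul0r addr0 raddf0.
have -> : map_poly D (p * 'X + c%:P) = map_poly D p * 'X + (D c)%:P.
  apply/polyP => i; rewrite coef_map !coefD !coefMX !coefC /= raddfD /=.
  by case: i => [|i]; rewrite /= ?raddf0 ?coef_map.
rewrite derivD derivC addr0 derivM derivX mulr1 !hornerE raddfD DM IHp.
by ring.
Qed.

(* The last clause says that E(y) / E has no new constants. *)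
Lemma derivation_adj E E' y h : {subset E <= E'} ->
  (forall x, x \in E -> D x \in E') -> y \in E' -> h \in adj E y ->
  exists A B, [/\ A \in E', B \in E', D h = A + B * D y &
    transc E y -> h \notin E -> B != 0].
Proof.
move=> EE' DE E'y /adjP[u [v [Eu Ev vy ->]]]; have sub := polyOverS EE'.
have E'D p : p \is a polyOver E -> map_poly D p \is a polyOver E'.
  by move=> Ep; apply/polyOverP => i; rewrite coef_map DE ?(polyOverP Ep).
have E'h p : p \is a polyOver E' -> p.[y] \in E'.
  by move=> Ep; rewrite rpred_horner.
exists (((map_poly D u).[y] * v.[y] - u.[y] * (map_poly D v).[y]) / v.[y] ^+ 2).
exists ((u^`() * v - u * v^`()).[y] / v.[y] ^+ 2); split.
- by rewrite rpred_div ?rpredX ?rpredB ?rpredM ?E'h ?E'D ?sub.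
- apply: rpred_div; last by rewrite rpredX ?E'h ?sub.
  by apply: E'h; rewrite rpredB ?rpredM ?polyOver_deriv ?sub.
- by rewrite derivation_div // !derivation_horner !hornerE; field.
(* [B = 0] means that the Wronskian of [u] and [v] vanishes at [y]; as [y] is transcendental it
   vanishes identically. *)
move=> ty; apply: contraNneq => /eqP.
rewrite mulf_eq0 invr_eq0 expf_eq0 (negbTE vy) /= orbF => /eqP w0.
have v0 : v != 0 by apply: contraNneq vy => ->; rewrite horner0.
apply: transc_proportional => //; apply: wronskian_proportional => //.
apply: (transc_eq ty); rewrite ?rpredM ?polyOver_deriv //.
by apply/eqP; rewrite -subr_eq0 -hornerN -hornerD w0.
Qed.

Lemma derivation_adj_sub E E' y : {subset E <= E'} ->
  (forall x, x \in E -> D x \in E') -> y \in E' -> D y \in E' ->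
  forall x, x \in adj E y -> D x \in E'.
Proof.
move=> EE' DE E'y E'Dy x Ex.
have [A [B [EA EB -> _]]] := derivation_adj EE' DE E'y Ex.
by rewrite rpredD ?rpredM.
Qed.

End Derivation.

(** * Additive difference equations over a stable subfield *)

Section Substitution.
Variable S : {rmorphism F -> F}.

(** The action of [S] on polynomial expressions in an element [y] with [S y = y + b], lifted to
    polynomials. *)
Definition shift b p := map_poly S p \Po ('X + b%:P).

Lemma shift_horner b p y : S y = y + b -> (shift b p).[y] = S p.[y].
Proof. by move=> Sy; rewrite horner_comp !hornerE -Sy horner_map. Qed.

Lemma size_shift b p : size (shift b p) = size p.
Proof. by rewrite size_comp_poly2 ?size_XaddC // size_map_poly. Qed.

Lemma lead_coef_shift b p : lead_coef (shift b p) = S (lead_coef p).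
Proof.
rewrite lead_coef_comp ?size_XaddC // lead_coefXaddC expr1n mulr1.
exact: lead_coef_map.
Qed.

Lemma coef_XaddC_exp b n m : (('X + b%:P : {poly F}) ^+ n)`_m = b ^+ (n - m) *+ 'C(n, m).
Proof.
rewrite addrC exprDn coef_sum; have [lt_nm|le_mn] := ltnP n m.
  rewrite bin_small // mulr0n big1 // => i _.
  rewrite coefMn -rmorphXn /= coefCM coefXn; case: eqP => [e|]; last by rewrite mulr0 mul0rn.
  by have := ltn_ord i; rewrite ltnS leqNgt -e lt_nm.
have lt_m : (m < n.+1)%N by rewrite ltnS.
rewrite (bigD1 (Ordinal lt_m)) //= big1 => [|i ne_im].
  by rewrite addr0 coefMn -rmorphXn /= coefCM coefXn eqxx mulr1.
rewrite coefMn -rmorphXn /= coefCM coefXn; case: eqP => [e|]; last by rewrite mulr0 mul0rn.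
by case/eqP: ne_im; apply: val_inj.
Qed.

(** Comparing subleading coefficients in a shift-invariant polynomial gives a first-order additive
    equation, the input of [mem_of_fixed_affine]. *)
Lemma coef_shift b p m : size p = m.+2 ->
  (shift b p)`_m = S p`_m + S p`_m.+1 * b *+ m.+1.
Proof.
move=> sp; rewrite coef_comp_poly size_map_poly sp !big_ord_recr /=.
rewrite big1 ?add0r => [|i _].
  rewrite !coef_map !coef_XaddC_exp subnn binn mulr1n mulr1 subSnn expr1.
  by rewrite binSn mulrnAr.
by rewrite coef_XaddC_exp bin_small ?mulr0n ?mulr0.
Qed.

Section Stable.
Variables (E : divringClosed F) (y b : F).
Hypothesis SE : forall x, x \in E -> S x \in E.
Hypothesis fixE : forall x, S x = x -> x \in E.
Hypotheses (Eb : b \in E) (Sy : S y = y + b).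

Lemma polyOver_shift p : p \is a polyOver E -> shift b p \is a polyOver E.
Proof.
move=> Ep; rewrite polyOver_comp ?polyOverXaddC //.
by apply/polyOverP => i; rewrite coef_map SE ?(polyOverP Ep).
Qed.

(** The increments of the two terms of [l * y *+ m.+1 + x] cancel, so this element is fixed by [S]
    and lies in [E]; solve it for [y]. *)
Lemma mem_of_fixed_affine m l x : l \in E -> l != 0 -> x \in E -> S l = l ->
  S x + l * b *+ m.+1 = x -> y \in E.
Proof.
move=> El l0 Ex Sl Sx; have Ez : l * y *+ m.+1 + x \in E.
  apply: fixE; rewrite rmorphD rmorphMn rmorphM /= Sl Sy mulrDr mulrnDl.
  by rewrite -addrA [_ *+ _ + S x]addrC Sx.
have := rpredB Ez Ex; rewrite addrK -mulr_natr => Ey.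
have := rpred_div Ey (rpredM El (rpred_nat E m.+1)).
move: (_%:R) (F0 m) => w w0; have -> // : l * y * w / (l * w) = y.
by field; rewrite l0 w0.
Qed.

Lemma shift_stable_trivial (I : {poly F} -> Prop) : y \notin E ->
  (forall p, I p -> p \is a polyOver E) ->
  (forall p q, I p -> I q -> I (p - q)) ->
  (forall c p, c \in E -> I p -> I (c *: p)) ->
  (forall p, I p -> I (shift b p)) ->
  (exists2 p, I p & p != 0) -> I 1.
Proof.
move=> Ey IE IB IZ IS exI.
have exn : exists n, `[< exists p, [/\ I p, p != 0 & size p = n] >].
  by have [p Ip p0] := exI; exists (size p); apply/asboolP; exists p.
have [n /asboolP[p0 [Ip0 p0_neq0 sp0]] minn] := ex_minnP exn.
pose p := (lead_coef p0)^-1 *: p0.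
have l0 : lead_coef p0 != 0 by rewrite lead_coef_eq0.
have Ip : I p by apply: IZ => //; rewrite rpredV lead_coefE (polyOverP (IE _ Ip0)).
have sp : size p = n by rewrite size_scale ?invr_eq0.
have lp : lead_coef p = 1 by rewrite lead_coefZ mulVf.
have Sp : shift b p = p.
  apply/eqP; rewrite -subr_eq0; apply: contraT => q0.
  have Iq : I (shift b p - p) by apply: IB => //; apply: IS.
  have : (n <= size (shift b p - p)%R)%N.
    by apply: minn; apply/asboolP; exists (shift b p - p).
  rewrite leqNgt => /negP[]; have [n1 sp1] : exists n1, size p = n1.+1.
    by exists (size p).-1; rewrite prednK // sp -sp0 lt0n size_poly_eq0.
  rewrite -sp sp1 ltnS; apply/leq_sizeP => j le_j; rewrite coefB.
  have [<-|ne_j] := eqVneq n1 j.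
    have := lead_coef_shift b p; rewrite !lead_coefE size_shift sp1 /= => ->.
    by move: lp; rewrite lead_coefE sp1 /= => ->; rewrite rmorph1 subrr.
  have lt_j : (n1 < j)%N by rewrite ltn_neqAle ne_j.
  by rewrite !nth_default ?subr0 ?size_shift ?sp1.
case: n sp {minn sp0} => [|[|m]] sp.
- have := size_poly_eq0 p; rewrite sp => /esym/eqP p_0.
  by move: lp; rewrite p_0 lead_coef0 => /esym/eqP; rewrite oner_eq0.
- have := size1_polyC (eq_leq sp); have := lp; rewrite lead_coefE sp /= => ->.
  by move=> p1; move: Ip; rewrite p1.
case/negP: Ey; apply: (mem_of_fixed_affine (m := m) (l := 1) (x := p`_m)).
- exact: rpred1.
- exact: oner_neq0.
- exact: (polyOverP (IE _ Ip)).
- exact: rmorph1.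
have := coef_shift b sp; rewrite Sp => {2}->.
by move: lp; rewrite lead_coefE sp /= => ->; rewrite rmorph1.
Qed.

(** The polynomials over [E] that vanish at [y] form a shift-stable space; if [y] were outside [E],
    it would contain 1. *)
Lemma mem_of_alg : ~ transc E y -> y \in E.
Proof.
move=> /transcPn[p [Ep p0 py]]; apply: contraT => Ey.
pose I q := q \is a polyOver E /\ q.[y] = 0.
suff [_] : I 1 by rewrite hornerC => /eqP; rewrite oner_eq0.
apply: (shift_stable_trivial Ey) => [q [] //|q r [Eq qy] [Er ry]|c q Ec [Eq qy]|q [Eq qy]|].
- by split; rewrite ?rpredB // hornerD hornerN qy ry subr0.
- by split; rewrite ?polyOverZ // hornerZ qy mulr0.
- by split; rewrite ?polyOver_shift // shift_horner // qy rmorph0.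
- by exists p.
Qed.

(** The possible denominators of [h] form a shift-stable space, so 1 is one of them and [h] is a
    polynomial [u] in [y]. The increment of [h] lies in [E], so [shift b u] differs from [u] by a
    constant, which bounds the degree of [u] by 1. *)
Lemma affine_of_mem_adj h : transc E y -> h \in adj E y -> S h - h \in E ->
  exists2 c, S c = c & h - c * y \in E.
Proof.
move=> ty /adjP[u0 [v0 [Eu0 Ev0 v0y defh]]] Eh; have Ey := transc_notin ty.
pose I v := v \is a polyOver E /\
  exists2 u, u \is a polyOver E & v.[y] * h = u.[y].
have [_ [u Eu]] : I 1.
  apply: (shift_stable_trivial Ey) => [v [] //|v w [Ev [u Eu uh]] [Ew [t Et th]]|c v Ec [Ev [u Eu uh]]|v [Ev [u Eu uh]]|].
  - split; first exact: rpredB.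
    by exists (u - t); rewrite ?rpredB // !hornerE mulrBl uh th.
  - split; first exact: polyOverZ.
    by exists (c *: u); rewrite ?polyOverZ // !hornerZ -mulrA uh.
  - split; first exact: polyOver_shift.
    exists (shift b u - (S h - h) *: shift b v).
      by rewrite rpredB ?polyOverZ ?polyOver_shift.
    rewrite hornerD hornerN hornerZ !shift_horner // -uh rmorphM /=; ring.
  - exists v0; last by apply: contraNneq v0y => ->; rewrite horner0.
    by split=> //; exists u0; rewrite // defh mulrC divfK.
rewrite hornerC mul1r => hu; set e := S h - h in Eh.
have Su : shift b u = u + e%:P.
  apply: (transc_eq ty); rewrite ?polyOver_shift ?rpredD ?polyOverC //.
  by rewrite shift_horner // hornerD hornerC -hu /e addrC subrK.
have Su1 i : (shift b u)`_i.+1 = u`_i.+1 by rewrite Su coefD coefC addr0.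
(* In degree at least 2 the subleading coefficient is not the constant one, hence it is unchanged by
   the shift; with the fixed leading coefficient this would put [y] in [E]. *)
have le_su : (size u <= 2)%N.
  rewrite leqNgt; apply: contra Ey => su; have [m sm] : exists m, size u = m.+3.
    by exists (size u - 3)%N; rewrite -addn3 subnK.
  have lS : S u`_m.+2 = u`_m.+2.
    by have := lead_coef_shift b u; rewrite !lead_coefE size_shift sm /= Su1.
  apply: (mem_of_fixed_affine (m := m.+1) (l := u`_m.+2) (x := u`_m.+1)) => //.
  - exact: (polyOverP Eu).
  - have -> : u`_m.+2 = lead_coef u by rewrite lead_coefE sm.
    by rewrite lead_coef_eq0 -size_poly_eq0 sm.
  - exact: (polyOverP Eu).
  - by rewrite -[X in X * b]lS -coef_shift // Su1.
exists u`_1.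
  move: le_su; rewrite leq_eqVlt => /predU1P[su|]; last first.
    by rewrite ltnS => su; rewrite nth_default ?rmorph0.
  by have := lead_coef_shift b u; rewrite !lead_coefE size_shift su /= Su1.
have -> : h - u`_1 * y = u`_0.
  rewrite hu (@horner_coef_wide _ 2) // big_ord_recr big_ord1 /= expr0 expr1.
  by rewrite mulr1 addrK.
exact: (polyOverP Eu).
Qed.

End Stable.

Lemma stable_adj E y : (forall x, x \in E -> S x \in E) -> S y \in adj E y ->
  forall x, x \in adj E y -> S x \in adj E y.
Proof.
move=> SE Sy x /adjP[p [q [Ep Eq q0 ->]]].
rewrite fmorph_div -!horner_map rpred_div ?rpred_horner //;
  apply/polyOverP => i; rewrite coef_map sub_adj ?SE //.
  exact: (polyOverP Ep).
exact: (polyOverP Eq).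
Qed.

(* The additive case of the Kolchin-Ostrowski theorem. *)
Theorem ostrowski E (z b : nat -> F) n :
  (forall x, x \in E -> S x \in E) -> (forall x, S x = x -> x \in E) ->
  (forall i, S (z i) = z i + b i) -> (forall i, b i \in E) ->
  (forall i, (i < n)%N -> transc (tower E z i) (z i)) ->
  ~ transc (tower E z n) (z n) ->
  exists2 c : nat -> F, forall i, S (c i) = c i &
    z n - \sum_(i < n) c i * z i \in E.
Proof.
move=> SE fixE Sz Eb tz nz.
have ST j x : x \in tower E z j -> S x \in tower E z j.
  elim: j x => [|j IHj] //=; apply: stable_adj => //.
  by rewrite Sz rpredD ?mem_adj // sub_adj ?sub_tower.
have fixT j x : S x = x -> x \in tower E z j by move/fixE; apply: sub_tower.
have bT j i : b i \in tower E z j by apply: sub_tower.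
(* An algebraic solution of an additive equation already lies in the base field, here the tower over
   the earlier [z i]. *)
have Tz := mem_of_alg (ST n) (fixT n) (bT n n) (Sz n) nz.
(* The last variable is peeled off: [h] is affine in it with a fixed coefficient [c], and
   [h - c * z j] again has its increment in [E]. *)
have descent j h : (j <= n)%N -> h \in tower E z j -> S h - h \in E ->
    exists2 c : nat -> F, forall i, S (c i) = c i &
      h - \sum_(i < j) c i * z i \in E.
  elim: j h => [|j IHj] h lt_jq Th Eh.
    by exists (fun=> 0) => [i|]; rewrite ?rmorph0 // big_ord0 subr0.
  have Th' : S h - h \in tower E z j by apply: sub_tower.
  have [c Sc Thc] := affine_of_mem_adj (ST j) (fixT j) (bT j j) (Sz j) (tz j lt_jq) Th Th'.
  have [|d Sd Ed] := IHj _ (ltnW lt_jq) Thc.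
    rewrite rmorphB rmorphM /= Sc Sz mulrDr.
    have -> : S h - (c * z j + c * b j) - (h - c * z j) = (S h - h) - c * b j by ring.
    exact: rpredB Eh (rpredM (fixE _ Sc) (Eb j)).
  exists (fun i => if i == j then c else d i) => [i|]; first by case: eqP.
  rewrite big_ord_recr /= eqxx opprD addrA addrAC.
  rewrite (eq_bigr (fun i : 'I_j => d i * z i)) // => i _.
  by rewrite ltn_eqF.
apply: (descent n) => //; rewrite Sz addrC addKr.
exact: Eb.
Qed.

End Substitution.
End Characteristic0.
End Adjunction.

(** * Countably generated extensions *)

Section TowerUnion.
Variable F : fieldType.
Implicit Types E : divringClosed F.

Definition tower_union_pred E (s : nat -> F) : {pred F} :=
  fun z => `[< exists n, z \in tower E s n >].

Lemma tower_unionP E s z :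
  reflect (exists n, z \in tower E s n) (z \in tower_union_pred E s).
Proof. exact: asboolP. Qed.

Fact tower_union_divring_closed E s : divring_closed (tower_union_pred E s).
Proof.
have common x y : x \in tower_union_pred E s -> y \in tower_union_pred E s ->
    exists2 n, x \in tower E s n & y \in tower E s n.
  move=> /tower_unionP[m xm] /tower_unionP[n yn]; exists (maxn m n).
    exact: tower_sub (leq_maxl m n) _ xm.
  exact: tower_sub (leq_maxr m n) _ yn.
split=> [|x y xU yU|x y xU yU].
- by apply/tower_unionP; exists 0%N; exact: rpred1.
- have [n xn yn] := common _ _ xU yU.
  by apply/tower_unionP; exists n; rewrite rpredB.
- have [n xn yn] := common _ _ xU yU.
  by apply/tower_unionP; exists n; rewrite rpred_div.
Qed.
HB.instance Definition _ E s := GRing.isDivringClosed.Build F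
  (tower_union_pred E s) (tower_union_divring_closed E s).

Definition tower_union E s : divringClosed F := tower_union_pred E s.

Lemma sub_tower_union E s n : {subset tower E s n <= tower_union E s}.
Proof. by move=> x xn; apply/tower_unionP; exists n. Qed.

Lemma mem_tower_union E s n : s n \in tower_union E s.
Proof. exact/(@sub_tower_union _ _ n.+1)/mem_tower. Qed.

Lemma tower_union_min E E' s : {subset E <= E'} -> (forall i, s i \in E') ->
  {subset tower_union E s <= E'}.
Proof.
by move=> EE' sE' x /tower_unionP[n]; apply: tower_min => // i _; apply: sE'.
Qed.

End TowerUnion.

(** * The dichotomy for f' *)

Section Dichotomy.
Variables (F : fieldType) (D : {additive F -> F}) (S : {rmorphism F -> F}).
Variables (k : divringClosed F) (rho psi f b : F).
Hypothesis F0 : forall n, n.+1%:R != 0 :> F.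
Hypothesis DM : forall x y, D (x * y) = D x * y + x * D y.
Hypothesis Dk : forall x, x \in k -> D x \in k.
Hypothesis Sk : forall x, x \in k -> S x \in k.
Hypothesis fixk : forall x, S x = x -> x \in k.
Hypotheses (k_rho : rho \in k) (rho_neq0 : rho != 0).
Hypothesis DS : forall x, D (S x) = rho * S (D x).
Hypothesis Spsi : S psi = rho * psi.
Hypotheses (k_b : b \in k) (Sf : S f = f + b).

Let P j := iter j D psi.
Let fs j := iter j D f.
Hypothesis P_transc : forall j, transc (tower k P j) (P j).

Let L := tower_union k P.

Let delta x := psi * D x.
Let z i := iter i delta f.

Lemma tower_derivation (E E' : divringClosed F) (s : nat -> F) n : {subset E <= E'} ->
  (forall x, x \in E -> D x \in E') ->
  (forall i, (i < n)%N -> s i \in E') -> (forall i, (i < n)%N -> D (s i) \in E') ->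
  forall x, x \in tower E s n -> D x \in E'.
Proof.
move=> EE' DE; elim: n => [|n IHn] //= Es EDs; apply: derivation_adj_sub => //.
- by apply: tower_min => // i lt_in; apply/Es/ltnW.
- by apply: IHn => i lt_in; [apply/Es/ltnW | apply/EDs/ltnW].
- exact: Es.
- exact: EDs.
Qed.

Let psi_neq0 : psi != 0.
Proof.
by have := transc_notin (@P_transc 0); apply: contraNneq => psi0; rewrite /P /= psi0 rpred0.
Qed.

Let DL x : x \in L -> D x \in L.
Proof.
move=> /tower_unionP[n]; apply: tower_derivation => [y|y ky|i _|i _].
- exact: (@sub_tower_union _ _ _ 0).
- by apply: (@sub_tower_union _ _ _ 0); apply: Dk.
- exact: mem_tower_union.
- exact: (mem_tower_union _ _ i.+1).
Qed.

Let SL x : x \in L -> S x \in L.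
Proof.
(* Since [D] after [S] is [rho] times [S] after [D], applying [D] to [S (P j)] and dividing by [rho]
   gives [S (P j.+1)]; the order in [psi] grows by one only. *)
have SP j : S (P j) \in tower k P j.+1.
  elim: j => [|j IHj].
    by rewrite Spsi rpredM ?(mem_tower _ _ (leqnn 1)) // sub_tower.
  have -> : S (P j.+1) = rho^-1 * D (S (P j)) by rewrite DS mulKf.
  apply: rpredM; first by rewrite rpredV sub_tower.
  apply: tower_derivation IHj => [y|y ky|i lt_i|i lt_i].
  - exact: sub_tower.
  - by apply/sub_tower/Dk.
  - by apply/mem_tower/ltnW.
  - exact: (@mem_tower _ k P i.+1).
move=> /tower_unionP[n xn]; apply/tower_unionP; exists n.
elim: n x xn => [|n IHn] x //=; first exact: Sk.
by apply: stable_adj => //; apply: SP.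
Qed.

Let L_psi : psi \in L. Proof. exact: (mem_tower_union _ _ 0). Qed.
Let kL : {subset k <= L}. Proof. exact: (@sub_tower_union _ _ _ 0). Qed.

Let Sdelta x : S (delta x) = delta (S x).
Proof. by rewrite /delta rmorphM Spsi DS mulrCA mulrA. Qed.

Let bz i := iter i delta b.

Let L_bz i : bz i \in L.
Proof.
elim: i => [|i IHi]; first exact: kL.
by rewrite /bz /= /delta rpredM ?DL.
Qed.

Let Sz i : S (z i) = z i + bz i.
Proof.
by elim: i => [|i IHi] //=; rewrite Sdelta IHi /delta raddfD mulrDr.
Qed.

(** A triangular change of variables with diagonal entries [psi ^+ i], which are nonzero:
    independence over [L] passes from the iterates of [delta] on [f] to the derivatives of [f]. *)
Let z_lead i : exists2 W, W \in tower L fs i & z i = psi ^+ i * fs i + W.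
Proof.
elim: i => [|i [W TW defz]].
  by exists 0; rewrite ?rpred0 // expr0 mul1r addr0.
exists (psi * (D (psi ^+ i) * fs i + D W)).
  rewrite rpredM ?rpredD ?rpredM ?mem_tower //.
  - by apply: sub_tower.
  - by apply/sub_tower/DL; rewrite rpredX.
  apply: tower_derivation TW => [x|x Lx|j lt_j|j lt_j].
  - exact: sub_tower.
  - exact/sub_tower/DL.
  - by apply/mem_tower/ltnW.
  - exact: (@mem_tower _ L fs j.+1).
have -> : z i.+1 = psi * D (z i) by [].
have -> : fs i.+1 = D (fs i) by [].
by rewrite defz raddfD DM exprS; ring.
Qed.

Let psi_exp_neq0 i : psi ^+ i != 0.
Proof. by rewrite expf_neq0. Qed.

Let sub_f_z i : {subset tower L fs i <= tower L z i}.
Proof.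
elim: i => [|i IHi] //=; apply: adj_min => [x /IHi|]; first exact: sub_adj.
have [W TW defz] := z_lead i.
have -> : fs i = (z i - W) / psi ^+ i by rewrite defz addrK mulrC mulKf.
rewrite rpred_div ?rpredB ?mem_adj //; first exact/sub_adj/IHi.
by rewrite sub_adj // sub_tower // rpredX.
Qed.

Let f_transc_L i : transc (tower L z i) (z i) -> transc (tower L fs i) (fs i).
Proof.
move=> /(transcS (@sub_f_z i)) tz; have [W TW defz] := z_lead i.
have Tpsi : (psi ^+ i)^-1 \in tower L fs i.
  by rewrite sub_tower // rpredV rpredX.
have -> : fs i = (psi ^+ i)^-1 * z i + (- W * (psi ^+ i)^-1).
  rewrite defz; move: (psi ^+ i) (psi_exp_neq0 i) => w w0.
  by field.
by apply: transc_affine; rewrite ?rpredM ?rpredN ?invr_eq0.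
Qed.

(** The hypothesis adjoins the derivatives of [psi] first and those of [f] afterwards. The exchange
    lemma, applied to one derivative of [f] at a time, reverses this order. *)
Let P_transc_f i : (forall j, (j < i)%N -> transc (tower L fs j) (fs j)) ->
  forall j, transc (tower (tower k fs i) P j) (P j).
Proof.
elim: i => [|i IHi] tf j //.
have {IHi}tP := IHi (fun j lt_j => tf j (ltnW lt_j)).
set E := tower (tower k fs i) P j.
have tfi : transc (adj E (P j)) (fs i).
  apply: (transcS _ (tf i (leqnn _))); apply: adj_min; last first.
    exact/sub_tower/mem_tower_union.
  apply: tower_min; first exact: tower_mono.
  by move=> l _; apply/sub_tower/mem_tower_union.
apply: transcS (transc_exchange (tP j) tfi); apply: tower_min.
  apply: adj_min; last exact: mem_adj.
  by move=> x Tx; apply/sub_adj/sub_tower.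
by move=> l lt_l; apply/sub_adj/mem_tower.
Qed.

Let psi_exp_mem (E : divringClosed F) i : psi ^+ i \in tower E P i.
Proof.
case: i => [|i]; first exact: rpred1.
by rewrite rpredX // (@mem_tower _ E P 0).
Qed.

Section Minimal.
Variable q : nat.
Hypothesis f_transc : forall j, (j < q)%N -> transc (tower L fs j) (fs j).
Let k1 := tower k fs q.
Let E j := tower k1 P j.

Let P_transc1 j : transc (E j) (P j). Proof. exact: P_transc_f. Qed.

(** The derivative [fs q] genuinely involves [P s], the newest variable of [E s.+1]. Differentiating
    [m] more times brings in [P (s + m)] with a nonzero coefficient, so each further derivative of
    [f] is transcendental over a field that contains all earlier ones. *)
Lemma transc_of_new_variable s : fs q \in E s.+1 -> fs q \notin E s ->
  forall j, transc (tower k fs j) (fs j).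
Proof.
move=> fqs1 fqs.
(* The bound [s < N] is due to the last generator of [k1]: its derivative is [fs q], which is only
   known to lie in [E s.+1]. *)
have DE j N : (s < N)%N -> (j < N)%N -> forall x, x \in E j -> D x \in E N.
  move=> lt_sN; elim: j => [|j IHj] lt_jN.
    apply: (@tower_derivation k (E N) fs q) => [x kx|x kx|i lt_i|i lt_i].
    - by apply/sub_tower/sub_tower.
    - by apply/sub_tower/sub_tower/Dk.
    - by apply/sub_tower/mem_tower.
    - move: lt_i; rewrite leq_eqVlt => /predU1P[e|lt_i].
        have -> : D (fs i) = fs q by rewrite -e.
        exact: tower_sub lt_sN _ fqs1.
      by apply/sub_tower; apply: (@mem_tower _ k fs i.+1).
  apply: derivation_adj_sub => //; first exact: tower_sub (ltnW (ltnW lt_jN)).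
  - exact: IHj (ltnW lt_jN).
  - by apply/mem_tower/ltnW.
  - exact: (@mem_tower _ k1 P j.+1).
have step m : exists A B, [/\ A \in E (s + m).+1, B \in E (s + m).+1, B != 0 &
    fs (q + m).+1 = A + B * P (s + m).+1].
  elim: m => [|m [A [B [EA EB B0 defB]]]].
    rewrite !addn0; have [A [B [EA EB defB B0]]] :=
      derivation_adj F0 DM (@sub_adj _ (E s) (P s)) (DE s s.+1 (leqnn _) (leqnn _))
        (mem_adj (E s) (P s)) fqs1.
    by exists A, B; split=> //; apply: B0.
  have DE' x : x \in E (s + m).+1 -> D x \in E (s + m).+2.
    by apply: DE => //; rewrite ltnS -addnS leq_addr.
  (* The coefficient [B] of the newest variable does not change under differentiation; all other
     terms stay in the field below. *)
  exists (D A + D B * P (s + m).+1), B; rewrite !addnS; split=> //.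
  - by rewrite rpredD ?rpredM ?DE' ?mem_tower.
  - exact: sub_adj.
  have -> : fs (q + m).+2 = D (fs (q + m).+1) by [].
  by rewrite defB raddfD DM addrA.
have mem_fs m : fs (q + m) \in E (s + m).+1.
  case: m => [|m]; first by rewrite !addn0.
  rewrite addnS; have [A [B [EA EB _ ->]]] := step m.
  rewrite addnS; apply: rpredD; first exact: sub_adj EA.
  by apply: rpredM; [exact: sub_adj EB | exact: mem_tower].
have tf m : transc (E (s + m)) (fs (q + m)).
  case: m => [|m]; first by rewrite !addn0; apply: transc_of_mem_adj fqs1 fqs.
  rewrite !addnS; have [A [B [EA EB B0 ->]]] := step m.
  by rewrite addrC; apply: transc_affine.
move=> j; have [lt_jq|le_qj] := ltnP j q.
  apply: transcS (f_transc lt_jq); exact: tower_mono.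
rewrite -(subnKC le_qj); set m := (j - q)%N; apply: transcS (tf m).
apply: tower_min => [x kx|i lt_i]; first by apply/sub_tower/sub_tower.
have [lt_iq|le_qi] := ltnP i q; first by apply/sub_tower/mem_tower.
rewrite -(subnKC le_qi); apply: (tower_sub _ (mem_fs _)).
by rewrite -addnS leq_add2l -ltn_subLR // in lt_i *; rewrite ltn_subLR.
Qed.

(* The coefficient of the highest derivative of psi in delta^q f is
   psi^(q-1) f', which therefore lies in k<psi>. *)
Lemma derivation_mem_of_relation (c : nat -> F) : fs q \in k1 ->
  (forall i, c i \in k) -> z q - \sum_(i < q) c i * z i \in L -> D f \in k.
Proof.
move=> k1fq kc Lg.
have kk1 : {subset k <= k1} by move=> x; apply: sub_tower.
have Dk1 x : x \in k1 -> D x \in k1.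
  apply: tower_derivation => [//|y ky|i lt_i|i lt_i].
  - exact/kk1/Dk.
  - exact: mem_tower.
  - move: lt_i; rewrite leq_eqVlt => /predU1P[e|lt_i].
      by have -> : D (fs i) = fs q by rewrite -e.
    exact: (@mem_tower _ k fs i.+1).
have DE j x : x \in E j -> D x \in E j.+1.
  apply: tower_derivation => [y ky|y ky|i lt_i|i lt_i].
  - exact: sub_tower.
  - exact/sub_tower/Dk1.
  - by apply/mem_tower/ltnW.
  - exact: (@mem_tower _ k1 P i.+1).
have k1f : f \in k1.
  by case: (posnP q) => [q0|q_gt0]; [move: k1fq; rewrite q0 | apply: (@mem_tower _ k fs 0)].
have k1f1 : fs 1 \in k1 by apply: Dk1.
have zE i : exists2 W, W \in E i & z i.+1 = P i * psi ^+ i * fs 1 + W.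
  elim: i => [|i [W EW defz]].
    by exists 0; rewrite ?rpred0 // addr0 expr0 mulr1.
  exists (psi * (P i * D (psi ^+ i * fs 1) + D W)).
    rewrite rpredM ?(@mem_tower _ k1 P 0) // rpredD ?DE // rpredM ?mem_tower //.
    by apply: DE; apply: rpredM; [exact: psi_exp_mem | exact: sub_tower].
  have -> : z i.+2 = psi * D (z i.+1) by [].
  have -> : P i.+1 = D (P i) by [].
  by rewrite defz raddfD -mulrA DM exprS; ring.
have zEi i : z i \in E i.
  case: i => [|i]; first exact: k1f.
  have [W EW ->] := zE i; apply: rpredD; last exact: sub_adj EW.
  apply: rpredM; last exact: sub_tower.
  by apply: rpredM; [exact: mem_tower | exact/sub_adj/psi_exp_mem].
case: (posnP q) => [q0|q_gt0].
  by apply: Dk; move: k1fq; rewrite /k1 q0.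
have [p defq] : exists p, q = p.+1 by exists q.-1; rewrite prednK.
move: Lg; set g := _ - _ => Lg; have [W EW defz] := zE p.
pose W' := W - \sum_(i < q) c i * z i.
have EW' : W' \in E p.
  rewrite rpredB ?rpred_sum // => i _; rewrite rpredM //.
    by apply/sub_tower/kk1.
  by apply: (tower_sub _ (zEi i)); rewrite -ltnS -defq.
have defg : g = (psi ^+ p * fs 1) * P p + W'.
  by rewrite /g /W' {1}defq defz; ring.
have Eg j : (p < j)%N -> g \in E j.
  move=> lt_pj; rewrite defg; apply: rpredD.
    apply: rpredM; last exact: mem_tower.
    apply: rpredM; last exact: sub_tower.
    exact: tower_sub (ltnW lt_pj) _ (psi_exp_mem _ _).
  exact: tower_sub (ltnW lt_pj) _ EW'.
(* Over [k1] the element [g] does not involve [P j], and [P j] is transcendental there, so [g]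
   cannot involve it over [k] either. *)
have drop j : (p < j)%N -> g \in tower k P j.+1 -> g \in tower k P j.
  by move=> /Eg Ej; apply: (mem_adj_sub (@tower_mono _ _ _ P j kk1) (@P_transc1 j) Ej).
have {Lg} kg : g \in tower k P p.+1.
  have /tower_unionP[N kgN] := Lg.
  have : g \in tower k P (p.+1 + N) by apply: (tower_sub _ kgN); rewrite leq_addl.
  elim: (N) => [|n IHn]; first by rewrite addn0.
  by rewrite addnS => kgn; apply/IHn/drop; rewrite ?leq_addr.
have Ec : psi ^+ p * fs 1 \in tower k P p.
  (* [g] is the value at [P p] of a polynomial of degree at most 1 over the tower above [k1]; as [g]
     also lies in the tower above [k], so do the coefficients. *)
  pose Q := (psi ^+ p * fs 1) *: 'X + W'%:P.
  have EQ : Q \is a polyOver (E p).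
    rewrite rpredD ?polyOverC // polyOverZ ?polyOverX //.
    by apply: rpredM; [exact: psi_exp_mem | exact: sub_tower].
  have Qg : Q.[P p] \in adj (tower k P p) (P p) by rewrite hornerD hornerZ hornerX hornerC -defg.
  have := polyOver_adj (@tower_mono _ _ _ P p kk1) (@P_transc1 p) EQ Qg.
  by move=> /polyOverP/(_ 1); rewrite coefD coefZ coefX coefC mulr1 addr0.
have Ef1 : fs 1 \in tower k P p.
  rewrite -(mulKf (psi_exp_neq0 p) (fs 1)) rpredM // rpredV.
  exact: psi_exp_mem.
(* For [q = 1] this tower is [k] itself and the claim is reached. For [q > 1] the first derivative
   of [f] would lie in [L], against its transcendence there. *)
have [p0|p_gt0] := posnP p; first by move: Ef1; rewrite p0.
have lt_1q : (1 < q)%N by rewrite defq.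
have /negP[] := transc_notin (f_transc lt_1q).
exact/sub_tower/(sub_tower_union Ef1).
Qed.

End Minimal.

Theorem transc_or_derivation_mem :
  (forall j, transc (tower k fs j) (fs j)) \/ D f \in k.
Proof.
have [tz|] := pselect (forall i, transc (tower L z i) (z i)).
  left=> j; apply: transcS (f_transc_L (tz j)); exact: tower_mono.
move=> /existsNP[q0 nq0].
have exq : exists q, `[< ~ transc (tower L z q) (z q) >] by exists q0; apply/asboolP.
have [q /asboolP nq minq] := ex_minnP exq.
have tz i : (i < q)%N -> transc (tower L z i) (z i).
  move=> lt_iq; apply: contrapT => ni.
  have /minq : `[< ~ transc (tower L z i) (z i) >] by apply/asboolP.
  by rewrite leqNgt lt_iq.
have fixL x : S x = x -> x \in L by move/fixk/kL.
have [c Sc Lg] := ostrowski F0 SL fixL Sz L_bz tz nq.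
have tf j (lt_jq : (j < q)%N) := f_transc_L (tz j lt_jq).
pose k1 := tower k fs q.
(* The relation is solved for its top term: all the rest lies in [L] with the lower derivatives of
   [f] adjoined. *)
have : fs q \in tower_union k1 P.
  have sub : {subset tower L fs q <= tower_union k1 P}.
    apply: tower_min => [|i lt_i].
      apply: tower_union_min => [x kx|i]; last exact: mem_tower_union.
      by apply: (@sub_tower_union _ _ _ 0); apply: (@sub_tower _ k fs q).
    by apply: (@sub_tower_union _ _ _ 0); apply: (@mem_tower _ k fs).
  apply: sub; have [W TW defz] := z_lead q.
  rewrite -(mulKf (psi_exp_neq0 q) (fs q)) rpredM //.
    by rewrite sub_tower // rpredV rpredX.
  have -> : psi ^+ q * fs q =
      (z q - \sum_(i < q) c i * z i) - W + \sum_(i < q) c i * z i.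
    by rewrite defz; ring.
  apply: rpredD; first by apply: rpredB TW; apply: sub_tower.
  apply: rpred_sum => i _; apply: rpredM; first by rewrite sub_tower ?fixL.
  have [W' TW' ->] := z_lead i.
  rewrite rpredD ?rpredM ?mem_tower //; first by rewrite sub_tower // rpredX.
  exact: tower_sub (ltnW (ltn_ord i)) _ TW'.
(* The least height at which [fs q] appears decides: height 0 means that it lies in [k1], height
   [s.+1] that [P s] really occurs in it. *)
move=> /tower_unionP exN; have [[|s] Ns mins] := ex_minnP exN.
  right; apply: (derivation_mem_of_relation tf Ns _ Lg) => i.
  exact: fixk.
left; apply: (transc_of_new_variable tf Ns); apply/negP => /mins.
by rewrite ltnn.
Qed.

End Dichotomy.

(** * Algebraic independence and multivariate polynomials *)

Section UnivariateView.
Variables (n : nat) (K : fieldType).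
Implicit Types P : mpoly n.+1 K.

Definition mnm_init (m : multinom n.+1) : multinom n :=
  Multinom [tuple m (widen_ord (leqnSn n) i) | i < n].

Lemma mnm_eq_init (m m' : multinom n.+1) :
  mnm_init m = mnm_init m' -> m ord_max = m' ord_max -> m = m'.
Proof.
move=> e emax; apply/mnmP => i; have [lt_in|le_ni] := ltnP i n.
  have := congr1 (fun h : multinom n => h (Ordinal lt_in)) e.
  rewrite !mnmE; congr (_ = _); congr (fun_of_multinom _ _); exact: val_inj.
have -> // : i = ord_max; apply/val_inj/eqP.
by rewrite eqn_leq le_ni -ltnS ltn_ord.
Qed.

Lemma muni_sum P :
  muni P = \sum_(m <- msupp P) mcoeff m P *: mpolyX K (mnm_init m) *: 'X^(m ord_max).
Proof. by rewrite muniE. Qed.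

Lemma muni_inj P : muni P = 0 -> P = 0.
Proof.
move=> P0; apply/eqP; rewrite -msupp_eq0; case sP: (msupp P) => [//|m s].
have Pm : m \in msupp P by rewrite sP mem_head.
have := congr1 (fun Q : {poly mpoly n K} => mcoeff (mnm_init m) Q`_(m ord_max)) P0.
rewrite /= coef0 mcoeff0 muni_sum coef_sum raddf_sum /=.
rewrite (bigD1_seq m) ?msupp_uniq //= coefZ coefXn eqxx mulr1 mcoeffZ mcoeffX eqxx mulr1.
rewrite big1_seq ?addr0 => [/eqP|m' /andP[ne_m _]].
  by rewrite mcoeff_eq0 Pm.
rewrite coefZ coefXn; have [e|] := eqVneq (m ord_max) (m' ord_max); last by rewrite mulr0 mcoeff0.
rewrite mulr1 mcoeffZ mcoeffX; have [e'|] := eqVneq; last by rewrite mulr0.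
by case/eqP: ne_m; apply: mnm_eq_init.
Qed.

(** This turns a relation for the last variable, with polynomial coefficients in the others, back
    into one multivariate polynomial. *)
Lemma muni_surj (Q : {poly mpoly n K}) : exists P, muni P = Q.
Proof.
have surjX (m : multinom n) : exists P, muni P = (mpolyX K m)%:P.
  exists (mpolyX K (mnmwiden m)); rewrite muni_sum msuppX big_seq1 mcoeffX eqxx scale1r.
  rewrite mnmwiden_ordmax expr0 alg_polyC; congr (mpolyX K _)%:P.
  by apply/mnmP => i; rewrite mnmE mnmwiden_widen.
have surjC (q : mpoly n K) : exists P, muni P = q%:P.
  elim/mpolyind: q => [|c m q _ _ [P defP]]; first by exists 0; rewrite raddf0 rmorph0.
  have [M defM] := surjX m; exists (c *: M + P).
  by rewrite raddfD /= defP muniZ defM polyCD -mul_mpolyC polyCM mul_polyC.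
have surjXmax : exists P, muni P = 'X.
  exists (mpolyX K (mnm1 ord_max)); rewrite muni_sum msuppX big_seq1 mcoeffX eqxx scale1r.
  rewrite mnm1E eqxx expr1; have -> : mnm_init (mnm1 ord_max) = @mnm0 n.
    apply/mnmP => i; rewrite mnmE mnm1E mnm0E; case: eqP => // /(congr1 val) /= e.
    by have := ltn_ord i; rewrite -e ltnn.
  by rewrite mpolyX0 scale1r.
have [X defX] := surjXmax; elim/poly_ind: Q => [|Q q [P defP]].
  by exists 0; rewrite raddf0.
have [M defM] := surjC q; exists (P * X + M).
by rewrite raddfD /= defM -defP -defX rmorphM.
Qed.

End UnivariateView.

Lemma map_poly_muladd (A B : nzRingType) (phi : {rmorphism A -> B}) b c P :
  map_poly phi (b *: P * 'X + c%:P) = phi b *: map_poly phi P * 'X + (phi c)%:P.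
Proof. by rewrite rmorphD rmorphM /= map_polyX map_polyC map_polyZ. Qed.

Lemma map_poly_Cmul (A B : nzRingType) (phi : {rmorphism A -> B}) c P :
  map_poly phi (c%:P * P) = phi c *: map_poly phi P.
Proof. by rewrite mul_polyC map_polyZ. Qed.

Section AlgebraicIndependence.
Variables (K F : fieldType) (iota : {rmorphism K -> F}) (k : divringClosed F).
Hypothesis kP : forall x, reflect (exists a, x = iota a) (x \in k).
Variable s : nat -> F.

Let ev n : {rmorphism mpoly n K -> F} := mmap iota (fun i : 'I_n => s i).

Lemma mmap_muni n (P : mpoly n.+1 K) :
  ev _ P = (map_poly (ev n) (muni P)).[s n].
Proof.
rewrite muni_sum raddf_sum /= horner_sum; apply: eq_bigr => m _.
rewrite -mul_polyC rmorphM /= map_polyC map_polyXn hornerM hornerC hornerXn /=.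
rewrite /ev /= mmapZ mmapX -mulrA /mmap1 big_ord_recr /=; congr (_ * (_ * _)).
by apply: eq_bigr => i _; rewrite mnmE.
Qed.

Lemma mmap_tower n (P : mpoly n K) : ev _ P \in tower k s n.
Proof.
elim: n P => [|n IHn] P.
  apply: rpred_sum => m _; rewrite /mmap1 big_ord0 mulr1.
  by apply/kP; exists (mcoeff m P).
rewrite mmap_muni rpred_horner ?mem_adj //; apply/polyOverP => i.
by rewrite coef_map; apply/sub_adj/IHn.
Qed.

(** Induction on the number of variables: the leading coefficient in the last variable is nonzero,
    so its value is nonzero, and transcendence applies to the resulting univariate polynomial. *)
Lemma mmap_neq0_of_transc n (P : mpoly n K) :
  (forall j, transc (tower k s j) (s j)) -> P != 0 -> ev _ P != 0.
Proof.
move=> ts; elim: n P => [|n IHn] P P0.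
  have -> : P = mpolyC 0 (mcoeff (@mnm0 0) P).
    apply/mpolyP => m; have -> : m = @mnm0 0 by apply/mnmP => -[].
    by rewrite mcoeffC eqxx mulr1.
  rewrite /ev /= mmapC fmorph_eq0; apply: contraNneq P0 => P0.
  apply/eqP/mpolyP => m; have -> : m = @mnm0 0 by apply/mnmP => -[].
  by rewrite mcoeff0.
rewrite mmap_muni; apply: ts.
  by apply/polyOverP => i; rewrite coef_map mmap_tower.
have : lead_coef (muni P) != 0.
  by rewrite lead_coef_eq0; apply: contraNneq P0 => /muni_inj->.
move=> /IHn; apply: contraNneq => /polyP/(_ (size (muni P)).-1).
by rewrite coef_map coef0 lead_coefE => ->.
Qed.

(** Elements of the tower are quotients of values of polynomials. A relation for [s j] over the
    tower, cleared of denominators, is therefore a polynomial relation in one more variable. *)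
Lemma transc_of_mmap_neq0 :
  (forall n (P : mpoly n.+1 K), P != 0 -> ev _ P != 0) ->
  forall j, transc (tower k s j) (s j).
Proof.
move=> ev0; have frac_poly n :
    (forall x, x \in tower k s n -> exists P Q : mpoly n K, ev _ Q != 0 /\ x = ev _ P / ev _ Q :> F) ->
    forall p, p \is a polyOver (tower k s n) -> exists2 Q : mpoly n K, ev _ Q != 0 &
      exists P, ev _ Q *: p = map_poly (ev n) P.
  move=> frac; elim/poly_ind => [_|p c IHp Tpc].
    exists 1; first by rewrite rmorph1 oner_neq0.
    by exists 0; rewrite scaler0 raddf0.
  have Tc : c \in tower k s n.
    by move/polyOverP/(_ 0%N): Tpc; rewrite coefD coefMX coefC add0r.
  have Tp : p \is a polyOver (tower k s n).
    apply/polyOverP => i; move/polyOverP/(_ i.+1): Tpc.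
    by rewrite coefD coefMX coefC addr0.
  have [Q Q0 [P defP]] := IHp Tp; have [A [B [B0 ->]]] := frac c Tc.
  exists (Q * B); first by rewrite rmorphM mulf_neq0.
  exists (B *: P * 'X + (Q * A)%:P).
  rewrite map_poly_muladd -defP !(rmorphM (ev n)) scalerDr; congr (_ + _).
    by rewrite -!mul_polyC polyCM; ring.
  by rewrite scale_polyC; congr _%:P; rewrite -mulrA; congr (_ * _); rewrite mulrC divfK.
have frac n x : x \in tower k s n -> exists P Q : mpoly n K, ev _ Q != 0 /\ x = ev _ P / ev _ Q :> F.
  elim: n x => [|n IHn] x /=.
    move=> /kP[a ->]; by exists (mpolyC 0 a), 1; rewrite rmorph1 divr1 oner_neq0 /ev /= mmapC.
  move=> /adjP[p [q [Tp Tq q0 ->]]].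
  have [A A0 [P defP]] := frac_poly n IHn p Tp.
  have [B B0 [Q defQ]] := frac_poly n IHn q Tq.
  have [P1 defP1] := muni_surj (B%:P * P); have [Q1 defQ1] := muni_surj (A%:P * Q).
  have evP1 : ev n.+1 P1 = ev n B * (ev n A * p.[s n]).
    by rewrite mmap_muni defP1 map_poly_Cmul -defP !hornerZ.
  have evQ1 : ev n.+1 Q1 = ev n A * (ev n B * q.[s n]).
    by rewrite mmap_muni defQ1 map_poly_Cmul -defQ !hornerZ.
  exists P1, Q1; rewrite evP1 evQ1 !mulf_neq0 //; split=> //.
  by rewrite mulrCA -mulf_div divff ?mul1r // -mulf_div divff ?mul1r.
move=> n p Tp p0; apply/eqP => pn.
have [Q Q0 [P defP]] := frac_poly n (frac n) p Tp; have [P1 defP1] := muni_surj P.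
have /ev0/eqP[] : P1 != 0.
  apply: contraNneq p0 => P10; have : ev _ Q *: p = 0.
    by rewrite defP -defP1 P10 !raddf0.
  by move/eqP; rewrite scaler_eq0 (negbTE Q0).
by rewrite mmap_muni defP1 -defP hornerZ pn mulr0.
Qed.

End AlgebraicIndependence.

(** * Formal power series *)

#[local] Arguments pscoef : simpl never.

Section PowerSeriesCalculus.
Variable C : fieldType.
Implicit Types (f g h s u : pseries C) (p q : {poly C}).

Local Notation psc := (fun c => ps_of_poly c%:P).
Local Notation psX := (ps_of_poly 'X : pseries C).

Lemma pscoef_poly p n : pscoef (ps_of_poly p) n = p`_n.
Proof. by []. Qed.

Lemma pscoef_mk (a : nat -> C) n : pscoef (PSeries a) n = a n.
Proof. by []. Qed.

Lemma pscoef1 n : pscoef (1 : pseries C) n = (n == 0)%:R.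
Proof. by rewrite -[1]/(ps_of_poly 1) pscoef_poly coef1. Qed.

Lemma pscoef_compE s f n : pscoef (ps_comp s f) n =
  \sum_(i < n.+1) pscoef f i * pscoef (s ^+ i) n.
Proof. by []. Qed.

Lemma pscoef_deriv f n : pscoef (ps_deriv f) n = pscoef f n.+1 *+ n.+1.
Proof. by []. Qed.

Lemma pscoefM f g n :
  pscoef (f * g) n = \sum_(i < n.+1) pscoef f i * pscoef g (n - i).
Proof. by []. Qed.

Lemma pscoefD f g n : pscoef (f + g) n = pscoef f n + pscoef g n.
Proof. by []. Qed.

Lemma pscoefN f n : pscoef (- f) n = - pscoef f n.
Proof. by []. Qed.

Lemma pscoef0 n : pscoef (0 : pseries C) n = 0.
Proof. by rewrite -[0]/(ps_of_poly 0) pscoef_poly coef0. Qed.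

Lemma pscoef_sum (I : Type) (r : seq I) (P : pred I) (G : I -> pseries C) n :
  pscoef (\sum_(i <- r | P i) G i) n = \sum_(i <- r | P i) pscoef (G i) n.
Proof.
by elim/big_rec2: _ => [|i x y _ <-]; rewrite ?pscoef0.
Qed.

Lemma pscoefM_trunc f g n m : (m <= n)%N ->
  pscoef (f * g) m = (ps_trunc n f * ps_trunc n g)`_m.
Proof. exact: ps_mul_trunc. Qed.

Lemma pscoef0M f g : pscoef (f * g) 0 = pscoef f 0 * pscoef g 0.
Proof. by rewrite pscoefM big_ord1. Qed.

Lemma pscoef0X f n : pscoef (f ^+ n) 0 = pscoef f 0 ^+ n.
Proof.
elim: n => [|n IHn]; first by rewrite !expr0 pscoef1.
by rewrite !exprS pscoef0M IHn.
Qed.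

Lemma pscoefCM c f n : pscoef (psc c * f) n = c * pscoef f n.
Proof.
rewrite pscoefM big_ord_recl pscoef_poly coefC /= subn0 big1 ?addr0 // => i _.
by rewrite pscoef_poly coefC mul0r.
Qed.

Lemma pscoefXnM k f n :
  pscoef (psX ^+ k * f) n = if (n < k)%N then 0 else pscoef f (n - k).
Proof.
elim: k n => [|k IHk] n; first by rewrite expr0 mul1r subn0.
rewrite exprS -mulrA pscoefM.
case: n => [|n]; first by rewrite big_ord1 pscoef_poly coefX mul0r.
rewrite big_ord_recl pscoef_poly coefX mul0r add0r.
rewrite big_ord_recl pscoef_poly coefX mul1r /bump /= !subSS subn0.
rewrite IHk big1 ?addr0 // => i _.
by rewrite pscoef_poly coefX mul0r.
Qed.

Lemma psX_neq0 : psX != 0.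
Proof.
apply/eqP => /(congr1 (fun f => pscoef f 1)) /eqP.
by rewrite pscoef0 pscoef_poly coefX oner_eq0.
Qed.

Lemma ps_split k f : f = ps_of_poly (\poly_(i < k) pscoef f i) +
  psX ^+ k * PSeries (fun i => pscoef f (k + i)).
Proof.
apply/psP => n; rewrite pscoefD pscoefXnM pscoef_poly coef_poly pscoef_mk.
by case: ltnP => [|le_kn]; rewrite ?addr0 ?add0r ?subnKC.
Qed.

Lemma ps_factor f : f != 0 ->
  exists n g, f = psX ^+ n * g /\ pscoef g 0 != 0.
Proof.
move=> /ps_order[n [fn minn]]; exists n, (PSeries (fun i => pscoef f (n + i))).
split; last by rewrite pscoef_mk addn0.
apply/psP => i; rewrite pscoefXnM; case: ltnP => [/minn //|le_ni].
by rewrite pscoef_mk subnKC.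
Qed.

Lemma ps_factor_inj n m f g : pscoef f 0 != 0 -> pscoef g 0 != 0 ->
  psX ^+ n * f = psX ^+ m * g -> n = m /\ f = g.
Proof.
move=> f0 g0 e; suff enm : n = m.
  split=> //; move: e; rewrite enm; apply: mulfI.
  by rewrite expf_neq0 ?psX_neq0.
wlog lt_nm : n m f g f0 g0 e / (n < m)%N.
  by move=> wl; case: (ltngtP n m) => // lt; [apply: (wl n m f g) | apply/esym/(wl m n g f)].
have /eqP := congr1 (fun h => pscoef h n) e; rewrite !pscoefXnM lt_nm ltnn subnn.
by rewrite (negbTE f0).
Qed.

(* A continuity argument: in each coefficient, a tail X^N g does not count. *)
Lemma ps_additive_ext (A B : pseries C -> pseries C) :
  zmod_morphism A -> zmod_morphism B ->
  (forall n, exists N, forall g,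
     pscoef (A (psX ^+ N * g)) n = pscoef (B (psX ^+ N * g)) n) ->
  (forall p, A (ps_of_poly p) = B (ps_of_poly p)) -> A =1 B.
Proof.
move=> Aadd Badd tail AB f; apply/psP => n; have [N tailN] := tail n.
have D (T : pseries C -> pseries C) : zmod_morphism T -> forall g h, T (g + h) = T g + T h.
  move=> Tadd g h; have T0 : T 0 = 0 by rewrite -{1}(subrr 0) Tadd subrr.
  have TN x : T (- x) = - T x by rewrite -sub0r Tadd T0 sub0r.
  by rewrite -{1}[h]opprK Tadd TN opprK.
by rewrite (ps_split N f) !D // !pscoefD AB tailN.
Qed.

Section Composition.
Variable s : pseries C.
Hypothesis s0 : pscoef s 0 = 0.

Lemma pscoef_exp_small n m : (m < n)%N -> pscoef (s ^+ n) m = 0.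
Proof.
have -> : s = psX * PSeries (fun i => pscoef s i.+1).
  apply/psP => -[|i]; rewrite -[psX]expr1 pscoefXnM //.
  by rewrite subn1 pscoef_mk.
by rewrite exprMn pscoefXnM => ->.
Qed.

Lemma pscoef_comp f n N : (n < N)%N ->
  pscoef (ps_comp s f) n = \sum_(i < N) pscoef f i * pscoef (s ^+ i) n.
Proof.
move=> lt_nN; rewrite pscoef_compE (big_ord_widen _ (fun i => pscoef f i * pscoef (s ^+ i) n) lt_nN).
rewrite [RHS](bigID (fun i : 'I_N => (i < n.+1)%N)) /= [X in _ + X]big1 ?addr0 // => i.
by rewrite -leqNgt => /pscoef_exp_small->; rewrite mulr0.
Qed.

Lemma ps_comp_zmod : zmod_morphism (ps_comp s).
Proof.
move=> f g; apply/psP => n; rewrite pscoefD pscoefN !pscoef_compE -sumrB.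
by apply: eq_bigr => i _; rewrite pscoefD pscoefN mulrBl.
Qed.

Lemma ps_comp_poly p : ps_comp s (ps_of_poly p) =
  (map_poly (@ps_of_poly C \o polyC) p).[s].
Proof.
apply/psP => n; rewrite (@pscoef_comp _ _ (maxn n.+1 (size p))) ?leq_maxl //.
rewrite (@horner_coef_wide _ (maxn n.+1 (size p))); last first.
  by rewrite (leq_trans (size_poly _ _)) ?leq_maxr.
rewrite pscoef_sum; apply: eq_bigr => i _.
by rewrite coef_map -pscoefCM.
Qed.

Lemma ps_of_polyMXC p c :
  ps_of_poly (p * 'X + c%:P) = ps_of_poly p * psX + psc c.
Proof. by rewrite rmorphD rmorphM. Qed.

Lemma horner_polyMXC p c :
  (map_poly (@ps_of_poly C \o polyC) (p * 'X + c%:P)).[s] =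
  (map_poly (@ps_of_poly C \o polyC) p).[s] * s + psc c.
Proof. by rewrite rmorphD rmorphM /= map_polyX map_polyC !hornerE. Qed.

Lemma ps_comp_eq f g n : (forall i, (i <= n)%N -> pscoef f i = pscoef g i) ->
  pscoef (ps_comp s f) n = pscoef (ps_comp s g) n.
Proof.
by move=> fg; rewrite !pscoef_compE; apply: eq_bigr => i _; rewrite fg // -ltnS.
Qed.

(** A coefficient of a composition depends on a truncation only, and on polynomials composition is
    Horner evaluation, which is multiplicative. *)
Lemma ps_compM f g : ps_comp s (f * g) = ps_comp s f * ps_comp s g.
Proof.
apply/psP => n; pose T h := ps_of_poly (ps_trunc n h).
have TE h i : (i <= n)%N -> pscoef (ps_comp s (T h)) i = pscoef (ps_comp s h) i.
  move=> le_in; apply: ps_comp_eq => j le_ji.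
  by rewrite pscoef_poly ps_truncE // (leq_trans le_ji).
transitivity (pscoef (ps_comp s (ps_of_poly (ps_trunc n f * ps_trunc n g))) n).
  by apply: ps_comp_eq => i le_in; rewrite (pscoefM_trunc _ _ le_in).
rewrite ps_comp_poly rmorphM hornerM -!ps_comp_poly !pscoefM.
by apply: eq_bigr => i _; rewrite !TE // ?leq_subr // -ltnS.
Qed.

Lemma ps_comp1 : ps_comp s 1 = 1.
Proof. by rewrite -[1 in LHS]/(ps_of_poly 1) ps_comp_poly rmorph1 hornerC. Qed.

Lemma ps_compX : ps_comp s psX = s.
Proof. by rewrite ps_comp_poly map_polyX hornerX. Qed.

Lemma ps_compC c : ps_comp s (psc c) = psc c.
Proof. by rewrite ps_comp_poly map_polyC hornerC. Qed.

Lemma pscoef0_comp f : pscoef (ps_comp s f) 0 = pscoef f 0.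
Proof. by rewrite pscoef_compE big_ord1 expr0 pscoef1 mulr1. Qed.

Definition ps_comp_rmorphism : {rmorphism pseries C -> pseries C} :=
  HB.pack (ps_comp s)
    (GRing.isZmodMorphism.Build _ _ (ps_comp s) ps_comp_zmod)
    (GRing.isMonoidMorphism.Build _ _ (ps_comp s) (conj ps_comp1 ps_compM)).

Lemma ps_compD f g : ps_comp s (f + g) = ps_comp s f + ps_comp s g.
Proof. exact: (rmorphD ps_comp_rmorphism). Qed.

Lemma ps_compXn n : ps_comp s (psX ^+ n) = s ^+ n.
Proof. by rewrite -[LHS]/(ps_comp_rmorphism _) rmorphXn /= ps_compX. Qed.

Lemma ps_comp_factor e h n g : s = psX ^+ e * h ->
  ps_comp s (psX ^+ n * g) = psX ^+ (e * n) * (h ^+ n * ps_comp s g).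
Proof.
move=> defs; rewrite ps_compM ps_compXn mulrA; congr (_ * _).
by rewrite [LHS](congr1 (fun x => x ^+ n) defs) exprMn exprM.
Qed.

(** Orders multiply under composition: with $s = t^e h$ and $f = t^n g$ the leading coefficient of
    $f(s)$ is $h_0^n g_0$, at $t^{en}$. *)
Lemma ps_comp_eq0 f : s != 0 -> ps_comp s f = 0 -> f = 0.
Proof.
move=> /ps_factor[e [h [defs h0]]] sf0; apply/eqP/negP => /negP.
move=> /ps_factor[n [g [deff g0]]]; move: sf0; rewrite deff (ps_comp_factor _ _ defs).
move/(congr1 (fun x => pscoef x (e * n))); rewrite pscoefXnM ltnn subnn pscoef0 => /eqP.
by rewrite pscoef0M pscoef0X pscoef0_comp mulf_eq0 expf_eq0 (negbTE h0) (negbTE g0) andbF.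
Qed.

Lemma ps_comp_inj : s != 0 -> injective (ps_comp s).
Proof.
move=> sn0 f g e; apply/eqP; rewrite -subr_eq0; apply/eqP/(ps_comp_eq0 sn0).
by rewrite ps_comp_zmod e subrr.
Qed.

(** No continuity of [T] is assumed: being multiplicative, [T] sends multiples of $t^N$ to multiples
    of $s^N$. *)
Lemma ps_comp_unique (T : {rmorphism pseries C -> pseries C}) :
  (forall c, T (psc c) = psc c) -> T psX = s -> T =1 ps_comp s.
Proof.
move=> TC TX; apply: ps_additive_ext; [exact: raddfB|exact: ps_comp_zmod| |].
  move=> n; exists n.+1 => g; rewrite ps_compM rmorphM rmorphXn TX ps_compXn.
  rewrite !pscoefM; apply: eq_bigr => i _.
  by rewrite !pscoef_exp_small ?mul0r.
move=> p; rewrite ps_comp_poly; elim/poly_ind: p => [|p c IHp].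
  by rewrite !raddf0 horner0.
by rewrite ps_of_polyMXC rmorphD rmorphM TC TX IHp horner_polyMXC.
Qed.

End Composition.

Section Derivation.

Lemma ps_deriv_zmod : zmod_morphism (@ps_deriv C).
Proof. by move=> f g; apply/psP => n; rewrite pscoefD pscoefN !pscoef_deriv pscoefD pscoefN mulrnBl. Qed.

HB.instance Definition _ :=
  GRing.isZmodMorphism.Build (pseries C) (pseries C) (@ps_deriv C) ps_deriv_zmod.

Lemma ps_derivD f g : ps_deriv (f + g) = ps_deriv f + ps_deriv g.
Proof. exact: raddfD. Qed.

Lemma ps_deriv_poly p : ps_deriv (ps_of_poly p) = ps_of_poly p^`().
Proof. by apply/psP => n; rewrite pscoef_deriv !pscoef_poly coef_deriv. Qed.

Lemma ps_derivM f g : ps_deriv (f * g) = ps_deriv f * g + f * ps_deriv g.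
Proof.
apply/psP => n; rewrite pscoefD; have -> : pscoef (ps_deriv (f * g)) n =
    pscoef (f * g) n.+1 *+ n.+1 by [].
rewrite (pscoefM_trunc f g (leqnn n.+1)) -coef_deriv derivM coefD.
have D h i : (i <= n)%N -> (ps_trunc n.+1 h)^`()`_i = pscoef (ps_deriv h) i.
  by move=> le_in; rewrite coef_deriv ps_truncE.
have T h i : (i <= n)%N -> (ps_trunc n.+1 h)`_i = pscoef h i.
  by move=> le_in; rewrite ps_truncE // leqW.
by rewrite !coefM !pscoefM; congr (_ + _); apply: eq_bigr => i _;
  rewrite D ?T ?leq_subr // -ltnS.
Qed.

Lemma ps_deriv_exp f n : ps_deriv (f ^+ n.+1) = f ^+ n * ps_deriv f *+ n.+1.
Proof.
elim: n => [|n IHn]; first by rewrite expr1 expr0 mul1r.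
rewrite exprS ps_derivM IHn mulrnAr mulrA -exprS [_ * f ^+ n.+1]mulrC.
by rewrite -mulrS.
Qed.

Lemma ps_deriv_comp s f : pscoef s 0 = 0 ->
  ps_deriv (ps_comp s f) = ps_comp s (ps_deriv f) * ps_deriv s.
Proof.
move=> s0.
apply: (@ps_additive_ext (fun f => ps_deriv (ps_comp s f))
  (fun f => ps_comp s (ps_deriv f) * ps_deriv s)) => [g h|g h|n|p].
- by rewrite ps_comp_zmod raddfB.
- by rewrite raddfB /= ps_comp_zmod mulrBl.
(* One order more than for the composition itself, because differentiation lowers the order by
   one. *)
- exists n.+2 => g; have small k h i : (i < k)%N -> pscoef (s ^+ k * h) i = 0.
    move=> lt_ik; rewrite pscoefM big1 // => j _.
    by rewrite (pscoef_exp_small s0) ?mul0r // (leq_trans _ lt_ik) // ltn_ord.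
  have small2 k h h' i : (i < k)%N -> pscoef (s ^+ k * h * h') i = 0.
    by move=> lt_ik; rewrite -mulrA small.
  have cX k h : ps_comp s (psX ^+ k * h) = s ^+ k * ps_comp s h.
    by rewrite ps_compM // ps_compXn.
  have small' k h h' i c : (i < k)%N -> pscoef (s ^+ k * h *+ c * h') i = 0.
    by move=> lt_ik; rewrite mulrnAl -mulrnAr -mulrA small.
  rewrite ps_compM // ps_compXn // ps_derivM ps_deriv_exp pscoefD small' // small //.
  rewrite ps_derivM ps_deriv_exp -mulrnAr -mulrA (ps_compD s0).
  rewrite !cX mulrDl pscoefD !small2 // addr0.
rewrite ps_deriv_poly !ps_comp_poly //; elim/poly_ind: p => [|p c IHp].
  by rewrite deriv0 !raddf0 !horner0 mul0r raddf0.
rewrite horner_polyMXC ps_derivD ps_derivM IHp ps_deriv_poly derivC.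
rewrite derivD derivC !addr0 derivM derivX mulr1 rmorphD hornerD.
have -> : (map_poly (@ps_of_poly C \o polyC) (p^`() * 'X)).[s] =
    (map_poly (@ps_of_poly C \o polyC) p^`()).[s] * s.
  by rewrite -[_ * 'X]addr0 -polyC0 horner_polyMXC polyC0 addr0.
by rewrite mulrDl mulrAC addrC.
Qed.

Hypothesis C0 : forall n, n.+1%:R != 0 :> C.

Lemma ps_log1p_deriv u : pscoef u 0 = 0 ->
  ps_deriv (ps_log1p u) * (1 + u) = ps_deriv u.
Proof.
move=> u0; rewrite /ps_log1p ps_deriv_comp //; set l := PSeries _.
(* Here [l] is $\log(1+t)$, whose derivative is the alternating geometric series; the claim follows
   by substituting [u]. *)
have l1 : ps_deriv l * (1 + psX) = 1.
  apply/psP => n; rewrite mulrDr mulr1 pscoefD mulrC -[psX]expr1 pscoefXnM !pscoef_deriv !pscoef_mk.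
  have lE i : (-1) ^+ i.+2 / i.+1%:R *+ i.+1 = (-1) ^+ i :> C.
    by rewrite -mulr_natr divfK // exprS exprS !mulN1r opprK.
  case: n => [|n]; first by rewrite lE addr0 coef1.
  by rewrite subn1 !lE coef1 exprS mulN1r addNr.
have : ps_comp u (ps_deriv l) * (1 + u) = 1.
  by rewrite -[X in 1 + X](ps_compX u0) -{1}(ps_comp1 u0) -(ps_compD u0) -ps_compM // l1 ps_comp1.
by move=> e; rewrite mulrAC e mul1r.
Qed.

End Derivation.
End PowerSeriesCalculus.

(** * Laurent series and the logarithm *)

(* Stated over an abstract field, where ring and field work faster than in
   {fraction A}. *)
Section FieldIdentities.
Variable K : fieldType.
Implicit Types a b c e : K.

Lemma sub_quotients a b c e : b != 0 -> e != 0 ->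
  a / b - c / e = (a * e - c * b) / (b * e).
Proof. by move=> b0 e0; field; rewrite b0 e0. Qed.

Lemma quotient_rule_sub a b c e a' b' c' e' : b != 0 -> e != 0 ->
  (((a' * e + a * e') - (c' * b + c * b')) * (b * e) -
     (a * e - c * b) * (b' * e + b * e')) / (b * e) ^+ 2 =
  (a' * b - a * b') / b ^+ 2 - (c' * e - c * e') / e ^+ 2.
Proof. by move=> b0 e0; field; rewrite b0 e0. Qed.

Lemma quotient_rule_mul a b c e a' b' c' e' : b != 0 -> e != 0 ->
  ((a' * c + a * c') * (b * e) - (a * c) * (b' * e + b * e')) / (b * e) ^+ 2 =
  (a' * b - a * b') / b ^+ 2 * (c / e) + a / b * ((c' * e - c * e') / e ^+ 2).
Proof. by move=> b0 e0; field; rewrite b0 e0. Qed.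

Lemma log_derivative_quotient a b c e l : a != 0 -> b != 0 ->
  a * l * b + a * c = b * e -> l + c * b^-1 = e * a^-1.
Proof.
move=> a0 b0 eq; apply: (mulfI a0); apply: (mulIf b0).
have -> : a * (e * a^-1) * b = b * e by field.
by rewrite -eq; field.
Qed.

Lemma distribute_common_factor (A : comPzRingType) (x a l b i c : A) :
  x * a * l + b * (x * i) + x * c = x * (a * l + b * i + c).
Proof. by ring. Qed.

(** The derivative of an inverse without denominators: it trades a Laurent series [x] with a pole
    for the power series [v = 1 / x]. *)
Lemma leibniz_clear (t x v x' v' : K) : x * v = 1 ->
  x' * v + x * v' = 0 -> t * x' * v ^+ 2 + t * v' = 0.
Proof.
move=> xv e; have -> : t * x' * v ^+ 2 + t * v' =
    t * v * (x' * v + x * v') + t * v' * (1 - x * v) by ring.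
by rewrite e xv subrr !mulr0 addr0.
Qed.

End FieldIdentities.

Section FractionDerivation.
Variables (A : idomainType) (D : {additive A -> A}).
Hypothesis DM : forall x y, D (x * y) = D x * y + x * D y.
Implicit Types x y : {fraction A}.

Lemma fracP x : exists a b, b != 0 /\ x = tofrac a / tofrac b.
Proof.
exists (\n_(repr x)), (\d_(repr x)); split; first exact: denom_ratioP.
exact: frac_numden.
Qed.

Lemma frac_deriv_tofrac a : frac_deriv D (tofrac a) = tofrac (D a).
Proof.
have D1 : D 1 = 0.
  have := DM 1 1; rewrite !mulr1 mul1r => /eqP.
  by rewrite -subr_eq0 opprD addrA subrr sub0r oppr_eq0 => /eqP.
have -> : tofrac a = tofrac a / tofrac 1 by rewrite tofrac1 divr1.
by rewrite frac_deriv_div ?oner_neq0 // D1 mulr1 mulr0 subr0 tofrac1 expr1n divr1.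
Qed.

Lemma frac_deriv_zmod : zmod_morphism (frac_deriv D).
Proof.
move=> x y; have [a [b [b0 ->]]] := fracP x; have [c [e [e0 ->]]] := fracP y.
have [B0 E0] : tofrac b != 0 :> {fraction A} /\ tofrac e != 0 :> {fraction A}.
  by rewrite !tofrac_eq0.
rewrite sub_quotients // -!tofracM -tofracB.
rewrite !frac_deriv_div ?mulf_neq0 // (raddfB D) /= !DM.
by rewrite !(tofracB, tofracD, tofracM) quotient_rule_sub.
Qed.

Lemma frac_derivM x y :
  frac_deriv D (x * y) = frac_deriv D x * y + x * frac_deriv D y.
Proof.
have [a [b [b0 ->]]] := fracP x; have [c [e [e0 ->]]] := fracP y.
have [B0 E0] : tofrac b != 0 :> {fraction A} /\ tofrac e != 0 :> {fraction A}.
  by rewrite !tofrac_eq0.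
rewrite mulf_div -!tofracM !frac_deriv_div ?mulf_neq0 // !DM.
by rewrite !(tofracB, tofracD, tofracM) quotient_rule_mul.
Qed.

(** Apply both maps to [y * tofrac b = tofrac a] and cancel the nonzero image of [b]; the Leibniz
    rule alone suffices. Chain rules on fractions are thereby reduced to numerators. *)
Lemma frac_derivation_ext (K : fieldType) (phi : {rmorphism {fraction A} -> K})
    (d1 d2 : {fraction A} -> K) :
  (forall x y, d1 (x * y) = d1 x * phi y + phi x * d1 y) ->
  (forall x y, d2 (x * y) = d2 x * phi y + phi x * d2 y) ->
  (forall a, d1 (tofrac a) = d2 (tofrac a)) -> d1 =1 d2.
Proof.
move=> d1M d2M d12 x; have [a [b [b0 ->]]] := fracP x.
set y := tofrac a / _; have B0 : tofrac b != 0 :> {fraction A} by rewrite tofrac_eq0.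
have pb : phi (tofrac b) != 0 by rewrite fmorph_eq0.
have := d12 a; have -> : tofrac a = y * tofrac b by rewrite divfK.
rewrite d1M d2M d12 => /addIr; exact: mulIf.
Qed.

End FractionDerivation.

Section LaurentSubstitution.
Variable C : fieldType.
Implicit Types (f g h s u : pseries C) (x y : laurent C).

HB.instance Definition _ := GRing.isZmodMorphism.Build (laurent C) (laurent C)
  (@laurent_deriv C) (frac_deriv_zmod (@ps_derivM C)).

Lemma laurent_derivM x y :
  laurent_deriv (x * y) = laurent_deriv x * y + x * laurent_deriv y.
Proof. exact: (frac_derivM (@ps_derivM C)). Qed.

Lemma laurent_deriv_tofrac f : laurent_deriv (tofrac f) = tofrac (ps_deriv f).
Proof. exact: (frac_deriv_tofrac (@ps_derivM C)). Qed.

Section Composition.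
Variable s : pseries C.
Hypotheses (s0 : pscoef s 0 = 0) (s_neq0 : s != 0).

Let tofrac_comp : {rmorphism pseries C -> laurent C} :=
  @tofrac (pseries C) \o ps_comp_rmorphism s0.

Let tofrac_comp_inj : injective tofrac_comp.
Proof. by move=> f g /eqP; rewrite /= tofrac_eq => /eqP /(ps_comp_inj s0 s_neq0). Qed.

Definition laurent_comp_rmorphism : {rmorphism laurent C -> laurent C} :=
  HB.pack (laurent_comp s)
    (GRing.isZmodMorphism.Build _ _ (laurent_comp s)
      (frac_lift_zmod_morphism tofrac_comp_inj))
    (GRing.isMonoidMorphism.Build _ _ (laurent_comp s)
      (frac_lift_monoid_morphism tofrac_comp_inj)).

Lemma laurent_comp_tofrac f : laurent_comp s (tofrac f) = tofrac (ps_comp s f).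
Proof.
have -> : tofrac f = tofrac f / tofrac 1 :> laurent C by rewrite tofrac1 divr1.
rewrite /laurent_comp (frac_lift_div _ tofrac_comp_inj) ?oner_neq0 //.
by rewrite (rmorph1 tofrac_comp) divr1.
Qed.

Lemma laurent_compM x y :
  laurent_comp s (x * y) = laurent_comp s x * laurent_comp s y.
Proof. exact: (rmorphM laurent_comp_rmorphism). Qed.

Lemma laurent_compD x y :
  laurent_comp s (x + y) = laurent_comp s x + laurent_comp s y.
Proof. exact: (rmorphD laurent_comp_rmorphism). Qed.

Lemma laurent_comp1 : laurent_comp s 1 = 1.
Proof. exact: (rmorph1 laurent_comp_rmorphism). Qed.

Lemma laurent_compV x : laurent_comp s x^-1 = (laurent_comp s x)^-1.
Proof. exact: (fmorphV laurent_comp_rmorphism). Qed.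

Lemma laurent_chain_rule x : laurent_deriv (laurent_comp s x) =
  tofrac (ps_deriv s) * laurent_comp s (laurent_deriv x).
Proof.
apply: (@frac_derivation_ext _ _ laurent_comp_rmorphism
  (fun x => laurent_deriv (laurent_comp s x))
  (fun x => tofrac (ps_deriv s) * laurent_comp s (laurent_deriv x))) => [y z|y z|f].
- by rewrite laurent_compM laurent_derivM.
- rewrite laurent_derivM laurent_compD !laurent_compM mulrDr.
  by congr (_ + _); [apply: mulrA | apply: mulrCA].
rewrite laurent_deriv_tofrac !laurent_comp_tofrac laurent_deriv_tofrac.
by rewrite ps_deriv_comp // tofracM mulrC.
Qed.

End Composition.
End LaurentSubstitution.

(** * The derivation on polynomials and rational functions in the logarithm *)

Section LogDerivation.
Variable C : fieldType.
Implicit Types p q : {poly laurent C}.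

Local Notation invt := (expansion (ratfunX C))^-1.

Lemma expansion_ratfunX :
  expansion (ratfunX C) = tofrac (ps_of_poly 'X : pseries C).
Proof.
have -> : ratfunX C = tofrac 'X / tofrac 1 by rewrite tofrac1 divr1.
by rewrite expansion_div ?oner_neq0 // (rmorph1 (@ps_of_poly C)) tofrac1 divr1.
Qed.

Definition log_poly_deriv p := map_poly (@laurent_deriv C) p + invt *: p^`().

Lemma log_poly_deriv_zmod : zmod_morphism log_poly_deriv.
Proof.
move=> p q; rewrite /log_poly_deriv derivB scalerBr opprD addrACA; congr (_ + _).
exact: (raddfB (map_poly (@laurent_deriv C))).
Qed.

HB.instance Definition _ := GRing.isZmodMorphism.Build
  {poly laurent C} {poly laurent C} log_poly_deriv log_poly_deriv_zmod.

Lemma map_poly_laurent_derivM p q :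
  map_poly (@laurent_deriv C) (p * q) =
  map_poly (@laurent_deriv C) p * q + p * map_poly (@laurent_deriv C) q.
Proof.
apply/polyP => i; rewrite coefD !coefM coef_map coefM raddf_sum /= -big_split /=.
by apply: eq_bigr => j _; rewrite laurent_derivM !coef_map.
Qed.

Lemma log_poly_derivM p q :
  log_poly_deriv (p * q) = log_poly_deriv p * q + p * log_poly_deriv q.
Proof.
rewrite /log_poly_deriv map_poly_laurent_derivM derivM scalerDr mulrDl mulrDr.
by rewrite -scalerAl -scalerAr addrACA.
Qed.

HB.instance Definition _ := GRing.isZmodMorphism.Build
  (laurent_log C) (laurent_log C)
  (@laurent_log_deriv C) (frac_deriv_zmod log_poly_derivM).

Lemma laurent_log_derivM (x y : laurent_log C) : laurent_log_deriv (x * y) =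
  laurent_log_deriv x * y + x * laurent_log_deriv y.
Proof. exact: (frac_derivM log_poly_derivM). Qed.

Lemma laurent_log_deriv_tofrac p :
  laurent_log_deriv (tofrac p) = tofrac (log_poly_deriv p).
Proof. exact: (frac_deriv_tofrac log_poly_derivM). Qed.

Lemma log_poly_derivC c : log_poly_deriv c%:P = (laurent_deriv c)%:P.
Proof. by rewrite /log_poly_deriv derivC scaler0 addr0 map_polyC. Qed.

Lemma log_poly_deriv_affine p q c : log_poly_deriv (p * q + c%:P) =
  log_poly_deriv p * q + p * log_poly_deriv q + (laurent_deriv c)%:P.
Proof.
rewrite -log_poly_derivM -log_poly_derivC; exact: (raddfD (@log_poly_deriv)).
Qed.

Lemma laurent_deriv_const c : laurent_deriv (tofrac (ps_of_poly c%:P : pseries C)) = 0.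
Proof. by rewrite laurent_deriv_tofrac ps_deriv_poly derivC tofrac0. Qed.

Lemma laurent_natrE n : n%:R = tofrac (ps_of_poly n%:R%:P : pseries C).
Proof. by rewrite polyC_natr !rmorph_nat. Qed.

Lemma laurent_deriv_nat n : laurent_deriv (n%:R : laurent C) = 0.
Proof. by rewrite (laurent_natrE n) laurent_deriv_const. Qed.

Lemma log_poly_derivX : log_poly_deriv 'X = invt%:P.
Proof.
rewrite /log_poly_deriv derivX alg_polyC; have -> : map_poly (@laurent_deriv C) 'X = 0.
  apply/polyP => i; rewrite coef_map coefX coef0 /=.
  by rewrite laurent_deriv_nat.
by rewrite add0r.
Qed.

End LogDerivation.

#[local] Opaque laurent_deriv expansion log_poly_deriv.

Section LogSubstitution.
Variable C : fieldType.
Hypothesis C0 : forall n, n.+1%:R != 0 :> C.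
Variables (d : nat) (r : C) (u : pseries C) (lambda : C).
Hypotheses (d_gt0 : (0 < d)%N) (r_neq0 : r != 0) (u0 : pscoef u 0 = 0).

Local Notation s := (leading_form d r u).
Local Notation psX := (ps_of_poly 'X : pseries C).
Local Notation t := (tofrac psX : laurent C).
Local Notation Lsub := (log_subst d u lambda : {poly laurent C}).

Lemma leading_formE : s = psX ^+ d * (ps_of_poly r%:P * (1 + u)).
Proof.
by rewrite /leading_form -mul_polyC rmorphM rmorphXn /= mulrCA mulrA.
Qed.

Lemma pscoef0_leading_unit : pscoef (ps_of_poly r%:P * (1 + u)) 0 = r.
Proof. by rewrite pscoefCM pscoefD pscoef1 u0 addr0 mulr1. Qed.

Lemma leading_form0 : pscoef s 0 = 0.
Proof. by rewrite leading_formE pscoefXnM d_gt0. Qed.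

Lemma leading_form_neq0 : s != 0.
Proof.
rewrite leading_formE mulf_neq0 ?expf_neq0 ?psX_neq0 //.
apply/eqP => /(congr1 (fun f => pscoef f 0)).
by rewrite pscoef0_leading_unit pscoef0 => /eqP; rewrite (negbTE r_neq0).
Qed.

(** The logarithmic derivative $s'/s = d/t + (\log(1+u))'$, multiplied by $ts$ to become an identity
    of power series. *)
Lemma ps_log_derivative : s * ps_deriv (ps_log1p u) * psX + s *+ d = psX * ps_deriv s.
Proof.
have -> : s * ps_deriv (ps_log1p u) = psX ^+ d * (ps_of_poly r%:P * ps_deriv u).
  by rewrite leading_formE -(ps_log1p_deriv C0 u0); ring.
rewrite leading_formE; case: d d_gt0 => // e _.
have dc c : ps_deriv (ps_of_poly c%:P) = 0 :> pseries C.
  by rewrite ps_deriv_poly derivC.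
have -> : ps_deriv (psX ^+ e.+1 * (ps_of_poly r%:P * (1 + u))) =
    psX ^+ e *+ e.+1 * (ps_of_poly r%:P * (1 + u)) +
    psX ^+ e.+1 * (ps_of_poly r%:P * ps_deriv u).
  rewrite ps_derivM ps_deriv_exp ps_deriv_poly derivX rmorph1 mulr1; congr (_ + _ * _).
  by rewrite ps_derivM dc mul0r add0r ps_derivD (dc 1) add0r.
by rewrite exprS; ring.
Qed.

Definition laurent_leading_comp := laurent_comp_rmorphism leading_form0 leading_form_neq0.

Local Notation Phi := laurent_leading_comp.

Lemma laurent_natr_neq0 n : n.+1%:R != 0 :> laurent C.
Proof.
rewrite (laurent_natrE _ n.+1) tofrac_eq0; apply/eqP => /(congr1 (fun f => pscoef f 0)) /eqP.
by rewrite pscoef0 pscoef_poly coefC (negbTE (C0 n)).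
Qed.

Let dR_neq0 : d%:R != 0 :> laurent C.
Proof. by case: d d_gt0 => // e _; apply: laurent_natr_neq0. Qed.

Lemma size_log_subst : size Lsub = 2%N.
Proof.
rewrite /log_subst addrC size_polyDl size_scale ?size_polyX //.
by rewrite ltnS size_polyC; case: eqP.
Qed.

Definition log_poly_comp : {rmorphism {poly laurent C} -> {poly laurent C}} :=
  comp_poly Lsub \o map_poly Phi.

Lemma log_poly_compE p : log_poly_comp p = map_poly Phi p \Po Lsub.
Proof. by []. Qed.

Lemma size_log_poly_comp p : size (log_poly_comp p) = size p.
Proof. by rewrite log_poly_compE size_comp_poly2 ?size_log_subst // size_map_poly. Qed.

(** The power of [d] comes from $\log t \mapsto d \log t + ...$; it makes the degree visible when
    eigenvalues are compared. *)
Lemma lead_coef_log_poly_comp p :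
  lead_coef (log_poly_comp p) = laurent_comp s (lead_coef p) * d%:R ^+ (size p).-1.
Proof.
rewrite log_poly_compE lead_coef_comp ?size_log_subst // size_map_poly lead_coef_map.
congr (_ * _ ^+ _); rewrite lead_coefE size_log_subst /log_subst.
by rewrite coefD coefC coefZ coefX add0r mulr1.
Qed.

Let tofrac_log_poly_comp : {rmorphism {poly laurent C} -> laurent_log C} :=
  @tofrac {poly laurent C} \o log_poly_comp.

Lemma log_poly_comp_eq0 p : (log_poly_comp p == 0) = (p == 0).
Proof. by rewrite -!size_poly_eq0 size_log_poly_comp. Qed.

Let tofrac_log_poly_comp_inj : injective tofrac_log_poly_comp.
Proof.
move=> p q /eqP; rewrite -subr_eq0 -rmorphB tofrac_eq0 log_poly_comp_eq0.
by rewrite subr_eq0 => /eqP.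
Qed.

Definition laurent_log_comp_rmorphism : {rmorphism laurent_log C -> laurent_log C} :=
  HB.pack (laurent_log_comp d r u lambda)
    (GRing.isZmodMorphism.Build _ _ (laurent_log_comp d r u lambda)
      (frac_lift_zmod_morphism tofrac_log_poly_comp_inj))
    (GRing.isMonoidMorphism.Build _ _ (laurent_log_comp d r u lambda)
      (frac_lift_monoid_morphism tofrac_log_poly_comp_inj)).

Lemma laurent_log_compD x y : laurent_log_comp d r u lambda (x + y) =
  laurent_log_comp d r u lambda x + laurent_log_comp d r u lambda y.
Proof. exact: (rmorphD laurent_log_comp_rmorphism). Qed.

Lemma laurent_log_compM x y : laurent_log_comp d r u lambda (x * y) =
  laurent_log_comp d r u lambda x * laurent_log_comp d r u lambda y.
Proof. exact: (rmorphM laurent_log_comp_rmorphism). Qed.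

Lemma laurent_log_comp_div p q : q != 0 ->
  laurent_log_comp d r u lambda (tofrac p / tofrac q) =
  tofrac (log_poly_comp p) / tofrac (log_poly_comp q).
Proof. exact: (frac_lift_div (f := tofrac_log_poly_comp)). Qed.

Lemma laurent_log_comp_tofrac p :
  laurent_log_comp d r u lambda (tofrac p) = tofrac (log_poly_comp p).
Proof.
have -> : tofrac p = tofrac p / tofrac 1 :> laurent_log C by rewrite tofrac1 divr1.
by rewrite laurent_log_comp_div ?oner_neq0 // rmorph1 tofrac1 divr1.
Qed.

Local Notation rho := (tofrac (ps_deriv s) : laurent C).

(** The chain rule at the generator, that is $(\log R)' = R'/R$; with the chain rule for Laurent
    series it gives the general case. *)
Lemma log_poly_deriv_subst :
  log_poly_deriv Lsub = (rho * laurent_comp s (expansion (ratfunX C))^-1)%:P.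
Proof.
have S0 : tofrac s != 0 :> laurent C by rewrite tofrac_eq0 leading_form_neq0.
have T0 : t != 0 by rewrite tofrac_eq0 psX_neq0.
have dX : log_poly_deriv (d%:R *: 'X : {poly laurent C}) =
    (d%:R * (expansion (ratfunX C))^-1)%:P.
  have elim0 (A : pzRingType) (x y a : A) : a = 0 -> a * x + y = y.
    by move=> ->; rewrite mul0r add0r.
  rewrite -mul_polyC log_poly_derivM log_poly_derivC log_poly_derivX (polyCM d%:R).
  by apply: elim0; apply/eqP; rewrite polyC_eq0 laurent_deriv_nat.
rewrite /log_subst (raddfD (@log_poly_deriv C)) /= dX log_poly_derivC.
have -> : laurent_deriv (tofrac (ps_of_poly lambda%:P + ps_log1p u)) =
    tofrac (ps_deriv (ps_log1p u)).
  by rewrite laurent_deriv_tofrac ps_derivD ps_deriv_poly derivC add0r.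
rewrite -polyCD; congr _%:P.
rewrite laurent_compV ?leading_form0 ?leading_form_neq0 // expansion_ratfunX.
rewrite laurent_comp_tofrac ?leading_form0 ?leading_form_neq0 // ps_compX ?leading_form0 //.
apply: (log_derivative_quotient S0 T0).
have := congr1 (@tofrac (pseries C)) ps_log_derivative.
by rewrite (mulr_natr (tofrac s) d) -tofracMn -!tofracM -tofracD => ->.
Qed.

Lemma log_poly_chain_rule p : log_poly_deriv (log_poly_comp p) =
  rho%:P * log_poly_comp (log_poly_deriv p).
Proof.
elim/poly_ind: p => [|p c IHp].
  by rewrite !raddf0 mulr0.
have compX : log_poly_comp 'X = Lsub by rewrite log_poly_compE map_polyX comp_polyX.
have compC a : log_poly_comp a%:P = (laurent_comp s a)%:P.
  by rewrite log_poly_compE map_polyC comp_polyC.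
have compD p1 p2 : log_poly_comp (p1 + p2) = log_poly_comp p1 + log_poly_comp p2.
  exact: rmorphD.
have compM p1 p2 : log_poly_comp (p1 * p2) = log_poly_comp p1 * log_poly_comp p2.
  exact: rmorphM.
have expand (a b : {poly laurent C}) e :
    log_poly_comp (a * 'X + b + e%:P) =
    log_poly_comp a * Lsub + log_poly_comp b + (laurent_comp s e)%:P.
  by rewrite (compD (a * 'X + b)) (compD (a * 'X)) (compM a) compX compC.
have e1 : log_poly_comp (p * 'X + c%:P) =
    log_poly_comp p * Lsub + (laurent_comp s c)%:P.
  by rewrite (compD (p * 'X)) (compM p) compX compC.
have e2 : log_poly_deriv (p * 'X + c%:P) =
    log_poly_deriv p * 'X + p * ((expansion (ratfunX C))^-1)%:P + (laurent_deriv c)%:P.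
  exact: etrans (log_poly_deriv_affine p 'X c)
    (congr1 (fun q => log_poly_deriv p * 'X + p * q + (laurent_deriv c)%:P) (log_poly_derivX C)).
have e3 := laurent_chain_rule leading_form0 leading_form_neq0 c.
have e4 := congr1 (fun q => rho%:P * log_poly_comp q) e2.
apply: etrans (congr1 (@log_poly_deriv C) e1) (etrans _ (esym e4)).
apply: etrans (log_poly_deriv_affine _ _ _) _.
rewrite expand (compM p) compC IHp e3 log_poly_deriv_subst.
rewrite (polyCM rho (laurent_comp s (laurent_deriv c))).
rewrite (polyCM rho (laurent_comp s (expansion (ratfunX C))^-1)).
exact: distribute_common_factor.
Qed.

Lemma laurent_log_chain_rule x : laurent_log_deriv (laurent_log_comp d r u lambda x) =
  tofrac rho%:P * laurent_log_comp d r u lambda (laurent_log_deriv x).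
Proof.
apply: (@frac_derivation_ext _ _ laurent_log_comp_rmorphism
  (fun x => laurent_log_deriv (laurent_log_comp d r u lambda x))
  (fun x => tofrac rho%:P * laurent_log_comp d r u lambda (laurent_log_deriv x))) => [y z|y z|p].
- by rewrite laurent_log_compM laurent_log_derivM.
- rewrite laurent_log_derivM laurent_log_compD !laurent_log_compM mulrDr.
  by congr (_ + _); [apply: mulrA | apply: mulrCA].
rewrite laurent_log_deriv_tofrac !laurent_log_comp_tofrac laurent_log_deriv_tofrac.
by rewrite -tofracM log_poly_chain_rule.
Qed.

End LogSubstitution.

(** * Elements fixed by a substitution *)

Section Iteration.
Variable C : numClosedFieldType.
Implicit Types (f g h s u a w : pseries C).

Local Notation psc := (fun c => ps_of_poly c%:P : pseries C).
Local Notation psX := (ps_of_poly 'X : pseries C).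

Lemma ps_comp_comp s w f : pscoef s 0 = 0 -> pscoef w 0 = 0 ->
  ps_comp s (ps_comp w f) = ps_comp (ps_comp s w) f.
Proof.
move=> s0 w0; have sw0 : pscoef (ps_comp s w) 0 = 0 by rewrite pscoef0_comp.
apply: (ps_comp_unique sw0
  (T := (ps_comp_rmorphism s0 \o ps_comp_rmorphism w0 : {rmorphism pseries C -> pseries C}))).
  by move=> c /=; rewrite !ps_compC.
by rewrite /= ps_compX.
Qed.

Definition ps_iter s n := iter n (fun a => ps_comp a s) psX.

Lemma pscoef1_comp s f : pscoef s 0 = 0 ->
  pscoef (ps_comp s f) 1 = pscoef f 1 * pscoef s 1.
Proof.
move=> s0; rewrite pscoef_compE big_ord_recl big_ord1 /= expr0 expr1 pscoef1.
by rewrite mulr0 add0r.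
Qed.

Lemma ps_iter_coef s n : pscoef s 0 = 0 ->
  pscoef (ps_iter s n) 0 = 0 /\ pscoef (ps_iter s n) 1 = pscoef s 1 ^+ n.
Proof.
move=> s0; elim: n => [|n [IHn0 IHn1]].
  by rewrite /ps_iter /= !pscoef_poly !coefX expr0.
by rewrite /ps_iter /= pscoef0_comp pscoef1_comp // -/(ps_iter s n) IHn1 exprS.
Qed.

Lemma ps_iter_fixed s f n : pscoef s 0 = 0 -> ps_comp s f = f ->
  ps_comp (ps_iter s n) f = f.
Proof.
move=> s0 sf; elim: n => [|n IHn].
  have X0 : pscoef psX 0 = 0 by rewrite pscoef_poly coefX.
  by apply/esym/(ps_comp_unique X0 (T := idfun)).
have [a0 _] := ps_iter_coef n s0.
by rewrite /ps_iter /= -/(ps_iter s n) -ps_comp_comp // sf.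
Qed.

Lemma ps_low_eq0 N f : (forall i, (i < N)%N -> pscoef f i = 0) ->
  exists q, f = psX ^+ N * q.
Proof.
move=> f0; exists (PSeries (fun i => pscoef f (N + i))).
rewrite {1}(ps_split N f); have -> : \poly_(i < N) pscoef f i = 0; last first.
  by rewrite rmorph0 add0r.
by apply/polyP => i; rewrite coef_poly coef0; case: ltnP => // /f0.
Qed.

(** The binomial expansion to first order; all higher terms carry at least one more factor [psX]. *)
Lemma one_plus_exp e w n : exists q,
  (1 + psX ^+ e.+1 * w) ^+ n = 1 + psX ^+ e.+1 * (w *+ n + psX * q).
Proof.
elim: n => [|n [q defq]].
  by exists 0; rewrite expr0 mulr0n mulr0 !addr0 mulr0 addr0.
exists (q + psX ^+ e * w * (w *+ n + psX * q)).
by rewrite exprSr defq mulrSr exprS; ring.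
Qed.

(* A series fixed by a substitution tangent to the identity is constant: with
   a = t + w t^(e+2) and x = g t^n, the coefficient of t^(n+e+1) in x(a) - x is
   n w_0 g_0. *)
Lemma tangent_fixed a n g : pscoef a 0 = 0 -> pscoef a 1 = 1 -> (0 < n)%N ->
  pscoef g 0 != 0 -> ps_comp a (psX ^+ n * g) = psX ^+ n * g -> a = psX.
Proof.
move=> a0 a1 n_gt0 g0 fixg; apply/eqP; rewrite -subr_eq0; apply/negP => /negP.
move=> /ps_factor[k [w [defw w0]]].
have aX i : pscoef (a - psX) i = pscoef a i - (i == 1)%:R.
  by rewrite pscoefD pscoefN pscoef_poly coefX.
have [e defk] : exists e, k = e.+2.
  case: k defw => [|[|e]] defw; last by exists e.
    move: (aX 0); rewrite defw pscoefXnM a0 subr0 /= => /eqP.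
    by rewrite (negbTE w0).
  move: (aX 1); rewrite defw pscoefXnM a1 subrr /= subnn => /eqP.
  by rewrite (negbTE w0).
have defa : a = psX * (1 + psX ^+ e.+1 * w).
  by rewrite -[LHS](subrK psX) defw defk exprS; ring.
have exp_a j : exists q, a ^+ j = psX ^+ j * (1 + psX ^+ e.+1 * (w *+ j + psX * q)).
  have [q defq] := one_plus_exp e w j; exists q.
  by rewrite [LHS](congr1 (fun x => x ^+ j) defa) exprMn defq.
(* Substituting [a] in the unit [g] changes it only from order [e + 2] on, so the coefficient in
   question comes from the power $a^n$ alone. *)
have [q defq] : exists q, ps_comp a g - g = psX ^+ e.+2 * q.
  apply: ps_low_eq0 => m lt_me; rewrite pscoefD pscoefN pscoef_compE.
  rewrite big_ord_recr /= big1 ?add0r => [|j _].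
    have [q ->] := exp_a m; rewrite pscoefXnM ltnn subnn pscoefD pscoef1.
    by rewrite pscoefXnM /= addr0 mulr1 subrr.
  have [q ->] := exp_a j; rewrite pscoefXnM ltnNge (ltnW (ltn_ord j)) /=.
  rewrite pscoefD pscoef1 pscoefXnM subn_eq0 leqNgt ltn_ord add0r.
  case: (posnP j) => [j0|j_gt0].
    rewrite j0 subn0 mulr0n add0r; case: ltnP => [_|le_em]; first by rewrite mulr0.
    have -> : m = e.+1 by apply/eqP; rewrite eqn_leq le_em -ltnS lt_me.
    by rewrite subnn pscoef0M pscoef_poly coefX mul0r mulr0.
  by rewrite ltn_subLR ?(ltnW (ltn_ord j)) // (leq_trans lt_me) ?mulr0 // -addn1 addnC leq_add.
have [q' defq'] := exp_a n.
have compXn : ps_comp a (psX ^+ n * g) = a ^+ n * ps_comp a g.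
  by rewrite ps_compM // ps_compXn.
have : psX ^+ (n + e.+1) * ((w *+ n + psX * q') * ps_comp a g + psX * q) = 0.
  have -> : psX ^+ (n + e.+1) * ((w *+ n + psX * q') * ps_comp a g + psX * q) =
     a ^+ n * ps_comp a g - psX ^+ n * g +
       psX ^+ n * (psX ^+ e.+2 * q - (ps_comp a g - g)).
    by rewrite defq' exprD [psX ^+ e.+2]exprS; ring.
  by rewrite -compXn fixg defq !subrr mulr0 addr0.
move=> /eqP; rewrite mulf_eq0 expf_eq0 (negbTE (psX_neq0 C)) andbF /= => /eqP.
move=> /(congr1 (fun f => pscoef f 0)) /eqP.
rewrite pscoefD !pscoef0M pscoefD pscoef0M pscoef0_comp pscoef0 pscoef_poly coefX.
rewrite !mul0r !addr0 mulf_eq0 (negbTE g0) orbF -mulr_natr pscoef0M.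
have -> : pscoef (n%:R : pseries C) 0 = n%:R.
  by rewrite -(rmorph_nat (@ps_of_poly C)) pscoef_poly -polyC_natr coefC.
by rewrite mulf_eq0 (negbTE w0) pnatr_eq0 -leqn0 leqNgt n_gt0.
Qed.

End Iteration.

Section FixedElements.
Variable C : numClosedFieldType.
Variables (d : nat) (r : C) (u : pseries C) (lambda : C).
Hypotheses (d_gt0 : (0 < d)%N) (r_neq0 : r != 0) (u0 : pscoef u 0 = 0).

Local Notation s := (leading_form d r u).
Local Notation psc := (fun c => ps_of_poly c%:P : pseries C).
Local Notation psX := (ps_of_poly 'X : pseries C).

Let C0 n : n.+1%:R != 0 :> C.
Proof. by rewrite pnatr_eq0. Qed.
Let s0 : pscoef s 0 = 0.
Proof. exact: leading_form0. Qed.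
Let sn0 : s != 0.
Proof. exact: leading_form_neq0. Qed.

(** Both conclusions compare the two sides: the first their orders, the second their leading
    coefficients. *)
Lemma ps_eigenvector n g l : pscoef g 0 != 0 -> l != 0 ->
  ps_comp s (psX ^+ n * g) = psc l * (psX ^+ n * g) -> (d * n = n)%N /\ r ^+ n = l.
Proof.
move=> g0 l0; rewrite (ps_comp_factor s0 n g (leading_formE d r u)) [psc l * _]mulrCA => e.
have h0 : pscoef ((ps_of_poly r%:P * (1 + u)) ^+ n * ps_comp s g) 0 = r ^+ n * pscoef g 0.
  by rewrite pscoef0M pscoef0X (pscoef0_leading_unit r u0) (pscoef0_comp s).
have lg0 : pscoef (psc l * g) 0 = l * pscoef g 0 by rewrite pscoefCM.
have [||dn e'] := ps_factor_inj _ _ e.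
- by rewrite h0 mulf_neq0 ?expf_neq0.
- by rewrite lg0 mulf_neq0.
split=> //; have := congr1 (fun f => pscoef f 0) e'; rewrite /= h0 lg0.
exact: mulIf.
Qed.

(** If [f] minus its constant term has order [n > 0], then [d * n = n] and $r^n = 1$. So [d = 1],
    and the [n]-th iterate of [s] is tangent to the identity and still fixes that series; hence the
    iterate is the identity, which is excluded. *)
Lemma ps_fixed f : (1 < d)%N \/ (forall n, (0 < n)%N -> ps_iter s n != psX) ->
  ps_comp s f = f -> f = psc (pscoef f 0).
Proof.
move=> ord fixf; apply/eqP; rewrite -subr_eq0; apply/negP => /negP fn0.
have fix1 : ps_comp s (f - psc (pscoef f 0)) = f - psc (pscoef f 0).
  by rewrite ps_comp_zmod fixf ps_compC.
have f0 : pscoef (f - psc (pscoef f 0)) 0 = 0.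
  by rewrite pscoefD pscoefN pscoef_poly coefC subrr.
have [n [g [defg g0]]] := ps_factor fn0; rewrite defg in fix1 f0.
have n_gt0 : (0 < n)%N.
  by case: n f0 {defg fix1} => // /eqP; rewrite pscoefXnM /= (negbTE g0).
have e1 : ps_comp s (psX ^+ n * g) = psc 1 * (psX ^+ n * g).
  by rewrite fix1 polyC1 (rmorph1 (@ps_of_poly C)) mul1r.
have [dn rn] := ps_eigenvector g0 (oner_neq0 C) e1.
have d1 : d = 1%N by apply/eqP; rewrite -(eqn_pmul2r n_gt0) dn mul1n.
case: ord => [|/(_ n n_gt0)/eqP[]]; first by rewrite d1.
have [a0 a1] := ps_iter_coef n s0.
apply: (tangent_fixed a0 _ n_gt0 g0); last exact: ps_iter_fixed.
rewrite a1 (leading_formE d r u) pscoefXnM d1 /= subnn.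
by rewrite (pscoef0_leading_unit r u0) rn.
Qed.

(** Eigenvector equations pass to inverses, so this reduces them to power series. *)
Lemma laurent_or_inverse (x : laurent C) : x != 0 -> exists n g, pscoef g 0 != 0 /\
  (x = tofrac (psX ^+ n * g) \/ x^-1 = tofrac (psX ^+ n * g)).
Proof.
have [n [f ->]] := laurentP x; rewrite rmorphXn /= => x0.
have /ps_factor[m [g [-> g0]]] : f != 0.
  by apply: contraNneq x0 => ->; rewrite tofrac0 mul0r.
have XN k : tofrac (psX ^+ k) != 0 :> laurent C.
  by rewrite tofrac_eq0 expf_neq0 ?psX_neq0.
have [le_nm|lt_mn] := leqP n m.
  exists (m - n)%N, g; split=> //; left; apply: (canLR (mulfK (XN n))).
  by rewrite -tofracM mulrAC -exprD subnK.
have [h hg] := ps_invertible g0; have h0 : pscoef h 0 != 0.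
  apply: contraTneq isT => h0; have := congr1 (fun f => pscoef f 0) hg.
  by rewrite pscoef0M h0 mul0r pscoef1 => /esym/eqP; rewrite oner_eq0.
exists (n - m)%N, h; split=> //; right; rewrite invf_div.
have gn0 : tofrac (psX ^+ m * g) != 0 :> laurent C.
  rewrite tofrac_eq0 mulf_neq0 ?expf_neq0 ?psX_neq0 //.
  by apply: contraNneq g0 => ->; rewrite pscoef0.
apply: (canLR (mulfK gn0)); rewrite -tofracM mulrACA -exprD subnK ?(ltnW lt_mn) //.
by rewrite hg mulr1.
Qed.

Lemma tofrac_psc_divff c : c != 0 ->
  tofrac (psc c) * tofrac (psc c^-1) = 1 :> laurent C.
Proof.
move=> c0; have e : psc c * psc c^-1 = 1.
  by apply/psP => n; rewrite pscoefCM pscoef_poly coefC pscoef1; case: n => [|n];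
    rewrite ?divff ?mulr0.
by rewrite -tofracM e tofrac1.
Qed.

Lemma laurent_fixed (x : laurent C) :
  (1 < d)%N \/ (forall n, (0 < n)%N -> ps_iter s n != psX) ->
  laurent_comp s x = x -> exists c, x = tofrac (psc c).
Proof.
move=> ord fixx; have [->|x0] := eqVneq x 0.
  by exists 0; rewrite polyC0 [tofrac _]tofrac0.
have fixE f : laurent_comp s (tofrac f) = tofrac f -> exists c, tofrac f = tofrac (psc c).
  rewrite laurent_comp_tofrac // => /eqP; rewrite tofrac_eq => /eqP.
  by move=> /(ps_fixed ord) ef; exists (pscoef f 0); rewrite {1}ef.
have [n [g [g0 [ex|ex]]]] := laurent_or_inverse x0.
  by rewrite ex; apply: fixE; rewrite -ex.
have [|c ec] := fixE (psX ^+ n * g).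
  by rewrite -ex laurent_compV // fixx.
have c0 : c != 0.
  apply: contraNneq x0 => c0; rewrite -invr_eq0 ex ec c0 polyC0.
  by rewrite tofrac_eq0.
exists c^-1; have cV : tofrac (psc c) * tofrac (psc c^-1) = 1 :> laurent C.
  exact: tofrac_psc_divff.
by rewrite -[LHS]mulr1 -cV -ec -ex mulVKf.
Qed.

(** For [d > 1] the equality [d * n = n] of orders forces [n = 0], and then the eigenvalue is
    $r^0$. *)
Lemma laurent_eigenvalue (x : laurent C) l : (1 < d)%N -> x != 0 ->
  laurent_comp s x = tofrac (psc l) * x -> l = 1.
Proof.
move=> d_gt1 x0 ex; have l0 : l != 0.
  apply: contraNneq x0 => l0; move: ex; rewrite l0 polyC0 [tofrac _]tofrac0 mul0r => /eqP.
  by rewrite (fmorph_eq0 (laurent_comp_rmorphism s0 sn0)).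
have eigen n g l' : l' != 0 -> pscoef g 0 != 0 ->
    laurent_comp s (tofrac (psX ^+ n * g)) = tofrac (psc l') * tofrac (psX ^+ n * g) ->
    l' = 1.
  move=> l'0 g0; rewrite laurent_comp_tofrac // -tofracM => /eqP.
  rewrite tofrac_eq => /eqP /(ps_eigenvector g0 l'0)[dn <-].
  suff -> : n = 0%N by rewrite expr0.
  apply/eqP; rewrite -leqn0 leqNgt; apply/negP => n_gt0.
  by move: d_gt1; rewrite -(ltn_pmul2r n_gt0) dn mul1n ltnn.
have [n [g [g0 [dx|dx]]]] := laurent_or_inverse x0.
  by apply: (eigen n g) => //; rewrite -dx.
have : l^-1 = 1; last by move/(congr1 GRing.inv); rewrite invrK invr1.
apply: (eigen n g); rewrite ?invr_eq0 // -dx laurent_compV // ex invfM.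
congr (_ * _); exact: mulr1_eq (tofrac_psc_divff l0).
Qed.

Local Notation M := (log_poly_comp lambda d_gt0 r_neq0 u0).

(** The leading coefficient is an eigenvector of the substitution on Laurent series, with eigenvalue
    $d^m / d^n$ for [n] the degree of [p]. Such an eigenvalue is 1, and powers of [d > 1] are
    distinct. *)
Lemma log_poly_eigenvector (p : {poly laurent C}) m : (1 < d)%N -> p != 0 ->
  M p = d%:R ^+ m *: p ->
  (size p).-1 = m /\ laurent_comp s (lead_coef p) = lead_coef p.
Proof.
move=> d_gt1 p0 Mp; set n := (size p).-1.
have lp : laurent_comp s (lead_coef p) * d%:R ^+ n = d%:R ^+ m * lead_coef p.
  by rewrite -(lead_coef_log_poly_comp C0 lambda d_gt0 r_neq0 u0) Mp lead_coefZ.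
have dE k : d%:R ^+ k = tofrac (psc (d%:R ^+ k)) :> laurent C.
  by rewrite laurent_natrE -tofracXn -rmorphXn -polyC_exp.
have dn0 k : d%:R ^+ k != 0 :> C by rewrite expf_neq0 // pnatr_eq0 -lt0n.
have Dn0 k : d%:R ^+ k != 0 :> laurent C.
  by rewrite expf_neq0 //; case: (d) d_gt0 => // e _; apply: laurent_natr_neq0.
have lE : laurent_comp s (lead_coef p) = tofrac (psc (d%:R ^+ m / d%:R ^+ n)) * lead_coef p.
  apply: (mulIf (Dn0 n)); rewrite lp mulrAC; congr (_ * _).
  by rewrite !dE -tofracM -rmorphM -polyCM divfK.
have l1 : d%:R ^+ m / d%:R ^+ n = 1 :> C.
  by apply: (laurent_eigenvalue d_gt1 _ lE); rewrite lead_coef_eq0.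
split; last by rewrite lE l1 polyC1 (rmorph1 (@ps_of_poly C)) tofrac1 mul1r.
apply/esym/eqP; move/(congr1 (fun x => x * d%:R ^+ n)): l1.
rewrite divfK // mul1r => /eqP; rewrite -!natrX eqr_nat.
by rewrite eqn_exp2l.
Qed.

(** Write [x = p / q] in lowest terms with [q] monic. Invariance and coprimality make [p] and [q]
    eigenvectors for the same eigenvalue $d^m$, where [m] is the degree of [q]. The eigenvalue
    determines the degree and makes the leading coefficient of [p] fixed, hence a complex
    constant. *)
Lemma laurent_log_fixed (x : laurent_log C) : (1 < d)%N ->
  laurent_log_comp d r u lambda x = x ->
  exists c, x = tofrac (tofrac (psc c))%:P.
Proof.
move=> d_gt1; have [a [b [b0 ->]]] := fracP x.
pose g := gcdp a b; have g0 : g != 0 by rewrite gcdp_eq0 negb_and b0 orbT.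
have [ga gb] : a %/ g * g = a /\ b %/ g * g = b.
  by rewrite !divpK ?dvdp_gcdl ?dvdp_gcdr.
have cab : coprimep (a %/ g) (b %/ g) by rewrite coprimep_div_gcd // b0 orbT.
have bg0 : b %/ g != 0 by apply: contraNneq b0 => e; rewrite -gb e mul0r.
pose l := lead_coef (b %/ g); have l0 : l != 0 by rewrite lead_coef_eq0.
pose p := l^-1 *: (a %/ g); pose q := l^-1 *: (b %/ g).
have cpq : coprimep p q by rewrite coprimepZl ?coprimepZr ?invr_eq0.
have q0 : q != 0 by rewrite scaler_eq0 invr_eq0 (negbTE l0) (negbTE bg0).
have lq : lead_coef q = 1 by rewrite lead_coefZ mulVf.
have -> : tofrac a / tofrac b = tofrac p / tofrac q :> laurent_log C.
  apply/eqP; rewrite eqr_div ?tofrac_eq0 // -!tofracM tofrac_eq; apply/eqP.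
  by rewrite -{1}ga -{1}gb /p /q -scalerAr -scalerAl -mulrA [g * _]mulrC.
clearbody p q; rewrite (laurent_log_comp_div C0 lambda d_gt0 r_neq0 u0 _ q0) => /eqP.
have Mq0 : M q != 0 by rewrite log_poly_comp_eq0.
rewrite eqr_div ?tofrac_eq0 // -!tofracM tofrac_eq => /eqP fixpq.
have cM : coprimep (M q) (M p).
  by rewrite !log_poly_compE coprimep_sym coprimep_comp_poly // coprimep_map.
have [c Mq] : exists c, M q = c *: q.
  have qM : q %| M q.
    rewrite -(Gauss_dvdpr _ (_ : coprimep q p)) -?fixpq ?dvdp_mull //.
    by rewrite coprimep_sym.
  have /eqpP[[c1 c2] /= /andP[c10 c20] e] : q %= M q.
    by rewrite -dvdp_size_eqp // size_log_poly_comp.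
  by exists (c1 / c2); rewrite mulrC -scalerA e scalerA mulVf // scale1r.
have cE : c = d%:R ^+ (size q).-1.
  have := lead_coef_log_poly_comp C0 lambda d_gt0 r_neq0 u0 q.
  by rewrite Mq lead_coefZ lq mulr1 laurent_comp1 // mul1r.
set m := (size q).-1 in cE.
have Mp : M p = d%:R ^+ m *: p.
  apply: (mulIf q0); rewrite fixpq Mq cE -scalerAl.
  by rewrite -scalerAr.
have [p0|pn0] := eqVneq p 0.
  exists 0; rewrite p0 tofrac0 mul0r; apply/esym/eqP.
  exact: eqxx.
have [sp lp] := log_poly_eigenvector d_gt1 pn0 Mp.
have [c0 ec0] := laurent_fixed (or_introl d_gt1) lp.
exists c0; suff e : p = lead_coef p *: q.
  have Q0 : tofrac q != 0 :> laurent_log C by rewrite tofrac_eq0.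
  apply: (canLR (mulfK Q0)); rewrite -ec0 -tofracM mul_polyC.
  exact: congr1 e.
(* The leading terms cancel in this difference, so an eigenvector for $d^m$ of degree below [m]
   would arise. *)
apply/eqP; rewrite -subr_eq0; apply/negP => /negP pq0.
have Mpq : M (p - lead_coef p *: q) = d%:R ^+ m *: (p - lead_coef p *: q).
  rewrite rmorphB Mp -mul_polyC rmorphM Mq cE scalerBr; congr (_ - _).
  by rewrite log_poly_compE map_polyC comp_polyC /= lp -scalerAr mul_polyC.
have [spq _] := log_poly_eigenvector d_gt1 pq0 Mpq.
have sq : size q = m.+1 by rewrite prednK // lt0n size_poly_eq0.
have sp1 : size p = m.+1 by rewrite -sp prednK // lt0n size_poly_eq0.
have : (size (p - lead_coef p *: q)%R <= m)%N.
  apply/leq_sizeP => j le_mj; rewrite coefB coefZ.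
  have [<-|ne_mj] := eqVneq m j.
    by move: lq; rewrite !lead_coefE sq sp1 /= => ->; rewrite mulr1 subrr.
  have lt_mj : (m < j)%N by rewrite ltn_neqAle ne_mj.
  by rewrite !nth_default ?sq ?sp1 // mulr0 subrr.
by rewrite -spq leqNgt prednK ?leqnn // lt0n size_poly_eq0.
Qed.

End FixedElements.

(** * Rational functions with simple poles *)

Lemma inv_product_split (K : fieldType) (a b c : K) : a != 0 -> b != 0 ->
  c != 0 -> c = a - b -> a^-1 / b = c^-1 * (b^-1 + -1 * a^-1).
Proof. by move=> a0 b0 c0 ec; rewrite ec in c0 *; field; rewrite a0 b0 c0. Qed.

Section RationalFunctions.
Variable C : numClosedFieldType.
Implicit Types (x y h : ratfun C) (p q : {poly C}) (al be c : C).

Local Notation psc := (fun c => ps_of_poly c%:P : pseries C).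
Local Notation psX := (ps_of_poly 'X : pseries C).
Local Notation rc := (fun c => tofrac c%:P : ratfun C).
Local Notation lin := (fun al => tofrac ('X - al%:P) : ratfun C).
Local Notation t := (ratfunX C).

Definition ratfun_deriv : ratfun C -> ratfun C := frac_deriv (@deriv C).

HB.instance Definition _ := GRing.isZmodMorphism.Build (ratfun C) (ratfun C)
  ratfun_deriv (frac_deriv_zmod (@derivM C)).

Lemma ratfun_derivM x y :
  ratfun_deriv (x * y) = ratfun_deriv x * y + x * ratfun_deriv y.
Proof. exact: (frac_derivM (@derivM C)). Qed.

Lemma ratfun_deriv_tofrac p : ratfun_deriv (tofrac p) = tofrac p^`().
Proof. exact: (frac_deriv_tofrac (@derivM C)). Qed.

Lemma ratfun_derivD x y : ratfun_deriv (x + y) = ratfun_deriv x + ratfun_deriv y.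
Proof. exact: raddfD. Qed.

Lemma ratfun_deriv_scale c x : ratfun_deriv (rc c * x) = rc c * ratfun_deriv x.
Proof. by rewrite ratfun_derivM ratfun_deriv_tofrac derivC tofrac0 mul0r add0r. Qed.

Lemma ratfun_deriv_exp x n :
  ratfun_deriv (x ^+ n.+1) = rc n.+1%:R * (x ^+ n * ratfun_deriv x).
Proof.
elim: n => [|n IHn]; first by rewrite expr1 expr0 polyC1 tofrac1 !mul1r.
rewrite exprS ratfun_derivM IHn -[n.+2%:R]natr1 polyCD tofracD mulrDl polyC1 tofrac1 mul1r.
rewrite addrC; congr (_ + _); last exact: mulrC.
by rewrite mulrCA [x ^+ n.+1]exprS -mulrA.
Qed.

Lemma ratfun_derivV x : x != 0 -> ratfun_deriv x^-1 = - (ratfun_deriv x / x ^+ 2).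
Proof.
move=> x0; have := ratfun_derivM x x^-1.
rewrite mulfV // -[1]tofrac1 ratfun_deriv_tofrac derivC tofrac0 => /esym/eqP.
rewrite addrC addr_eq0 => /eqP e; apply: (mulfI x0); rewrite e mulrN expr2 invfM.
by rewrite mulrCA mulVKf.
Qed.

Lemma expansion_tofrac p : expansion (tofrac p) = tofrac (ps_of_poly p).
Proof.
have -> : tofrac p = tofrac p / tofrac 1 by rewrite tofrac1 divr1.
by rewrite expansion_div ?oner_neq0 // (rmorph1 (@ps_of_poly C)) tofrac1 divr1.
Qed.

Lemma expansionD x y : expansion (x + y) = expansion x + expansion y.
Proof. exact: rmorphD. Qed.

Lemma expansionM x y : expansion (x * y) = expansion x * expansion y.
Proof. exact: rmorphM. Qed.

Lemma expansion_quotient x y : expansion (x / y) = expansion x / expansion y.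
Proof. exact: fmorph_div. Qed.

Lemma expansion_deriv x : laurent_deriv (expansion x) = expansion (ratfun_deriv x).
Proof.
apply: (@frac_derivation_ext _ _ (@expansion C)
  (fun x => laurent_deriv (expansion x)) (fun x => expansion (ratfun_deriv x))).
- by move=> a b; rewrite expansionM laurent_derivM.
- move=> a b; rewrite ratfun_derivM expansionD.
  by rewrite !expansionM.
by move=> p; rewrite ratfun_deriv_tofrac !expansion_tofrac laurent_deriv_tofrac ps_deriv_poly.
Qed.

Section Composition.
Variables (S : ratfun C) (a : pseries C).
Hypotheses (a0 : pscoef a 0 = 0) (an0 : a != 0) (Sa : expansion S = tofrac a).

Let ratfun_eval : {rmorphism {poly C} -> ratfun C} :=
  horner_eval S \o map_poly (@tofrac {poly C} \o polyC).

Lemma expansion_ratfun_eval p :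
  expansion (ratfun_eval p) = tofrac (ps_comp a (ps_of_poly p)).
Proof.
elim/poly_ind: p => [|p c IHp].
  rewrite rmorph0 (rmorph0 (@expansion C)) [ps_of_poly 0](rmorph0 (@ps_of_poly C)).
  by rewrite (rmorph0 (ps_comp_rmorphism a0) : ps_comp a 0 = 0) tofrac0.
have eX : ratfun_eval 'X = S by rewrite /= map_polyX horner_evalE hornerX.
have eC : ratfun_eval c%:P = rc c by rewrite /= map_polyC horner_evalE hornerC.
rewrite (rmorphD ratfun_eval) (rmorphM ratfun_eval) eX eC.
rewrite expansionD expansionM IHp Sa expansion_tofrac.
by rewrite ps_of_polyMXC ps_compD // ps_compM // ps_compX // ps_compC // tofracD tofracM.
Qed.

(** Injectivity is read off from the expansions; it is what makes [frac_lift] independent of the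
    representative in [ratfun_comp]. *)
Lemma ratfun_eval_inj : injective ratfun_eval.
Proof.
move=> p q /(congr1 (@expansion C)) /eqP; rewrite !expansion_ratfun_eval tofrac_eq.
by move=> /eqP /(ps_comp_inj a0 an0) /ps_of_poly_inj.
Qed.

Lemma expansion_ratfun_comp x :
  expansion (ratfun_comp x S) = laurent_comp a (expansion x).
Proof.
have [p [q [q0 ->]]] := fracP x.
have -> : ratfun_comp (tofrac p / tofrac q) S = ratfun_eval p / ratfun_eval q.
  exact: (frac_lift_div p ratfun_eval_inj q0).
rewrite !expansion_quotient !expansion_ratfun_eval !expansion_tofrac.
by rewrite laurent_compM // laurent_compV // !laurent_comp_tofrac.
Qed.

End Composition.

Lemma expansion_ratfun_iter (R : ratfun C) (s : pseries C) n : pscoef s 0 = 0 -> s != 0 ->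
  expansion R = tofrac s ->
  ps_iter s n != 0 /\ expansion (ratfun_iter n R) = tofrac (ps_iter s n).
Proof.
move=> s0 sn0 Rs; elim: n => [|n [IHn0 IHn]].
  by rewrite /= expansion_ratfunX psX_neq0.
have [a0 _] := ps_iter_coef n s0; split.
  by apply: contraNneq sn0 => /(ps_comp_eq0 a0 IHn0) ->.
by rewrite /= (expansion_ratfun_comp a0 IHn0 IHn) Rs laurent_comp_tofrac.
Qed.

Lemma lin_neq0 al : lin al != 0.
Proof. by rewrite tofrac_eq0 polyXsubC_eq0. Qed.

Lemma rc_neq0 c : c != 0 -> rc c != 0.
Proof. by move=> c0; rewrite tofrac_eq0 polyC_eq0. Qed.

(** The pairs consist of a coefficient and a pole. Poles may repeat, so that sums are
    concatenations; there is no polynomial part. *)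
Definition simple_poles (l : seq (C * C)) : ratfun C :=
  \sum_(i <- l) rc i.1 / lin i.2.

Definition has_simple_poles x := exists l, x = simple_poles l.

Lemma simple_poles0 : has_simple_poles 0.
Proof. by exists [::]; rewrite /simple_poles big_nil. Qed.

Lemma simple_polesD x y :
  has_simple_poles x -> has_simple_poles y -> has_simple_poles (x + y).
Proof. by move=> [l ->] [m ->]; exists (l ++ m); rewrite /simple_poles big_cat. Qed.

Lemma simple_polesZ c x : has_simple_poles x -> has_simple_poles (rc c * x).
Proof.
move=> [l ->]; exists [seq (c * i.1, i.2) | i <- l].
rewrite /simple_poles big_map mulr_sumr; apply: eq_bigr => i _ /=.
by rewrite polyCM tofracM mulrA.
Qed.

Lemma simple_polesN x : has_simple_poles x -> has_simple_poles (- x).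
Proof.
by move=> /(simple_polesZ (-1)); rewrite polyCN polyC1 tofracN tofrac1 mulN1r.
Qed.

Lemma simple_poles_lin al : has_simple_poles (lin al)^-1.
Proof.
by exists [:: (1, al)]; rewrite /simple_poles big_seq1 /= polyC1 tofrac1 mul1r.
Qed.

Lemma poly_factorization p : p != 0 -> exists r : seq C,
  tofrac p = rc (lead_coef p) * \prod_(al <- r) lin al.
Proof.
move=> p0; have [r rE] := closed_field_poly_normal p; exists r.
by rewrite {1}rE -mul_polyC tofracM (rmorph_prod (@tofrac {poly C})).
Qed.

(** Logarithmic derivatives turn products into sums, constants contribute 0, and a linear factor
    contributes one simple pole. *)
Lemma log_derivative_simple_poles x : x != 0 -> has_simple_poles (ratfun_deriv x / x).
Proof.
have logM y z : y != 0 -> z != 0 -> ratfun_deriv (y * z) / (y * z) =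
    ratfun_deriv y / y + ratfun_deriv z / z.
  by move=> y0 z0; rewrite ratfun_derivM mulrDl -!mulf_div divff // mulr1 divff // mul1r.
have prod_neq0 (r : seq C) : \prod_(al <- r) lin al != 0.
  elim/big_ind: _ => [|y z|be _]; [exact: oner_neq0|exact: mulf_neq0|exact: lin_neq0].
have logc c : ratfun_deriv (rc c) / rc c = 0.
  by rewrite ratfun_deriv_tofrac derivC tofrac0 mul0r.
have log_prod (r : seq C) : has_simple_poles
    (ratfun_deriv (\prod_(al <- r) lin al) / \prod_(al <- r) lin al).
  elim: r => [|al r IHr].
    rewrite big_nil -tofrac1 -polyC1 logc; exact: simple_poles0.
  rewrite big_cons (logM _ _ (lin_neq0 al) (prod_neq0 r)); apply: simple_polesD => //.
  rewrite ratfun_deriv_tofrac derivXsubC tofrac1 mul1r; exact: simple_poles_lin.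
have logP p : p != 0 -> has_simple_poles (ratfun_deriv (tofrac p) / tofrac p).
  move=> p0; have [r ->] := poly_factorization p0.
  have c0 : rc (lead_coef p) != 0 by rewrite rc_neq0 // lead_coef_eq0.
  by rewrite (logM _ _ c0 (prod_neq0 r)) logc add0r.
have [p [q [q0 ->]]] := fracP x; rewrite mulf_eq0 negb_or => /andP[P0 QV0].
have p0 : p != 0 by move: P0; rewrite tofrac_eq0.
have Q0 : tofrac q != 0 :> ratfun C by rewrite tofrac_eq0.
rewrite (logM _ _ P0 QV0); apply: simple_polesD; first exact: logP.
have -> : ratfun_deriv (tofrac q)^-1 / (tofrac q)^-1 =
    - (ratfun_deriv (tofrac q) / tofrac q).
  rewrite (ratfun_derivV Q0) invrK mulNr; congr (- _).
  by rewrite expr2 invfM mulrA divfK.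
exact/simple_polesN/logP.
Qed.

(** The linear span of the usual basis, given by closure rules so that linear statements need to be
    checked on generators only. *)
Inductive partial_fraction : ratfun C -> Prop :=
| PartFrac0 : partial_fraction 0
| PartFracD x y : partial_fraction x -> partial_fraction y -> partial_fraction (x + y)
| PartFracZ c x : partial_fraction x -> partial_fraction (rc c * x)
| PartFracX n : partial_fraction (t ^+ n)
| PartFracV al n : partial_fraction ((lin al)^-1 ^+ n.+1).

Lemma tE al : t = lin al + rc al.
Proof. by rewrite -tofracD subrK. Qed.

(** On generators: $t^{n+1}/(t-\alpha) = t^n + \alpha t^n/(t-\alpha)$, and distinct poles separate
    by $1/((t-\beta)(t-\alpha)) = (\alpha-\beta)^{-1}(1/(t-\alpha) - 1/(t-\beta))$. *)
Lemma partial_fraction_div al x : partial_fraction x -> partial_fraction (x / lin al).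
Proof.
have L0 := lin_neq0; elim=> [|y z _ IHy _ IHz|c y _ IHy|n|be n].
- rewrite mul0r; exact: PartFrac0.
- rewrite mulrDl; exact: PartFracD.
- rewrite -mulrA; exact: PartFracZ.
- elim: n => [|n IHn]; first by rewrite mul1r -[_^-1]expr1; exact: PartFracV.
  have -> : t ^+ n.+1 / lin al = t ^+ n + rc al * (t ^+ n / lin al).
    by rewrite exprSr {2}(tE al) mulrDr mulrDl mulfK // [_ * rc al]mulrC mulrA.
  by apply: PartFracD; [exact: PartFracX | exact: PartFracZ].
have [<-|ne] := eqVneq be al; first by rewrite -exprSr; exact: PartFracV.
have d0 : al - be != 0 by rewrite subr_eq0 eq_sym.
have step : (lin be)^-1 / lin al = rc (al - be)^-1 * ((lin al)^-1 + rc (-1) * (lin be)^-1).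
  have D0 := rc_neq0 d0.
  have pe : (al - be)%:P = ('X - be%:P) - ('X - al%:P) by rewrite polyCB; ring.
  have -> : rc (al - be)^-1 = (rc (al - be))^-1.
    by apply: (mulfI D0); rewrite -tofracM -polyCM !divff // polyC1 tofrac1.
  have -> : rc (-1) = -1 by rewrite polyCN polyC1 tofracN tofrac1.
  apply: inv_product_split D0 _ => //.
  by rewrite pe tofracB.
elim: n => [|n IHn].
  rewrite expr1 step; apply: PartFracZ; apply: PartFracD.
    by rewrite -[_^-1]expr1; exact: PartFracV.
  by apply: PartFracZ; rewrite -[_^-1]expr1; exact: PartFracV.
have -> : (lin be)^-1 ^+ n.+2 / lin al = rc (al - be)^-1 *
    ((lin be)^-1 ^+ n.+1 / lin al + rc (-1) * (lin be)^-1 ^+ n.+2).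
  rewrite exprSr -[LHS]mulrA step mulrCA; congr (_ * _).
  by rewrite mulrDr; congr (_ + _); rewrite mulrCA -exprSr.
by apply: PartFracZ; apply: PartFracD => //; apply: PartFracZ; exact: PartFracV.
Qed.

Lemma partial_fractionP x : partial_fraction x.
Proof.
have [p [q [q0 ->]]] := fracP x.
have pfp (P : {poly C}) : partial_fraction (tofrac P).
  elim/poly_ind: P => [|P c IHP]; first by rewrite tofrac0; exact: PartFrac0.
  rewrite tofracD tofracM; apply: PartFracD; last first.
    rewrite -[tofrac _]mulr1; apply: PartFracZ; exact: (PartFracX 0).
  elim: IHP => [|y z _ IHy _ IHz|e y _ IHy|n|al n].
  - rewrite mul0r; exact: PartFrac0.
  - rewrite mulrDl; exact: PartFracD.
  - rewrite -mulrA; exact: PartFracZ.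
  - rewrite -exprSr; exact: PartFracX.
  have -> : (lin al)^-1 ^+ n.+1 * tofrac 'X =
      (lin al)^-1 ^+ n + rc al * (lin al)^-1 ^+ n.+1.
    rewrite -[tofrac 'X]/t (tE al) mulrDr [_ * rc al]mulrC exprSr -mulrA mulVf ?mulr1 //.
    exact: lin_neq0.
  apply: PartFracD; last by apply: PartFracZ; exact: PartFracV.
  by case: n => [|n]; [exact: (PartFracX 0) | exact: PartFracV].
have [r ->] := poly_factorization q0; rewrite invfM mulrA.
have : partial_fraction (tofrac p / rc (lead_coef q)).
  have c0 : lead_coef q != 0 by rewrite lead_coef_eq0.
  have -> : tofrac p / rc (lead_coef q) = rc (lead_coef q)^-1 * tofrac p.
    rewrite mulrC; congr (_ * _); apply: (mulfI (rc_neq0 c0)).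
    by rewrite -tofracM -polyCM !divff ?rc_neq0 // polyC1 tofrac1.
  exact: PartFracZ.
elim: r (_ / rc _) => [|al r IHr] y py; first by rewrite big_nil invr1 mulr1.
rewrite big_cons invfM mulrA; apply: IHr; exact: partial_fraction_div.
Qed.

(* Hermite reduction. *)
Lemma deriv_plus_simple_poles x : exists h y,
  has_simple_poles y /\ x = ratfun_deriv h + y.
Proof.
elim: (partial_fractionP x) => [|x1 x2 _ [h1 [y1 [Hy1 ->]]] _ [h2 [y2 [Hy2 ->]]]|c x1 _ [h [y [Hy ->]]]|n|al n].
- by exists 0, 0; split; [exact: simple_poles0 | rewrite raddf0 addr0].
- exists (h1 + h2), (y1 + y2); split; first exact: simple_polesD.
  by rewrite ratfun_derivD addrACA.
- exists (rc c * h), (rc c * y); split; first exact: simple_polesZ.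
  by rewrite ratfun_deriv_scale mulrDr.
- exists (rc n.+1%:R^-1 * t ^+ n.+1), 0; split; first exact: simple_poles0.
  rewrite addr0 ratfun_deriv_scale ratfun_deriv_exp mulrA -tofracM -polyCM.
  by rewrite mulVf ?pnatr_eq0 // ratfun_deriv_tofrac derivX tofrac1 mul1r mulr1.
case: n => [|n].
  exists 0, (lin al)^-1; split; first exact: simple_poles_lin.
  by rewrite raddf0 add0r.
exists (rc (- n.+1%:R^-1) * (lin al)^-1 ^+ n.+1), 0; split; first exact: simple_poles0.
rewrite addr0 ratfun_deriv_scale ratfun_deriv_exp mulrA -tofracM -polyCM.
rewrite mulNr mulVf ?pnatr_eq0 // ratfun_derivV ?lin_neq0 //.
rewrite ratfun_deriv_tofrac derivXsubC tofrac1 polyCN polyC1 tofracN tofrac1 mulN1r.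
by rewrite mulrN opprK mul1r -exprVn -exprD addn2.
Qed.

(** Repeated poles are merged by [undup], so the denominator is squarefree; the size bound says that
    the fraction is proper. *)
Lemma simple_poles_fraction l : exists (r : seq C) (N : {poly C}),
  [/\ uniq r, (size N <= size r)%N &
   simple_poles l = tofrac N / tofrac (\prod_(al <- r) ('X - al%:P))].
Proof.
pose r := undup [seq i.2 | i <- l]; have ur : uniq r by rewrite undup_uniq.
pose P (s : seq C) := \prod_(al <- s) ('X - al%:P).
exists r, (\sum_(i <- l) i.1 *: P (rem i.2 r)); split=> //.
  have inr i : i \in l -> i.2 \in r by move=> il; rewrite mem_undup map_f.
  rewrite (leq_trans (size_sum _ _ _)) //; apply/bigmax_leqP_seq => i il _.
  rewrite (leq_trans (size_scale_leq _ _)) // size_prod_XsubC size_rem ?inr //.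
  by rewrite prednK //; have := inr i il; case: (r).
rewrite (rmorph_sum (@tofrac {poly C})) mulr_suml /simple_poles.
apply: eq_big_seq => i il.
have ir : i.2 \in r by rewrite mem_undup map_f.
have PE : P r = ('X - i.2%:P) * P (rem i.2 r).
  by rewrite /P (perm_big _ (perm_to_rem ir)) big_cons.
have R0 : tofrac (P (rem i.2 r)) != 0 :> ratfun C.
  rewrite tofrac_eq0 /P; elim/big_ind: _ => [|a b|be _]; rewrite ?oner_neq0 ?polyXsubC_eq0 //.
  exact: mulf_neq0.
by rewrite -/(P r) PE /= -mul_polyC !tofracM -mulf_div divff // mulr1.
Qed.

(** A pole of [x] would give its derivative a pole of order at least 2, so [x] is a polynomial. Its
    derivative is then both a polynomial and a proper fraction, hence 0. *)
Lemma deriv_simple_poles_const x : has_simple_poles (ratfun_deriv x) ->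
  exists c, x = rc c.
Proof.
move=> [l]; have [r [N [ur sN ->]]] := simple_poles_fraction l.
set M := \prod_(al <- r) _; have M0 : M != 0.
  by rewrite -size_poly_gt0 size_prod_XsubC.
have [p0 [q0 [q0n ->]]] := fracP x.
pose g := gcdp p0 q0; have g0 : g != 0 by rewrite gcdp_eq0 negb_and q0n orbT.
have gp : p0 %/ g * g = p0 by rewrite divpK ?dvdp_gcdl.
have gq : q0 %/ g * g = q0 by rewrite divpK ?dvdp_gcdr.
have : coprimep (p0 %/ g) (q0 %/ g) by rewrite coprimep_div_gcd // q0n orbT.
have : q0 %/ g != 0 by apply: contraNneq q0n => e; rewrite -gq e mul0r.
have -> : tofrac p0 / tofrac q0 = tofrac (p0 %/ g) / tofrac (q0 %/ g) :> ratfun C.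
  by rewrite -{1}gp -{1}gq !tofracM -mulf_div divff ?tofrac_eq0 // mulr1.
move: (p0 %/ g) (q0 %/ g) => p q {p0 q0 q0n g g0 gp gq} q0 cpq.
rewrite /ratfun_deriv (frac_deriv_div _ (@derivM C) q0) -tofracXn => /eqP.
rewrite eqr_div ?tofrac_eq0 ?expf_neq0 // -!tofracM tofrac_eq => /eqP /= eqN.
have sq : size q = 1%N.
  apply/eqP/negPn/negP => /closed_rootP[al rq].
  have [m [q1 nq1 defq]] := multiplicity_XsubC q al; rewrite q0 /= in nq1.
  case: m defq => [|m] defq; first by case/negP: nq1; move: rq; rewrite defq mulr1.
  have pal : p.[al] != 0 by apply: (coprimep_root _ rq); rewrite coprimep_sym.
  pose L := 'X - al%:P : {poly C}; have L0 : L != 0 by rewrite polyXsubC_eq0.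
  (* With [m.+1] the multiplicity of [al] in [q], the numerator of the derivative is [L ^+ m * B],
     and [B] takes the nonzero value $-(m+1) p(\alpha) q_1(\alpha)$ at [al]. *)
  pose B := L * (p^`() * q1 - p * q1^`()) - (p * q1) *+ m.+1.
  have defB : p^`() * q - p * q^`() = L ^+ m * B.
    by rewrite defq derivM deriv_exp derivXsubC mul1r /B /= -/L exprS; ring.
  have Bal : ~~ root B al.
    rewrite /root /B hornerD hornerN hornerMn !hornerM /L !hornerE subrr mul0r add0r.
    by rewrite oppr_eq0 mulrn_eq0 /= mulf_neq0.
  have BM : B * M = N * (L ^+ m.+2 * q1 ^+ 2).
    apply: (mulfI (expf_neq0 m L0)).
    have -> : L ^+ m * (B * M) = (L ^+ m * B) * M by rewrite mulrA.
    by rewrite -defB eqN defq -/L !exprS; ring.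
  (* A double root of [M], whose roots are distinct. *)
  have LM : L ^+ 2 %| M.
    have : L ^+ 2 %| B * M by rewrite BM -[m.+2]addn2 exprD; apply/dvdp_mull/dvdp_mulr/dvdp_mull.
    rewrite Gauss_dvdpr // coprimep_expl // /L coprimep_sym coprimep_XsubC.
    exact: Bal.
  have alr : al \in r.
    by rewrite -(root_prod_XsubC r) -dvdp_XsubCl (dvdp_trans _ LM) // expr2 dvdp_mulIl.
  move: LM; rewrite /M (perm_big _ (perm_to_rem alr)) big_cons expr2 dvdp_mul2l //.
  rewrite dvdp_XsubCl root_prod_XsubC => al2.
  by move: ur; rewrite (perm_uniq (perm_to_rem alr)) /= al2.
have qE := size1_polyC (eq_leq sq); have c0 : q`_0 != 0.
  by apply: contraNneq q0 => c0; rewrite qE c0.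
have dp : p^`() = 0.
  apply/eqP/negPn/negP => dp0; have := congr1 (fun P : {poly C} => size P) eqN.
  rewrite qE derivC mulr0 subr0 -polyC_exp -mulrA ![_ * _%:P]mulrC !mul_polyC /=.
  rewrite -scalerAr !size_scale ?expf_neq0 // size_mul // size_prod_XsubC => e.
  have := leq_trans (eq_leq e) sN; rewrite addnS /= leqNgt.
  by rewrite -[X in (X < _)%N]add0n ltn_add2r size_poly_gt0 dp0.
have pE : p = (p`_0)%:P.
  apply/size1_polyC/leq_sizeP => -[|j] // _.
  have /eqP := congr1 (fun P : {poly C} => P`_j) dp.
  by rewrite coef_deriv coef0 -mulr_natr mulf_eq0 pnatr_eq0 orbF => /eqP.
exists (p`_0 / q`_0); rewrite pE qE !coefC /=.
apply: (canLR (mulfK _)); first by rewrite rc_neq0.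
by rewrite -tofracM -polyCM divfK.
Qed.

End RationalFunctions.

Lemma add_sub_shift (V : zmodType) (x y z h h' : V) : h' + h = 0 ->
  x + y + z = x + h' + (y + z + h).
Proof.
move=> hh; have -> : h' = - h by apply/eqP; rewrite -subr_eq0 opprK hh.
by rewrite [y + z + h]addrC addrA subrK addrA.
Qed.

Section RationalPrimitive.
Variable C : numClosedFieldType.
Variables (d : nat) (r : C) (u : pseries C) (R : ratfun C).
Hypotheses (d_gt0 : (0 < d)%N) (r_neq0 : r != 0) (u0 : pscoef u 0 = 0).

Local Notation s := (leading_form d r u).
Local Notation psc := (fun c => ps_of_poly c%:P : pseries C).
Local Notation psX := (ps_of_poly 'X : pseries C).
Local Notation rc := (fun c => tofrac c%:P : ratfun C).
Local Notation lin := (fun al => tofrac ('X - al%:P) : ratfun C).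
Hypothesis R_lead : expansion R = tofrac s.

Let s0 : pscoef s 0 = 0.
Proof. exact: leading_form0. Qed.
Let sn0 : s != 0.
Proof. exact: leading_form_neq0. Qed.

Lemma expansion_inj (x y : ratfun C) : expansion x = expansion y -> x = y.
Proof. exact: fmorph_inj. Qed.

Lemma laurent_derivD (x y : laurent C) :
  laurent_deriv (x + y) = laurent_deriv x + laurent_deriv y.
Proof. exact: raddfD. Qed.

Lemma simple_poles_cons i l :
  simple_poles (i :: l) = rc i.1 / lin i.2 + simple_poles l.
Proof. by rewrite /simple_poles big_cons. Qed.

(** A summand $c/(t-\alpha)$ becomes $c R'/(R-\alpha)$, a multiple of the logarithmic derivative of
    $R-\alpha$. *)
Lemma pullback_simple_poles l : exists z, has_simple_poles z /\
  tofrac (ps_deriv s) * laurent_comp s (expansion (simple_poles l)) = expansion z.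
Proof.
have rho : tofrac (ps_deriv s) = expansion (ratfun_deriv R).
  by rewrite -expansion_deriv R_lead laurent_deriv_tofrac.
elim: l => [|[c al] l [z [Hz ez]]].
  exists 0; split; first exact: simple_poles0.
  rewrite /simple_poles big_nil (rmorph0 (@expansion C) : expansion 0 = 0).
  have -> : laurent_comp s 0 = 0 := rmorph0 (laurent_comp_rmorphism s0 sn0).
  exact: mulr0.
(* If [R] were the constant [al], then [s] would be a constant series without constant term, hence
   0. *)
have Ral : R - rc al != 0.
  apply/eqP => /eqP; rewrite subr_eq0 => /eqP eR.
  have /eqP := R_lead; rewrite eR expansion_tofrac tofrac_eq => /eqP es.
  have al0 : al = 0.
    by have := congr1 (fun f => pscoef f 0) es; rewrite /= s0 pscoef_poly coefC.
  by case/eqP: sn0; rewrite -es al0.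
have eL : laurent_comp s (expansion (lin al)) = expansion (R - rc al).
  rewrite expansion_tofrac laurent_comp_tofrac // rmorphB ps_comp_zmod ps_compX // ps_compC //.
  rewrite tofracB -R_lead -expansion_tofrac.
  exact/esym/(rmorphB (@expansion C)).
have dR : ratfun_deriv (R - rc al) = ratfun_deriv R.
  have -> : R - rc al = R + rc (- al) by rewrite polyCN tofracN.
  by rewrite ratfun_derivD ratfun_deriv_tofrac derivC tofrac0 addr0.
exists (rc c * (ratfun_deriv (R - rc al) / (R - rc al)) + z); split.
  by apply: simple_polesD => //; apply/simple_polesZ/log_derivative_simple_poles.
rewrite simple_poles_cons expansionD laurent_compD // mulrDr ez expansionD; congr (_ + _).
rewrite expansion_quotient laurent_compM // laurent_compV // eL dR.
rewrite (expansion_tofrac c%:P) laurent_comp_tofrac // ps_compC // -(expansion_tofrac c%:P).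
by rewrite expansionM expansion_quotient rho mulrCA.
Qed.

(** The factor [psX] absorbs the pole at 0; the other summands are units of the power series ring,
    inverted. *)
Lemma simple_poles_series l : exists w,
  tofrac psX * expansion (simple_poles l) = tofrac w.
Proof.
elim: l => [|[c al] l [w ew]].
  exists 0; rewrite /simple_poles big_nil (rmorph0 (@expansion C) : expansion 0 = 0).
  by rewrite mulr0 tofrac0.
have [v ev] : exists v, tofrac psX / tofrac (ps_of_poly ('X - al%:P)) = tofrac v :> laurent C.
  have [->|al0] := eqVneq al 0.
    by exists 1; rewrite subr0 divff ?tofrac1 // tofrac_eq0 psX_neq0.
  have q0 : pscoef (ps_of_poly ('X - al%:P)) 0 != 0.
    by rewrite pscoef_poly coefB coefX coefC sub0r oppr_eq0.
  have [g gq] := ps_invertible q0; exists (psX * g).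
  have Q0 : tofrac (ps_of_poly ('X - al%:P)) != 0 :> laurent C.
    by rewrite tofrac_eq0; apply: contraNneq q0 => ->; rewrite pscoef0.
  by apply: (canLR (mulfK Q0)); rewrite -tofracM -mulrA gq mulr1.
exists (psc c * v + w); rewrite simple_poles_cons expansionD mulrDr ew.
rewrite (tofracD (psc c * v) w) (tofracM (psc c) v) -ev expansion_quotient.
rewrite (expansion_tofrac c%:P) (expansion_tofrac ('X - al%:P)).
exact: (congr1 (fun x => x + tofrac w) (mulrCA _ _ _)).
Qed.

(** Differentiation followed by multiplication by [t] keeps the order of a pole. With [v = 1 / x] $=
    t^{n+1} g$ the hypothesis reads $w v^2 + t v' = 0$, whose coefficient at $t^{n+1}$ is $(n+1)
    g_0$, a nonzero number. *)
Lemma series_of_simple_pole_deriv (x : laurent C) w :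
  tofrac psX * laurent_deriv x = tofrac w -> exists f, x = tofrac f.
Proof.
have [->|x0] := eqVneq x 0; first by exists 0; rewrite tofrac0.
have [n [g [g0 [ex _|ex]]]] := laurent_or_inverse x0; first by exists (psX ^+ n * g).
case: n ex => [|n] ex.
  rewrite expr0 mul1r in ex; have [h hg] := ps_invertible g0.
  move=> _; exists h; rewrite -[x]invrK ex; apply: mulr1_eq.
  by rewrite -tofracM mulrC hg tofrac1.
have [v vE] : exists v, v = psX ^+ n.+1 * g by exists (psX ^+ n.+1 * g).
rewrite -vE in ex => ew.
have xV : x * tofrac v = 1 by rewrite -ex divff.
have leib : laurent_deriv x * tofrac v + x * tofrac (ps_deriv v) = 0.
  rewrite -laurent_deriv_tofrac -laurent_derivM xV -tofrac1.
  exact: (laurent_deriv_const (1 : C)).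
have eq0 : w * v ^+ 2 + psX * ps_deriv v = 0.
  apply/eqP; rewrite -tofrac_eq0 (tofracD (w * v ^+ 2)) (tofracM w) (tofracM psX).
  rewrite (tofracXn 2 v) -ew; apply/eqP.
  exact: leibniz_clear xV leib.
have dv : psX * ps_deriv v = psX ^+ n.+1 * (g *+ n.+1 + psX * ps_deriv g).
  have dX : ps_deriv psX = 1 by rewrite ps_deriv_poly derivX.
  by rewrite vE ps_derivM ps_deriv_exp dX exprS; ring.
have : psX ^+ n.+1 * (psX ^+ n.+1 * (w * g ^+ 2) + (g *+ n.+1 + psX * ps_deriv g)) = 0.
  by rewrite -eq0 dv vE; ring.
move=> /eqP; rewrite mulf_eq0 expf_eq0 (negbTE (psX_neq0 C)) andbF /= => /eqP.
move=> /(congr1 (fun f => pscoef f 0)); rewrite !pscoefD pscoefXnM /= add0r.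
rewrite pscoef0M pscoef_poly coefX mul0r addr0 pscoef0 -mulr_natr pscoef0M.
have -> : pscoef (n.+1%:R : pseries C) 0 = n.+1%:R.
  by rewrite -(rmorph_nat (@ps_of_poly C)) pscoef_poly -polyC_natr coefC.
by move/eqP; rewrite mulf_eq0 (negbTE g0) pnatr_eq0.
Qed.

Hypothesis ord : (1 < d)%N \/ (forall n, (0 < n)%N -> ps_iter s n != psX).

Lemma rational_of_rational_deriv (f : laurent C) (a b : ratfun C) :
  laurent_deriv f = expansion a -> laurent_comp s f = f + expansion b ->
  exists g, f = expansion g.
Proof.
move=> df fb; have [h [y [[l ely] ea]]] := deriv_plus_simple_poles a.
pose f1 := f + expansion (- h).
have df1 : laurent_deriv f1 = expansion y.
  rewrite /f1 laurent_derivD df expansion_deriv ea -expansionD addrAC.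
  rewrite -ratfun_derivD subrr.
  by rewrite (raddf0 (@ratfun_deriv C) : ratfun_deriv 0 = 0) add0r.
pose b1 := b + ratfun_comp (- h) R + h.
have f1b : laurent_comp s f1 = f1 + expansion b1.
  rewrite /f1 laurent_compD // fb -(expansion_ratfun_comp s0 sn0 R_lead).
  rewrite /b1 (expansionD (b + ratfun_comp (- h) R) h) (expansionD b).
  apply: add_sub_shift; rewrite -expansionD addNr.
  exact: (rmorph0 (@expansion C)).
have [z [Hz ez]] := pullback_simple_poles l.
have db1 : ratfun_deriv b1 = z - y.
  apply: (canRL (addrK y)); apply: expansion_inj.
  rewrite expansionD -expansion_deriv -df1 addrC -laurent_derivD -f1b.
  by rewrite laurent_chain_rule // df1 ely ez.
have [c eb1] : exists c, b1 = rc c.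
  apply: deriv_simple_poles_const; rewrite db1; apply: simple_polesD => //.
  by apply: simple_polesN; exists l.
have [w ew] := simple_poles_series l.
have [F eF] : exists F, f1 = tofrac F.
  by apply: (series_of_simple_pole_deriv (w := w)); rewrite df1 ely.
have compF : ps_comp s F = F + psc c.
  apply/eqP; rewrite -tofrac_eq -laurent_comp_tofrac // -eF f1b eb1 eF.
  by rewrite expansion_tofrac tofracD.
have c0 : c = 0.
  have := congr1 (fun f => pscoef f 0) compF.
  rewrite /= pscoef0_comp pscoefD (pscoef_poly c%:P) coefC /= => /eqP.
  by rewrite -subr_eq0 opprD addrA subrr sub0r oppr_eq0 => /eqP.
have compF0 : ps_comp s F = F by rewrite compF c0 polyC0 addr0.
have eFc := ps_fixed d_gt0 r_neq0 u0 ord compF0.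
exists (h + rc (pscoef F 0)); rewrite expansionD expansion_tofrac -eFc -eF /f1.
by rewrite addrCA -expansionD subrr (rmorph0 (@expansion C) : expansion 0 = 0) addr0.
Qed.

End RationalPrimitive.

(** * From differential relations to towers *)

Section Image.
Variables (K F : fieldType) (iota : {rmorphism K -> F}).

Definition image_pred : {pred F} := fun x => `[< exists a, x = iota a >].

Lemma imageP x : reflect (exists a, x = iota a) (x \in image_pred).
Proof. exact: asboolP. Qed.

Fact image_divring_closed : divring_closed image_pred.
Proof.
split=> [|_ _ /imageP[a ->] /imageP[b ->]|_ _ /imageP[a ->] /imageP[b ->]].
- by apply/imageP; exists 1; rewrite rmorph1.
- by apply/imageP; exists (a - b); rewrite rmorphB.
- by apply/imageP; exists (a / b); rewrite fmorph_div.
Qed.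
HB.instance Definition _ :=
  GRing.isDivringClosed.Build F image_pred image_divring_closed.

Definition image : divringClosed F := image_pred.

End Image.

Lemma mmap_comp (A B E : fieldType) (f : {rmorphism A -> B}) (g : {rmorphism B -> E})
  n (h : 'I_n -> B) (h' : 'I_n -> E) (P : mpoly n A) :
  (forall i, h' i = g (h i)) -> mmap (g \o f) h' P = g (mmap f h P).
Proof.
move=> hh; rewrite /mmap rmorph_sum; apply: eq_bigr => m _; rewrite rmorphM /=.
congr (_ * _); rewrite /mmap1 rmorph_prod; apply: eq_bigr => i _.
by rewrite hh rmorphXn.
Qed.

Section Embedding.
Variables (C : numClosedFieldType) (s : pseries C) (R b : ratfun C) (f : laurent C).
Hypotheses (s0 : pscoef s 0 = 0) (sn0 : s != 0) (R_s : expansion R = tofrac s).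
Hypothesis f_eq : laurent_comp s f = f + expansion b.
Variables (F : fieldType) (j : {rmorphism laurent C -> F}).
Variables (D : {additive F -> F}) (S : {rmorphism F -> F}) (psi : F).
Hypothesis DM : forall x y, D (x * y) = D x * y + x * D y.
Hypothesis Dj : forall x, D (j x) = j (laurent_deriv x).
Hypothesis Sj : forall x, S (j x) = j (laurent_comp s x).
Hypothesis DS : forall x, D (S x) = j (tofrac (ps_deriv s)) * S (D x).
Hypothesis fixS : forall x, S x = x -> exists c, x = j (tofrac (ps_of_poly c%:P)).
Hypothesis Spsi : S psi = D (j (expansion R)) * psi.
Hypothesis psi_dt : diff_transcendental (j \o @expansion C) D psi.

(** The dichotomy takes place in [F], where [psi] lives. Its outcome descends to Laurent series
    because [j] is injective and commutes with the derivations. *)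
Lemma diff_transcendental_or_rational_deriv :
  diff_transcendental (@expansion C) (@laurent_deriv C) f \/
  exists a, laurent_deriv f = expansion a.
Proof.
pose iota : {rmorphism ratfun C -> F} := j \o @expansion C.
pose k := image iota; have kP := imageP iota.
have DR : D (j (expansion R)) = j (tofrac (ps_deriv s)).
  by rewrite Dj R_s laurent_deriv_tofrac.
(* Otherwise [S psi = 0], hence [psi = 0] as [S] is injective, against the transcendence of
   [psi]. *)
have rho_neq0 : j (tofrac (ps_deriv s)) != 0.
  apply/eqP => rho0; have psi0 : psi = 0.
    by apply: (fmorph_inj S); rewrite Spsi DR rho0 mul0r rmorph0.
  have tr := transc_of_mmap_neq0 kP (s := fun i => iter i D psi) psi_dt.
  have := transc_notin (@tr 0); rewrite /= psi0.
  by rewrite (rpred0 k).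
have Dk x : x \in k -> D x \in k.
  move=> /kP[a ->]; apply/kP; exists (ratfun_deriv a).
  by rewrite /= Dj expansion_deriv.
have Sk x : x \in k -> S x \in k.
  move=> /kP[a ->]; apply/kP; exists (ratfun_comp a R).
  by rewrite /= Sj (expansion_ratfun_comp s0 sn0 R_s).
have fixk x : S x = x -> x \in k.
  by move=> /fixS[c ->]; apply/kP; exists (tofrac c%:P); rewrite /= expansion_tofrac.
have k_rho : j (tofrac (ps_deriv s)) \in k.
  rewrite -DR; apply: Dk; apply/kP; by exists R.
have Sf : S (j f) = j f + j (expansion b) by rewrite Sj f_eq rmorphD.
have F0 n : n.+1%:R != 0 :> F.
  rewrite -(rmorph_nat j) fmorph_eq0; apply: laurent_natr_neq0.
  by move=> m; rewrite pnatr_eq0.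
have k_b : j (expansion b) \in k by apply/kP; exists b.
have Spsi' : S psi = j (tofrac (ps_deriv s)) * psi by rewrite Spsi DR.
have tr := transc_of_mmap_neq0 kP (s := fun i => iter i D psi) psi_dt.
have [tf|/kP[a]] := transc_or_derivation_mem F0 DM Dk Sk fixk k_rho rho_neq0 DS Spsi' k_b Sf tr.
  left=> n P P0; have := mmap_neq0_of_transc kP tf P0.
  have iterE i : iter i D (j f) = j (iter i (@laurent_deriv C) f).
    by elim: i => //= i ->.
  apply: contraNneq => P_f0; apply/eqP.
  apply: etrans (@mmap_comp _ _ _ (@expansion C) j n.+1
    (fun i => iter i (@laurent_deriv C) f) (fun i => iter i D (j f)) P _) _.
    by move=> i; apply: iterE.
  by rewrite P_f0 rmorph0.
by rewrite Dj => /fmorph_inj da; right; exists a.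
Qed.

End Embedding.

Theorem theoremE (K : realType) (R : ratfun K[i])
  (R_at0 : vanishes_at0 R) (R_neq0 : R != 0)
  (R_iter : forall n, (0 < n)%N -> ratfun_iter n R != ratfunX K[i])
  (d : nat) (r : K[i]) (u : pseries K[i])
  (d_ge1 : (1 <= d)%N) (r_neq0 : r != 0) (u_at0 : pscoef u 0 = 0)
  (R_lead : expansion R = tofrac (leading_form d r u))
  (lambda : K[i]) (lambda_log : (2 <= d)%N -> cexp lambda = r)
  (Psi_ex : exists Psi : FR d r u lambda,
    sf_subst Psi = sf_deriv (sf_laurent (FR d r u lambda) (expansion R)) * Psi /\
    diff_transcendental (sf_laurent (FR d r u lambda) \o @expansion K[i])
      (@sf_deriv _ (FR d r u lambda)) Psi)
  (b : ratfun K[i]) (f : laurent K[i])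
  (f_eq : laurent_comp (leading_form d r u) f = f + expansion b) :
  (exists g : ratfun K[i], f = expansion g) \/
  diff_transcendental (@expansion K[i]) (@laurent_deriv K[i]) f.
Proof.
have s0 := leading_form0 r u d_ge1.
have sn0 : leading_form d r u != 0 by apply: leading_form_neq0.
(* Iterates of [R] expand to iterates of the series, and the expansion is injective. *)
have ord : (1 < d)%N \/
    (forall n, (0 < n)%N -> ps_iter (leading_form d r u) n != ps_of_poly 'X).
  right=> n n_gt0; have [_ iterE] := expansion_ratfun_iter n s0 sn0 R_lead.
  apply: contraNneq (R_iter n n_gt0) => e; apply/eqP/expansion_inj.
  by rewrite iterE e expansion_ratfunX.
suff [|[a da]] : diff_transcendental (@expansion K[i]) (@laurent_deriv K[i]) f \/
    exists a, laurent_deriv f = expansion a; first by right.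
  left; exact: (rational_of_rational_deriv d_ge1 r_neq0 u_at0 R_lead ord da f_eq).
move: Psi_ex; rewrite /FR; case: ifP => [_|/negbT d_neq1] [Psi [Psi_eq Psi_dt]].
  apply: (diff_transcendental_or_rational_deriv s0 sn0 R_lead f_eq (j := idfun)
    (D := @laurent_deriv K[i]) (S := laurent_comp_rmorphism s0 sn0) _ _ _ _ _ Psi_eq Psi_dt) => //.
  - exact: laurent_derivM.
  - exact: laurent_chain_rule.
  - by move=> x; apply: laurent_fixed.
have d_gt1 : (1 < d)%N by rewrite ltn_neqAle eq_sym d_neq1.
have C0 n : n.+1%:R != 0 :> K[i] by rewrite pnatr_eq0.
apply: (diff_transcendental_or_rational_deriv s0 sn0 R_lead f_eq
  (j := (@tofrac {poly laurent K[i]} \o polyC : {rmorphism _ -> _}))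
  (D := @laurent_log_deriv K[i])
  (S := laurent_log_comp_rmorphism C0 lambda d_ge1 r_neq0 u_at0) _ _ _ _ _ Psi_eq Psi_dt).
- exact: laurent_log_derivM.
- by move=> x; rewrite /= laurent_log_deriv_tofrac log_poly_derivC.
- move=> x; rewrite /= (laurent_log_comp_tofrac C0 lambda d_ge1 r_neq0 u_at0).
  by rewrite log_poly_compE map_polyC comp_polyC.
- exact: laurent_log_chain_rule.
- move=> x; exact: laurent_log_fixed.
Qed.
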